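(* Let $n\geqslant 2$, and let $n_1,\ldots,n_r\geqslant 1$ be integers with $r\geqslant 2$ and $n_1+\cdots+n_r=n$. The equivariant embedding of $\mathrm{SO}_n(\mathbb{R})/\mathrm{S}(\mathrm{O}_{n_1}(\mathbb{R})\times\cdots\times\mathrm{O}_{n_r}(\mathbb{R}))$ of minimal dimension is the (traceless) isospectral model. That is, among all finite-dimensional real representations $V$ of $\mathrm{SO}_n(\mathbb{R})$ containing a vector whose stabilizer is exactly $\mathrm{S}(\mathrm{O}_{n_1}(\mathbb{R})\times\cdots\times\mathrm{O}_{n_r}(\mathbb{R}))$, the minimal dimension is attained by $\mathrm{Sym}_n^{tr=0}(\mathbb{R})$, which has dimension $(n+2)(n-1)/2$, and every such $V$ of minimal dimension is isomorphic to $\mathrm{Sym}_n^{tr=0}(\mathbb{R})$ as a representation of $\mathrm{SO}_n(\mathbb{R})$.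
   Context: $\mathrm{S}(\mathrm{O}_{n_1}(\mathbb{R})\times\cdots\times\mathrm{O}_{n_r}(\mathbb{R}))$ denotes the subgroup of $\mathrm{SO}_n(\mathbb{R})$ of block diagonal matrices with diagonal blocks in $\mathrm{O}_{n_1}(\mathbb{R}),\ldots,\mathrm{O}_{n_r}(\mathbb{R})$ and total determinant $1$. For a compact Lie group $G$ acting smoothly on a manifold $M$, a $G$-equivariant embedding of $M$ of dimension $N$ is a smooth embedding $e:M\to\mathbb{R}^N$ together with a Lie group representation $\rho:G\to\mathrm{O}(N)$ such that $\rho(g)\circ e=e\circ g$ for all $g\in G$. For $M=G/K$ with $K$ a closed subgroup, giving a $G$-equivariant embedding amounts to giving a finite-dimensional real representation $V$ of $G$ with a vector $v\in V$ whose stabilizer is exactly $K$. The (traceless) isospectral model is the real representation $\mathrm{Sym}_n^{tr=0}(\mathbb{R})=\{T\in M_n(\mathbb{R}): T^t=T,\ \mathrm{tr}\,T=0\}$ of $\mathrm{SO}_n(\mathbb{R})$ with action $A\cdot T=ATA^t$. *)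

(* Defs.v *)
From HB Require Import structures.
From mathcomp Require Export all_boot all_order all_algebra.
From mathcomp Require Export all_classical all_reals all_analysis.

Set Implicit Arguments.
Unset Strict Implicit.
Unset Printing Implicit Defensive.

Export Order.TTheory GRing.Theory Num.Theory numFieldNormedType.Exports.
Local Open Scope classical_set_scope.
Local Open Scope ring_scope.

Definition orthogonal_group (R : realType) (n : nat) : set 'M[R]_n :=
  [set A | A *m A^T = 1%:M].

Definition special_orthogonal_group (R : realType) (n : nat) : set 'M[R]_n :=
  [set A | orthogonal_group A /\ \det A = 1].

Definition special_block_orthogonal_group (R : realType) (n r : nat)
    (p : 'I_r -> nat) (sum_p : (\sum_(i < r) p i)%N = n) : set 'M[R]_n :=
  [set A | (exists B : forall i : 'I_r, 'M[R]_(p i),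
              (forall i, orthogonal_group (B i)) /\
              A = castmx (sum_p, sum_p) (\mxdiag_(i < r) B i))
           /\ \det A = 1].

(* The map [rho] is defined on all matrices, but only its values on SO_n are
   constrained or used.  GL(V) carries the topology of the matrices in a basis
   of V; a continuous homomorphism between Lie groups is automatically smooth,
   so these are the Lie group representations of SO_n. *)
Definition is_SO_representation (R : realType) (n : nat) (V : vectType R)
    (rho : 'M[R]_n -> 'End(V)) : Prop :=
  [/\ rho 1%:M = \1%VF,
      forall A B, special_orthogonal_group A -> special_orthogonal_group B ->
        rho (A *m B) = (rho A \o rho B)%VF
    & {within @special_orthogonal_group R n,
        continuous (fun A : 'M[R]_n =>
          passmx.mxof (vbasis fullv) (vbasis fullv) (rho A))}].

Definition stabilizer (R : realType) (n : nat) (V : vectType R)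
    (rho : 'M[R]_n -> 'End(V)) (v : V) : set 'M[R]_n :=
  [set A | special_orthogonal_group A /\ rho A v = v].

Definition SO_isomorphic (R : realType) (n : nat) (V W : vectType R)
    (rho : 'M[R]_n -> 'End(V)) (sigma : 'M[R]_n -> 'End(W)) : Prop :=
  exists2 phi : 'Hom(V, W), bijective phi &
    forall A v, special_orthogonal_group A -> phi (rho A v) = sigma A (phi v).

Definition traceless_sym (R : realType) (n : nat) : {vspace 'M[R]_n} :=
  (lker (linfun (fun T : 'M[R]_n => T^T - T))
   :&: lker (linfun (mxtrace : 'M[R]_n -> R^o)))%VS.

Lemma mem_traceless_sym (R : realType) (n : nat) (T : 'M[R]_n) :
  (T \in traceless_sym R n) = (T^T == T) && (\tr T == 0).
Proof.
pose f : 'M[R]_n -> 'M[R]_n := fun T => T^T - T.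
have lf : linear f by move=> a u v; rewrite /f linearP scalerBr opprD addrACA.
pose F : {linear 'M[R]_n -> 'M[R]_n} :=
  HB.pack f (GRing.isLinear.Build _ _ _ _ f lf).
pose t : 'M[R]_n -> R^o := mxtrace.
have lt : linear t by move=> a u v; rewrite /t linearP.
pose G : {linear 'M[R]_n -> R^o} :=
  HB.pack t (GRing.isLinear.Build _ _ _ _ t lt).
rewrite memv_cap !memv_ker.
by rewrite (lfunE F) (lfunE G) /= /f subr_eq0.
Qed.

(* [vsproj] only restricts the codomain: A T A^T lies in [traceless_sym]
   whenever A is orthogonal and T lies in [traceless_sym]. *)
Definition isospectral_model (R : realType) (n : nat) (A : 'M[R]_n) :
    'End(subvs_of (traceless_sym R n)) :=
  linfun (fun T : subvs_of (traceless_sym R n) =>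
            vsproj (traceless_sym R n) (A *m vsval T *m A^T)).

Lemma isospectral_modelE (R : realType) (n : nat) (A : 'M[R]_n)
    (T : subvs_of (traceless_sym R n)) :
  special_orthogonal_group A ->
  vsval (isospectral_model A T) = A *m vsval T *m A^T.
Proof.
move=> [AAT _].
pose f := fun T : subvs_of (traceless_sym R n) =>
            vsproj (traceless_sym R n) (A *m vsval T *m A^T).
have lf : linear f.
  move=> a u v; rewrite /f (linearP (vsval : _ -> 'M[R]_n)).
  by rewrite mulmxDr mulmxDl -scalemxAr -scalemxAl (linearP (vsproj _)).
pose F : {linear subvs_of (traceless_sym R n) -> _} :=
  HB.pack f (GRing.isLinear.Build _ _ _ _ f lf).
rewrite /isospectral_model (lfunE F) /= /f vsprojK //.
have /[!mem_traceless_sym]/andP[/eqP sT /eqP tT] := subvsP T.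
rewrite !trmx_mul trmxK sT mulmxA eqxx /=.
by rewrite mxtrace_mulC mulmxA (mulmx1C AAT) mul1mx tT.
Qed.

(* Main.v *)
From HB Require Import structures.
Require Import Defs.
From mathcomp Require Import perm ring lra zify.

Set Implicit Arguments.
Unset Strict Implicit.
Unset Printing Implicit Defensive.
Local Open Scope classical_set_scope.
Local Open Scope ring_scope.

(** Let Sym_0 be the space of traceless symmetric matrices and K the block
    subgroup S(O x ... x O).  A traceless diagonal matrix whose entries separate
    the blocks has stabilizer K ([diagonal_model_vector]), so Sym_0 is one of the
    representations in question.  What has to be shown is that a representation
    V with [dim V <= (n + 2)(n - 1)/2 = dim Sym_0] and a vector v of stabilizer
    exactly K receives an injective equivariant linear map from Sym_0
    ([model_embeds]); minimality and uniqueness are then dimension counts.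
    Rather than by a classification of the representations of SO_n, the map is
    built from v.

    A continuous representation restricted to the rotations of an oriented
    plane is differentiable ([one_parameter_derivable0]), so there are
    infinitesimal generators [E i j] of the coordinate planes, and they satisfy
    the commutation relations of so(n) ([gen_bracket], [gen_comm]).

    Let W be the space of vectors fixed by the diagonal matrices of SO_n; v lies
    in W since K contains them.  The quarter turns of the coordinate planes act
    on W as the transpositions of the indices.  The generator [E i j] maps W
    into the space [Uv i j] of vectors on which a diagonal matrix with entries
    d acts by [d i * d j].  These characters are distinct if n is not 4, and the
    spaces [Uv i j] have the same dimension, so that
    [1 + dim (Uv i j) * n (n - 1)/2 <= dim V] forces dimension at most one:
    every generator has rank one on W ([rank_one_generic]).  For n = 4 a pair
    and the complementary pair have the same character, and the splitting of
    so(4) into two copies of so(3) replaces the count ([rank_one_four]).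

    Since the circle is compact, a generator of rank one makes the quarter turn
    act on W as a reflection ([reflectionP]).  As v is moved by enough products
    of quarter turns, W contains pairwise distinct vectors [w i] that the quarter
    turns permute like the indices ([standard_vector]).  The commutation relations then force
    [E i j (E i j (w i)) = -2 (w i - w j)], and the vectors
    [om i i = 2 w i], [om i j = E i j (w i)] are transformed by the generators
    as the matrices [e_i e_j^T + e_j e_i^T] are ([reflections_sym_system]).
    For n = 2 the vectors v and - v serve as the [w i] ([SO2_sym_system]).

    Consequently [T |-> \sum_ij T i j om i j] is equivariant under the
    generators, hence under the coordinate rotations by uniqueness for linear
    differential equations, hence under SO_n, which they generate
    ([SO_crot_ind], [model_map_SO]).  Its kernel is invariant, and no
    traceless symmetric matrix other than 0 can belong to it
    ([model_map_injective]). *)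

(** * Derivatives of matrix-valued functions *)

Section MatrixDerivative.
Variable R : realType.

Definition mx_derive (a b : nat) (F : R -> 'M[R]_(a, b)) (t : R)
    (D : 'M[R]_(a, b)) : Prop :=
  forall i j, is_derive t (1 : R) (fun x => F x i j) (D i j).

Lemma mx_derive_cst a b (A : 'M[R]_(a, b)) t : mx_derive (fun=> A) t 0.
Proof. by move=> i j; rewrite mxE; exact: is_derive_cst. Qed.

Lemma mx_derive_eq a b (F : R -> 'M[R]_(a, b)) t D D' :
  mx_derive F t D -> D = D' -> mx_derive F t D'.
Proof. by move=> h <-. Qed.

Lemma mx_derive_unique a b (F : R -> 'M[R]_(a, b)) t D D' :
  mx_derive F t D -> mx_derive F t D' -> D = D'.
Proof.
move=> h h'; apply/matrixP => i j.
by have [_ <-] := h i j; have [_ <-] := h' i j.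
Qed.

Lemma mx_derive_ext a b (F G : R -> 'M[R]_(a, b)) t D :
  (forall x, F x = G x) -> mx_derive F t D -> mx_derive G t D.
Proof. by move=> /funext ->. Qed.

Lemma mx_derive_near a b (F G : R -> 'M[R]_(a, b)) t D :
  (\near t, F t = G t) -> mx_derive F t D -> mx_derive G t D.
Proof.
move=> FG dF i j; apply: near_eq_is_derive (dF i j).
by near=> x; rewrite (near FG x).
Unshelve. all: by end_near. Qed.

Lemma mx_deriveM a b c (F : R -> 'M[R]_(a, b)) (G : R -> 'M[R]_(b, c)) t D D' :
  mx_derive F t D -> mx_derive G t D' ->
  mx_derive (fun x => F x *m G x) t (F t *m D' + D *m G t).
Proof.
move=> dF dG i j; rewrite !mxE -big_split /=.
have -> : (fun x => (F x *m G x) i j) =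
    \sum_(k < b) ((fun x => F x i k) * (fun x => G x k j)).
  by apply/funext => x; rewrite mxE fct_sumE.
apply: is_derive_sum => k.
have := is_deriveM (dF i k) (dG k j).
by move=> h; apply: is_derive_eq h _; rewrite /GRing.scale /= [X in _ + X]mulrC.
Qed.

Lemma mx_deriveMl a b c (A : 'M[R]_(a, b)) (G : R -> 'M[R]_(b, c)) t D :
  mx_derive G t D -> mx_derive (fun x => A *m G x) t (A *m D).
Proof.
move=> dG; apply: mx_derive_eq (mx_deriveM (mx_derive_cst A t) dG) _.
by rewrite mul0mx addr0.
Qed.

Lemma mx_deriveMr a b c (F : R -> 'M[R]_(a, b)) (A : 'M[R]_(b, c)) t D :
  mx_derive F t D -> mx_derive (fun x => F x *m A) t (D *m A).
Proof.
move=> dF; apply: mx_derive_eq (mx_deriveM dF (mx_derive_cst A t)) _.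
by rewrite mulmx0 add0r.
Qed.

Lemma mx_deriveD a b (F G : R -> 'M[R]_(a, b)) t D D' :
  mx_derive F t D -> mx_derive G t D' ->
  mx_derive (fun x => F x + G x) t (D + D').
Proof.
move=> dF dG i j; rewrite mxE.
have -> : (fun x => (F x + G x) i j) = (fun x => F x i j) + (fun x => G x i j).
  by apply/funext => x; rewrite mxE.
exact: is_deriveD.
Qed.

Lemma mx_deriveZ a b (f : R -> R) (A : 'M[R]_(a, b)) t d :
  is_derive t (1 : R) f d -> mx_derive (fun x => f x *: A) t (d *: A).
Proof.
move=> df i j; rewrite mxE.
have -> : (fun x => (f x *: A) i j) = f * cst (A i j).
  by apply/funext => x; rewrite mxE.
apply: is_derive_eq (is_deriveM df (is_derive_cst (A i j) _ _)) _.
by rewrite scaler0 add0r /GRing.scale /= mulrC.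
Qed.

Lemma mx_derive_comp a b (F : R -> 'M[R]_(a, b)) (f : R -> R) t D d :
  mx_derive F (f t) D -> is_derive t (1 : R) f d ->
  mx_derive (fun x => F (f x)) t (d *: D).
Proof.
move=> dF df i j; rewrite mxE mulrC.
exact: (@is_derive1_comp R (fun x => F x i j) f t _ _ (dF i j) df).
Qed.

Lemma mx_derive0_cst a b (F : R -> 'M[R]_(a, b)) s t :
  (forall x, mx_derive F x 0) -> F s = F t.
Proof.
move=> dF; apply/matrixP => i j.
apply: (@is_derive_0_is_cst R (fun x => F x i j)) => x.
by have := dF x i j; rewrite mxE.
Qed.

Lemma is_derive_addl (c x : R) : is_derive x (1 : R) (fun x => c + x) 1.
Proof.
exact: is_derive_eq (is_deriveD (is_derive_cst c x 1) (is_derive_id x 1))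
  (add0r _).
Qed.

Lemma cvg_det n (T : Type) (F : set_system T) (FF : ProperFilter F)
    (A : T -> 'M[R]_n) (B : 'M[R]_n) :
  (forall i j, A x i j @[x --> F] --> B i j) -> \det (A x) @[x --> F] --> \det B.
Proof.
move=> h; rewrite /determinant.
apply: (cvg_big (op := +%R) (x0 := 0)); first exact: add_continuous.
move=> s _; apply: cvgM; first exact: cvg_cst.
have := @cvg_big R 'I_n *%R 1 xpredT (@mul_continuous R) T F
  (index_enum 'I_n) (fun i x => A x i (s i)) (fun i => B i (s i)) _ (fun i _ => h i (s i)).
exact.
Qed.

(** The primitive is an integral from the left end of an interval, which therefore
    has to contain 0 in its interior. *)
Lemma continuous_primitive (f : R -> R) : continuous f ->
  exists F : R -> R, forall x : R, -1 < x < 2 -> is_derive x (1 : R) F (f x).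
Proof.
move=> cf.
exists (fun x => (\int[lebesgue_measure]_(t in `[(-1 : R), x]) f t)%R) => x /andP[x1 x2].
have [] := @continuous_FTC1_closed R f (-1) x 2 x2 _ x1 (cf x).
  apply: continuous_compact_integrable; first exact: segment_compact.
  exact: continuous_subspaceT.
by move=> d e; split; [exact: d | rewrite -e derive1E].
Qed.

End MatrixDerivative.

(** * One-parameter groups of matrices *)

Section OneParameter.
Variables (R : realType) (N : nat) (S : R -> 'M[R]_N).
Hypothesis S0 : S 0 = 1%:M.
Hypothesis SD : forall s t, S (s + t) = S s *m S t.
Hypothesis cS : forall i j, continuous (fun t => S t i j).

(** If [P] is a primitive of [S], then [S t (P h - P 0) = P (t + h) - P t],
    and [P h - P 0] is invertible for small [h], so [S] is as regular as [P]. *)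
Lemma one_parameter_derivable0 : exists E : 'M[R]_N, mx_derive S 0 E.
Proof.
have /choice[P0 dP0] : forall ij : 'I_N * 'I_N, exists F : R -> R,
    forall x : R, -1 < x < 2 -> is_derive x (1 : R) F (S x ij.1 ij.2).
  by move=> ij; apply: continuous_primitive; exact: cS.
pose P x := \matrix_(i, j) P0 (i, j) x : 'M[R]_N.
have dP x : -1 < x < 2 -> mx_derive P x (S x).
  move=> hx i j; have := dP0 (i, j) x hx.
  by congr (is_derive _ _ _ _); apply/funext => y; rewrite mxE.
have [h [h0 h1 hU]] : exists h : R, [/\ 0 < h, h < 1 & \det (P h - P 0) != 0].
  have cP : \det (h^-1 *: (P h - P 0)) @[h --> (0 : R)^'] --> (1 : R).
    rewrite -[X in _ --> X](det1 R N) -S0; apply: cvg_det => i j.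
    have [d e] := dP 0 ltac:(lra) i j.
    have : (fun h => h^-1 *: (P (h *: 1 + 0) i j - P 0 i j)) @ (0 : R)^' --> S 0 i j.
      by rewrite -e; exact: d.
    apply: cvg_trans; apply: near_eq_cvg; near=> h.
    by rewrite !mxE /= addr0 /GRing.scale /= mulr1.
  have : \forall h \near (0:R)^', \det (h^-1 *: (P h - P 0)) != 0.
    by apply: (cvgr_neq0 (1 : R)); [exact: cP | exact: oner_neq0].
  rewrite near_withinE => hn.
  have /nbhs_ballP[e /= e0 he] := hn.
  have m0 : 0 < Num.min e 1 by rewrite lt_min e0 ltr01.
  have [me m1] : Num.min e 1 <= e /\ Num.min e 1 <= 1.
    by split; rewrite ge_min lexx ?orbT.
  pose h := Num.min e 1 / 2.
  have [hp h_e h_1] : [/\ 0 < h, h < e & h < 1] by rewrite /h; split; lra.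
  exists h; split=> //.
  have : \det (h^-1 *: (P h - P 0)) != 0.
    apply: he; last by rewrite gt_eqF.
    by rewrite /ball /= sub0r normrN gtr0_norm.
  by rewrite detZ mulf_eq0 negb_or => /andP[].
have PU : P h - P 0 \in unitmx by rewrite unitmxE unitfE.
have key t : -1 < t < 1 -> S t *m (P h - P 0) = P (t + h) - P t.
  move=> ht; pose F x := P (t + x) - S t *m P x.
  suff FF : F h = F 0.
    rewrite mulmxBr; move: FF; rewrite /F addr0 => /eqP.
    rewrite subr_eq => /eqP ->; apply/matrixP=> i j; rewrite !mxE; ring.
  have dF x : 0 <= x <= h -> mx_derive F x 0.
    move=> hx.
    have d1 : mx_derive (fun x => P (t + x)) x (S (t + x)).
      have -> : S (t + x) = (1 : R) *: S (t + x) by rewrite scale1r.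
      apply: (@mx_derive_comp R N N P (fun x => t + x) x).
        by apply: dP; lra.
      exact: is_derive_addl.
    have d2 : mx_derive (fun x => - S t *m P x) x (- S t *m S x).
      by apply: mx_deriveMl; apply: dP; lra.
    apply: mx_derive_eq; first apply: mx_derive_ext (mx_deriveD d1 d2).
      by move=> y; rewrite /F mulNmx.
    by rewrite SD mulNmx subrr.
  apply/matrixP => i j.
  have [||c _] := @MVT_segment R (fun x => F x i j) (fun=> 0) 0 h (ltW h0).
  - move=> x; rewrite in_itv /= => /andP[xa xb].
    by have := dF x ltac:(lra) i j; rewrite mxE.
  - apply: derivable_within_continuous => x; rewrite in_itv /= => hx.
    by have [] := dF x hx i j.
  by rewrite mul0r => /eqP; rewrite subr_eq0 => /eqP.
exists ((S h - S 0) *m invmx (P h - P 0)).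
apply: (@mx_derive_near _ _ _ (fun t => (P (t + h) - P t) *m invmx (P h - P 0))).
  near=> t; rewrite -key ?mulmxK//; apply/andP; split; near: t.
    by apply: lt_nbhsr; lra.
  by apply: lt_nbhsl; lra.
apply: mx_deriveMr; rewrite -[S 0]mul1mx.
have d1 : mx_derive (fun x => P (x + h)) 0 (S h).
  have -> : S h = (1 : R) *: S (h + 0) by rewrite scale1r addr0.
  apply: (mx_derive_ext (F := fun x => P (h + x))) => [x|].
    by rewrite addrC.
  apply: (@mx_derive_comp R N N P (fun x => h + x) 0); last exact: is_derive_addl.
  by apply: dP; lra.
have d2 : mx_derive (fun x => - 1%:M *m P x) 0 (- 1%:M *m S 0).
  by apply: mx_deriveMl; apply: dP; lra.
apply: mx_derive_eq; first apply: mx_derive_ext (mx_deriveD d1 d2).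
  by move=> y; rewrite mulNmx mul1mx.
by rewrite mulNmx.
Unshelve. all: by end_near. Qed.

Variable E : 'M[R]_N.
Hypothesis dS0 : mx_derive S 0 E.

Lemma one_parameter_derive t : mx_derive S t (E *m S t).
Proof.
apply: (mx_derive_ext (F := fun x => S (- t + x) *m S t)) => [x|].
  by rewrite -SD addrAC addNr add0r.
apply: mx_deriveMr; rewrite -[E]scale1r.
apply: (@mx_derive_comp R N N S (fun x => - t + x) t); last exact: is_derive_addl.
by rewrite addNr.
Qed.

Lemma one_parameter_comm t : S t *m E = E *m S t.
Proof.
have d1 : mx_derive (fun x => S (t + x)) 0 (S t *m E).
  by apply: mx_derive_ext (mx_deriveMl (S t) dS0) => x; rewrite SD.
have d2 : mx_derive (fun x => S (t + x)) 0 (E *m S t).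
  apply: mx_derive_ext (mx_deriveMr (S t) dS0) => x.
  by rewrite -SD addrC.
exact: mx_derive_unique d1 d2.
Qed.

(** The orbit of [w] has derivative [S t (E w) = 0]. *)
Lemma generator_fix M (w : 'M[R]_(N, M)) :
  E *m w = 0 -> forall t, S t *m w = w.
Proof.
move=> Ew t; rewrite -[RHS]mul1mx -S0.
apply: (@mx_derive0_cst R N M (fun x => S x *m w)) => x.
apply: mx_derive_eq (mx_deriveMr w (one_parameter_derive x)) _.
by rewrite -one_parameter_comm -mulmxA Ew mulmx0.
Qed.

(** Otherwise [S t w = w + t E w], which is not periodic: the generator of a
    circle group has no nilpotent part. *)
Lemma generator_semisimple M (w : 'M[R]_(N, M)) (T : R) :
  T != 0 -> S T = 1%:M -> E *m (E *m w) = 0 -> E *m w = 0.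
Proof.
move=> T0 ST EEw.
pose F t := S t *m w + (- t) *: (E *m w).
have FF : F T = F 0.
  apply: mx_derive0_cst => x.
  have dN : is_derive x (1 : R) (fun y : R => - y) (- 1) by exact: is_deriveNid.
  apply: mx_derive_eq
    (mx_deriveD (mx_deriveMr w (one_parameter_derive x)) (mx_deriveZ (E *m w) dN)) _.
  rewrite -one_parameter_comm -mulmxA (generator_fix EEw).
  by rewrite scaleN1r subrr.
move: FF; rewrite /F ST S0 oppr0 scale0r addr0 => /eqP.
rewrite -subr_eq0 addrAC subrr add0r scaleNr oppr_eq0 scaler_eq0 (negPf T0) /=.
by move=> /eqP.
Qed.

End OneParameter.

(** * Rotations of a plane *)

Section Rotation.
Variables (R : realType) (n : nat).
Implicit Types (x y z w : 'cV[R]_n) (g A : 'M[R]_n) (s t : R).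

(** For an orthonormal pair, the rotation by the angle [t] that turns [x] towards
    [y] and fixes their orthogonal complement. *)
Definition rot x y t : 'M[R]_n :=
  1%:M + (cos t - 1) *: (x *m x^T + y *m y^T) + sin t *: (y *m x^T - x *m y^T).

Definition orthonormal2 x y : Prop :=
  [/\ x^T *m x = 1%:M, y^T *m y = 1%:M, x^T *m y = 0 & y^T *m x = 0].

Lemma rot0 x y : rot x y 0 = 1%:M.
Proof. by rewrite /rot cos0 sin0 subrr !scale0r !addr0. Qed.

Lemma orthonormal2_sym x y : orthonormal2 x y -> orthonormal2 y x.
Proof. by case. Qed.

Lemma orthonormal2Nl x y : orthonormal2 x y -> orthonormal2 (- x) y.
Proof.
case=> xx yy xy yx; split => //; rewrite ?linearN /= ?mulNmx ?mulmxN ?opprK //.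
  by rewrite xy oppr0.
by rewrite yx oppr0.
Qed.

Lemma orthonormal2_img g x y : g *m g^T = 1%:M ->
  orthonormal2 x y -> orthonormal2 (g *m x) (g *m y).
Proof.
move=> /mulmx1C gg [xx yy xy yx].
have h (a b : 'cV[R]_n) : (g *m a)^T *m (g *m b) = a^T *m b.
  by rewrite trmx_mul -mulmxA (mulmxA g^T) gg mul1mx.
by split; rewrite h.
Qed.

Lemma rotC x y t : rot y x t = rot x y (- t).
Proof.
rewrite /rot cosN sinN addrC [y *m y^T + _]addrC addrC; congr (_ + _).
by rewrite scaleNr -scalerN opprB.
Qed.

Lemma rotNl x y t : rot (- x) y t = rot x y (- t).
Proof.
rewrite /rot cosN sinN linearN /= !mulNmx !mulmxN opprK scaleNr -scalerN.
by rewrite opprB opprK addrC [x *m _ + _]addrC [- _ + _]addrC addrC.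
Qed.

Lemma rotNr x y t : rot x (- y) t = rot x y (- t).
Proof. by rewrite rotC rotNl -rotC. Qed.

Lemma tr_rot x y t : (rot x y t)^T = rot x y (- t).
Proof.
apply/matrixP => i j; rewrite /rot cosN sinN !mxE !big_ord1 !mxE eq_sym.
ring.
Qed.

Lemma rot_conj g x y t : g *m g^T = 1%:M ->
  g *m rot x y t *m g^T = rot (g *m x) (g *m y) t.
Proof.
move=> gg; rewrite /rot !trmx_mul.
rewrite !(mulmxDl, mulmxDr, mulmxN, mulNmx, mulmx1, =^~ scalemxAl, =^~ scalemxAr).
by rewrite gg !mulmxA.
Qed.

Section Orthonormal.
Variables (x y : 'cV[R]_n).
Hypothesis oxy : orthonormal2 x y.

Lemma rotD s t : rot x y (s + t) = rot x y s *m rot x y t.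
Proof.
case: oxy => xx yy xy yx.
rewrite /rot; set P := _ *m _ + _; set J := _ *m _ - _.
have dy (a b c d : 'cV[R]_n) :
  (a *m b^T) *m (c *m d^T) = a *m (b^T *m c) *m d^T by rewrite !mulmxA.
have PP : P *m P = P.
  by rewrite /P !(mulmxDl, mulmxDr, mulmxN, mulNmx, dy, xx, yy, xy, yx, mulmx0, mul0mx, mulmx1,
     addr0, add0r, subr0, sub0r, opprK, oppr0).
have PJ : P *m J = J.
  by rewrite /P /J !(mulmxDl, mulmxDr, mulmxN, mulNmx, dy, xx, yy, xy, yx, mulmx0, mul0mx, mulmx1,
     addr0, add0r, subr0, sub0r, opprK, oppr0) addrC.
have JP : J *m P = J.
  by rewrite /P /J !(mulmxDl, mulmxDr, mulmxN, mulNmx, dy, xx, yy, xy, yx, mulmx0, mul0mx, mulmx1,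
     addr0, add0r, subr0, sub0r, opprK, oppr0).
have JJ : J *m J = - P.
  by rewrite /P /J !(mulmxDl, mulmxDr, mulmxN, mulNmx, dy, xx, yy, xy, yx, mulmx0, mul0mx, mulmx1,
     addr0, add0r, subr0, sub0r, opprK, oppr0) opprD addrC.
clearbody P J.
rewrite !(mulmxDl, mulmxDr, =^~ scalemxAl, =^~ scalemxAr) PP PJ JP JJ.
rewrite !mulmx1 !mul1mx cosD sinD.
by apply/matrixP => i j; rewrite !mxE; ring.
Qed.

Lemma rot_orthogonal t : rot x y t *m (rot x y t)^T = 1%:M.
Proof. by rewrite tr_rot -rotD subrr rot0. Qed.

(** A rotation is the square of the rotation by half the angle. *)
Lemma det_rot t : \det (rot x y t) = 1.
Proof.
have -> : t = t / 2 + t / 2 by rewrite -splitr.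
rewrite rotD det_mulmx -[X in _ * X]det_tr -det_mulmx rot_orthogonal.
exact: det1.
Qed.

Lemma rot_special_orthogonal t : special_orthogonal_group (rot x y t).
Proof. by split; [exact: rot_orthogonal | exact: det_rot]. Qed.

Lemma rot_mulx t : rot x y t *m x = cos t *: x + sin t *: y.
Proof.
case: oxy => xx yy xy yx.
rewrite /rot !(mulmxDl, mulNmx, =^~ scalemxAl) mul1mx -!mulmxA xx yx !mulmx1 !mulmx0.
by apply/matrixP => i j; rewrite !mxE; ring.
Qed.

Lemma rot_muly t : rot x y t *m y = cos t *: y - sin t *: x.
Proof.
case: oxy => xx yy xy yx.
rewrite /rot !(mulmxDl, mulNmx, =^~ scalemxAl) mul1mx -!mulmxA yy xy !mulmx1 !mulmx0.
by apply/matrixP => i j; rewrite !mxE; ring.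
Qed.

Lemma rot_mul_perp m (w : 'M[R]_(n, m)) t :
  x^T *m w = 0 -> y^T *m w = 0 -> rot x y t *m w = w.
Proof.
move=> xw yw.
rewrite /rot !(mulmxDl, mulNmx, =^~ scalemxAl) mul1mx -!mulmxA xw yw !mulmx0.
by rewrite oppr0 !addr0 !scaler0 !addr0.
Qed.

End Orthonormal.

Lemma continuous_rot x y i j : continuous (fun t => rot x y t i j).
Proof.
have -> : (fun t => rot x y t i j) = (fun t => (1%:M : 'M[R]_n) i j
   + (cos t - 1) * (x *m x^T + y *m y^T) i j
   + sin t * (y *m x^T - x *m y^T) i j).
  by apply/funext => t; rewrite !mxE.
move=> t; apply: cvgD; last first.
  by apply: cvgM; [exact: continuous_sin | exact: cvg_cst].
apply: cvgD; first exact: cvg_cst.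
apply: cvgM; last exact: cvg_cst.
by apply: cvgD; [exact: continuous_cos | exact: cvg_cst].
Qed.

Definition orthonormal3 x y z : Prop :=
  [/\ orthonormal2 x y, orthonormal2 x z & orthonormal2 y z].

Lemma orthonormal3_tilt x y z (c s : R) : c ^+ 2 + s ^+ 2 = 1 ->
  orthonormal3 x y z -> orthonormal2 x (c *: y + s *: z).
Proof.
move=> cs [[xx yy xy yx] [_ zz xz zx] [_ _ yz zy]].
have uT : (c *: y + s *: z)^T = c *: y^T + s *: z^T.
  by apply/matrixP => i j; rewrite !mxE.
have E := (uT, @mulmxDl R, @mulmxDr R).
split=> //.
- rewrite !E -!scalemxAl -!scalemxAr yy yz zy zz.
  apply/matrixP => i j; rewrite !mxE.
  by rewrite -[RHS]mul1r -cs; ring.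
- by rewrite !E -!scalemxAr xy xz !scaler0 addr0.
- by rewrite !E -!scalemxAl yx zx !scaler0 addr0.
Qed.

(** Euler angles: a rotation of the plane spanned by [x] and [c y + s z]
    is a product of rotations of the coordinate planes of [x, y, z].  The angles
    are given by their sines and cosines; [cos b != 0] keeps them away from
    gimbal lock. *)
Lemma rot_euler x y z (c s t a b d : R) : c ^+ 2 + s ^+ 2 = 1 ->
  orthonormal3 x y z -> cos b != 0 ->
  cos b * cos a = cos t -> cos b * sin a = c * sin t -> sin b = s * sin t ->
  cos b * cos d = c ^+ 2 + s ^+ 2 * cos t ->
  cos b * sin d = c * s * (cos t - 1) ->
  rot x (c *: y + s *: z) t = rot x y a *m rot x z b *m rot y z d.
Proof.
move=> cs oxyz kn0 hca hsa hsb hcd hsd.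
have oxu := orthonormal3_tilt cs oxyz.
have [oxy oxz oyz] := oxyz.
have [[xx yy xy yx] [_ zz xz zx] [_ _ yz zy]] := oxyz.
set u := c *: y + s *: z in oxu *.
have uT : u^T = c *: y^T + s *: z^T by apply/matrixP => i j; rewrite !mxE.
have kk : cos b ^+ 2 = 1 - s ^+ 2 * sin t ^+ 2 by rewrite cos2sin2 hsb; ring.
have ct2 := cos2Dsin2 t.
(* a matrix is determined by its values at x, y, z and on their complement *)
pose Q := 1%:M - x *m x^T - y *m y^T - z *m z^T : 'M[R]_n.
have xQ : x^T *m Q = 0.
  by rewrite /Q !mulmxBr mulmx1 !mulmxA xx xy xz !mul0mx mul1mx !subr0 subrr.
have yQ : y^T *m Q = 0.
  by rewrite /Q !mulmxBr mulmx1 !mulmxA yx yy yz !mul0mx mul1mx !subr0 subrr.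
have zQ : z^T *m Q = 0.
  by rewrite /Q !mulmxBr mulmx1 !mulmxA zx zy zz !mul0mx mul1mx !subr0 subrr.
have uQ : u^T *m Q = 0.
  by rewrite uT mulmxDl -!scalemxAl yQ zQ !scaler0 addr0.
have decomp A : A = A *m x *m x^T + A *m y *m y^T + A *m z *m z^T + A *m Q.
  rewrite /Q !mulmxBr mulmx1 !mulmxA.
  by apply/matrixP => i j; rewrite !mxE; ring.
rewrite [LHS]decomp [RHS]decomp.
have yu : y = c *: u + (- s) *: (c *: z - s *: y).
  by apply/matrixP => i j; rewrite !mxE -[LHS]mul1r -cs; ring.
have zu : z = s *: u + c *: (c *: z - s *: y).
  by apply/matrixP => i j; rewrite !mxE -[LHS]mul1r -cs; ring.
have fv : rot x u t *m (c *: z - s *: y) = c *: z - s *: y.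
  apply: rot_mul_perp.
    by rewrite mulmxBr -!scalemxAr xz xy !scaler0 subr0.
  rewrite uT mulmxDl !mulmxBr -!scalemxAl -!scalemxAr.
  by rewrite yy yz zy zz; apply/matrixP => i j; rewrite !mxE; ring.
have rzbx := rot_mulx oxz b; have rzbz := rot_muly oxz b.
have rzby : rot x z b *m y = y by apply: rot_mul_perp.
have rax := rot_mulx oxy a; have ray := rot_muly oxy a.
have raz : rot x y a *m z = z by apply: rot_mul_perp.
have rdy := rot_mulx oyz d; have rdz := rot_muly oyz d.
have rdx : rot y z d *m x = x by apply: rot_mul_perp.
have E := (mulmxDr, mulmxBr, mulmxN, =^~ scalemxAr).
have hx : rot x u t *m x = rot x y a *m rot x z b *m rot y z d *m x.
  rewrite rot_mulx// -!mulmxA rdx rzbx !E rax raz /u.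
  by apply/matrixP => i j; rewrite !mxE -hca hsb; ring: hsa.
have kk0 : cos b ^+ 2 != 0 by rewrite expf_neq0.
have cc : c ^+ 2 = 1 - s ^+ 2 by rewrite -cs; ring.
have tt : sin t ^+ 2 = 1 - cos t ^+ 2 by exact: sin2cos2.
have hxy : cos d * sin a + sin d * sin b * cos a = c * sin t.
  apply: (mulfI kk0).
  transitivity ((cos b * cos d) * (cos b * sin a)
     + (cos b * sin d) * sin b * (cos b * cos a)); first by ring.
  by rewrite hca hsa hcd hsd hsb kk; ring: cc tt.
have hyy : cos d * cos a - sin d * sin b * sin a = c ^+ 2 * cos t + s ^+ 2.
  apply: (mulfI kk0).
  transitivity ((cos b * cos d) * (cos b * cos a)
     - (cos b * sin d) * sin b * (cos b * sin a)); first by ring.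
  by rewrite hca hsa hcd hsd hsb kk; ring: cc tt.
have hxz : cos d * sin b * cos a - sin d * sin a = s * sin t.
  apply: (mulfI kk0).
  transitivity ((cos b * cos d) * sin b * (cos b * cos a)
     - (cos b * sin d) * (cos b * sin a)); first by ring.
  by rewrite hca hsa hcd hsd hsb kk; ring: cc tt.
have hyz : - sin d * cos a - cos d * sin b * sin a = c * s * (cos t - 1).
  apply: (mulfI kk0).
  transitivity (- (cos b * sin d) * (cos b * cos a)
     - (cos b * cos d) * sin b * (cos b * sin a)); first by ring.
  by rewrite hca hsa hcd hsd hsb kk; ring: cc tt.
have hy : rot x u t *m y = rot x y a *m rot x z b *m rot y z d *m y.
  transitivity (- (c * sin t) *: x + (c ^+ 2 * cos t + s ^+ 2) *: y
      + (c * s * (cos t - 1)) *: z).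
    rewrite {1}yu mulmxDr -!scalemxAr fv rot_muly// /u.
    by apply/matrixP => i j; rewrite !mxE; ring.
  rewrite -!mulmxA rdy !E rzby rzbz !E ray raz rax.
  by apply/matrixP => i j; rewrite !mxE -hxy -hyy -hsd; ring.
have hz : rot x u t *m z = rot x y a *m rot x z b *m rot y z d *m z.
  transitivity (- (s * sin t) *: x + (c * s * (cos t - 1)) *: y
      + (s ^+ 2 * cos t + c ^+ 2) *: z).
    rewrite {1}zu mulmxDr -!scalemxAr fv rot_muly// /u.
    by apply/matrixP => i j; rewrite !mxE; ring.
  rewrite -!mulmxA rdz !E rzby rzbz !E ray raz rax.
  apply/matrixP => i j; rewrite !mxE -hxz -hyz.
  by rewrite [s ^+ 2 * _ + _]addrC -hcd; ring.
have hQ : rot x u t *m Q = rot x y a *m rot x z b *m rot y z d *m Q.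
  by rewrite -!mulmxA !rot_mul_perp.
by rewrite hx hy hz hQ.
Qed.

End Rotation.

(** * Infinitesimal generators of a representation of SO_n *)

Lemma cvg_mx (R : realType) (T : Type) (F : set_system T) (FF : Filter F) m n
    (f : T -> 'M[R]_(m, n)) (B : 'M[R]_(m, n)) :
  (forall i j, f x i j @[x --> F] --> B i j) -> f x @[x --> F] --> B.
Proof.
move=> h A [P BP sPA]; rewrite /= nbhs_simpl.
have : \forall x \near F, forall i j, P i j (f x i j).
  by apply: filter_forall => i; apply: filter_forall => j; exact: h (BP i j).
by apply: filterS => x Px; exact: sPA.
Qed.

Section SpecialOrthogonal.
Variables (R : realType) (n : nat).
Implicit Types A B : 'M[R]_n.

Lemma special_orthogonalM A B : special_orthogonal_group A ->
  special_orthogonal_group B -> special_orthogonal_group (A *m B).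
Proof.
move=> [oA dA] [oB dB]; split; last by rewrite det_mulmx dA dB mul1r.
rewrite /orthogonal_group /= trmx_mul -mulmxA (mulmxA B).
by rewrite (_ : B *m B^T = 1%:M) // mul1mx.
Qed.

Lemma special_orthogonal_tr A : special_orthogonal_group A ->
  special_orthogonal_group A^T.
Proof.
by move=> [oA dA]; split; rewrite ?det_tr// /orthogonal_group /= trmxK mulmx1C.
Qed.

Lemma special_orthogonal1 : special_orthogonal_group (1%:M : 'M[R]_n).
Proof. by split; rewrite ?det1// /orthogonal_group /= trmx1 mulmx1. Qed.

End SpecialOrthogonal.

(** A continuous matrix representation of SO_n; values outside SO_n are
    unconstrained. *)
Definition is_matrix_rep (R : realType) (n N : nat) (sg : 'M[R]_n -> 'M[R]_N) :=
  [/\ sg 1%:M = 1%:M,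
      forall A B, special_orthogonal_group A -> special_orthogonal_group B ->
        sg (A *m B) = sg A *m sg B
    & forall i j, {within @special_orthogonal_group R n,
        continuous (fun A => sg A i j)}].

Section Representation.
Variables (R : realType) (n N : nat) (sg : 'M[R]_n -> 'M[R]_N).
Local Notation SO := (@special_orthogonal_group R n).
Hypothesis rsg : is_matrix_rep sg.

Lemma sg1 : sg 1%:M = 1%:M.
Proof. by case: rsg. Qed.

Lemma sgM A B : SO A -> SO B -> sg (A *m B) = sg A *m sg B.
Proof. by case: rsg => _ h _; exact: h. Qed.

Lemma csg i j : {within SO, continuous (fun A => sg A i j)}.
Proof. by case: rsg => _ _; exact. Qed.

Implicit Types x y z w : 'cV[R]_n.

Lemma sg_trK A : SO A -> sg A *m sg A^T = 1%:M.
Proof.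
move=> hA; rewrite -(sgM hA (special_orthogonal_tr hA)).
by case: hA => -> _; exact: sg1.
Qed.

Lemma sg_trKC A : SO A -> sg A^T *m sg A = 1%:M.
Proof. by move=> hA; apply: mulmx1C; exact: sg_trK. Qed.

Section Circle.
Variables (x y : 'cV[R]_n).
Hypothesis oxy : orthonormal2 x y.

Lemma sg_rot0 : sg (rot x y 0) = 1%:M.
Proof. by rewrite rot0 sg1. Qed.

Lemma sg_rotD s t : sg (rot x y (s + t)) = sg (rot x y s) *m sg (rot x y t).
Proof. by rewrite rotD// sgM//; exact: rot_special_orthogonal. Qed.

Lemma sg_rot_continuous i j : continuous (fun t => sg (rot x y t) i j).
Proof.
move=> t.
have /subspace_continuousP := @csg i j => /(_ _ (rot_special_orthogonal oxy t)) h.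
apply: cvg_comp h => A; rewrite /= nbhs_simpl /within /= => nA.
have c : rot x y s @[s --> t] --> rot x y t.
  by apply: (@cvg_mx R R (nbhs t) _ n n (rot x y)) => k l; exact: continuous_rot.
have h' : \forall s \near t, SO (rot x y s) -> A (rot x y s) := c _ nA.
change (\forall s \near t, A (rot x y s)).
by apply: filterS h' => s; apply; exact: rot_special_orthogonal.
Qed.

End Circle.

(** The infinitesimal action of the rotations of the oriented plane [x, y]. *)
Definition gen x y : 'M[R]_N :=
  xget 0 [set E | mx_derive (fun t => sg (rot x y t)) 0 E].

Lemma genP x y : orthonormal2 x y ->
  mx_derive (fun t => sg (rot x y t)) 0 (gen x y).
Proof.
move=> oxy; rewrite /gen; apply: xgetPex.
by apply: one_parameter_derivable0;
  [exact: sg_rot0 | exact: sg_rotD | exact: sg_rot_continuous].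
Qed.

Lemma gen_unique x y E : orthonormal2 x y ->
  mx_derive (fun t => sg (rot x y t)) 0 E -> gen x y = E.
Proof. by move=> oxy; apply: mx_derive_unique; exact: genP. Qed.

Lemma gen_conj A x y : SO A -> orthonormal2 x y ->
  sg A *m gen x y *m sg A^T = gen (A *m x) (A *m y).
Proof.
move=> hA oxy; symmetry; apply: gen_unique.
  by apply: orthonormal2_img => //; case: hA.
apply: mx_derive_ext (mx_deriveMr (sg A^T) (mx_deriveMl (sg A) (genP oxy))) => t.
have hr := rot_special_orthogonal oxy t; have hA' := special_orthogonal_tr hA.
by rewrite -rot_conj; [rewrite !sgM//; exact: special_orthogonalM | case: hA].
Qed.

Lemma sg_gen A x y : SO A -> orthonormal2 x y ->
  sg A *m gen x y = gen (A *m x) (A *m y) *m sg A.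
Proof. by move=> hA oxy; rewrite -gen_conj// -mulmxA sg_trKC// mulmx1. Qed.

Lemma genNl x y : orthonormal2 x y -> gen (- x) y = - gen x y.
Proof.
move=> oxy; apply: gen_unique; first exact: orthonormal2Nl.
have dN : is_derive (0 : R) (1 : R) (fun y : R => - y) (- 1) by exact: is_deriveNid.
apply: (@mx_derive_ext _ _ _ (fun t => sg (rot x y (- t)))) => [t|].
  by rewrite rotNl.
rewrite -scaleN1r.
apply: (@mx_derive_comp R N N (fun t => sg (rot x y t)) (fun t => - t)) dN.
by rewrite oppr0; exact: genP.
Qed.

Lemma genC x y : orthonormal2 x y -> gen y x = - gen x y.
Proof.
move=> oxy; rewrite -(genNl oxy); symmetry; apply: gen_unique.
  exact: orthonormal2Nl.
apply: mx_derive_ext (genP (orthonormal2_sym oxy)) => t.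
by rewrite rotNl rotC.
Qed.

Lemma is_derive_asin0 (f : R -> R) (d : R) : f 0 = 0 ->
  is_derive (0 : R) (1 : R) f d -> is_derive (0 : R) (1 : R) (fun t => asin (f t)) d.
Proof.
move=> f0 df.
have da : is_derive (f 0) (1 : R) (@asin R) 1.
  have h : -1 < f 0 < 1 by rewrite f0; lra.
  apply: is_derive_eq (is_derive1_asin h) _.
  by rewrite f0 expr0n /= subr0 sqrtr1 invr1.
by apply: is_derive_eq (is_derive1_comp da df) _; rewrite mul1r.
Qed.

(** The differential of a continuous representation is additive: the Euler
    angles of the rotation by [t] in the tilted plane are
    [c t], [s t] and [0] to first order. *)
Lemma gen_tilt x y z (c s : R) : c ^+ 2 + s ^+ 2 = 1 -> orthonormal3 x y z ->
  gen x (c *: y + s *: z) = c *: gen x y + s *: gen x z.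
Proof.
move=> cs oxyz; have [oxy oxz oyz] := oxyz.
apply: gen_unique; first exact: orthonormal3_tilt.
pose k (t : R) := Num.sqrt (1 - s ^+ 2 * sin t ^+ 2).
pose a t := asin (c * sin t * (k t)^-1).
pose b t := asin (s * sin t).
pose d t := asin (c * s * (cos t - 1) * (k t)^-1).
have c2 : c ^+ 2 = 1 - s ^+ 2 by rewrite -cs; ring.
have s21 : 0 <= s ^+ 2 <= 1 by have := sqr_ge0 c; have := sqr_ge0 s; lra.
apply: (@mx_derive_near R N N (fun t => sg (rot x y (a t)) *m
   (sg (rot x z (b t)) *m sg (rot y z (d t))))).
  have : \forall t \near (0 : R), 0 < cos t.
    by apply: (cvgr_gt (cos 0) (@continuous_cos R 0)); rewrite cos0 ltr01.
  apply: filterS => t C0.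
  have t2 := cos2Dsin2 t.
  have kk : k t ^+ 2 = 1 - s ^+ 2 * sin t ^+ 2.
    rewrite sqr_sqrtr//; have := sqr_ge0 (cos t); have := sqr_ge0 (sin t); nra.
  have k0 : 0 < k t.
    rewrite sqrtr_gt0; have := sqr_ge0 (sin t); have : 0 < cos t ^+ 2.
      by rewrite exprn_gt0.
    nra.
  have asinE (u v : R) : 0 <= v -> u ^+ 2 + v ^+ 2 = 1 ->
      sin (asin u) = u /\ cos (asin u) = v.
    move=> v0 uv; have hu : -1 <= u <= 1.
      by apply/andP; split; have := sqr_ge0 v; nra.
    rewrite asinK//; split => //.
    by rewrite cos_asin// (_ : 1 - u ^+ 2 = v ^+ 2) ?sqrtr_sqr ?ger0_norm// -uv; ring.
  have kn : k t != 0 by rewrite gt_eqF.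
  have [sb cb] : sin (b t) = s * sin t /\ cos (b t) = k t.
    by apply: asinE; [exact: ltW | rewrite kk; ring].
  have [sa ca] : sin (a t) = c * sin t * (k t)^-1 /\ cos (a t) = cos t * (k t)^-1.
    apply: asinE; first by rewrite mulr_ge0 ?invr_ge0 ?ltW.
    apply: (@mulIf _ (k t ^+ 2)); first by rewrite expf_neq0.
    rewrite mul1r {2}kk.
    transitivity (c ^+ 2 * sin t ^+ 2 + cos t ^+ 2); first by field.
    by rewrite c2 sin2cos2; ring.
  have [sd cd] : sin (d t) = c * s * (cos t - 1) * (k t)^-1 /\
      cos (d t) = (c ^+ 2 + s ^+ 2 * cos t) * (k t)^-1.
    apply: asinE.
      apply: mulr_ge0; last by rewrite invr_ge0 ltW.
      by rewrite addr_ge0 ?sqr_ge0// mulr_ge0 ?sqr_ge0// ltW.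
    apply: (@mulIf _ (k t ^+ 2)); first by rewrite expf_neq0.
    rewrite mul1r {2}kk.
    transitivity (c ^+ 2 * s ^+ 2 * (cos t - 1) ^+ 2
        + (c ^+ 2 + s ^+ 2 * cos t) ^+ 2); first by field.
    by rewrite c2 sin2cos2; ring.
  rewrite (@rot_euler R n x y z c s t (a t) (b t) (d t)) //.
  - have r1 := rot_special_orthogonal oxy (a t).
    have r2 := rot_special_orthogonal oxz (b t).
    have r3 := rot_special_orthogonal oyz (d t).
    by rewrite (sgM (special_orthogonalM r1 r2) r3) (sgM r1 r2) mulmxA.
  - by rewrite cb.
  - by rewrite cb ca mulrCA divff// mulr1.
  - by rewrite cb sa mulrCA divff// mulr1.
  - by rewrite cb cd mulrCA divff// mulr1.
  - by rewrite cb sd mulrCA divff// mulr1.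
have d_sin : is_derive (0 : R) (1 : R) sin 1.
  by apply: is_derive_eq (is_derive_sin 0) _; rewrite cos0.
have d_cos : is_derive (0 : R) (1 : R) cos 0.
  by apply: is_derive_eq (is_derive_cos 0) _; rewrite sin0 oppr0.
have k_0 : k 0 = 1 by rewrite /k sin0 expr0n /= mulr0 subr0 sqrtr1.
have d_k : is_derive (0 : R) (1 : R) (fun t => (k t)^-1) 0.
  have d1 : is_derive (0 : R) (1 : R) (fun t => 1 - s ^+ 2 * sin t ^+ 2) 0.
    have -> : (fun t => 1 - s ^+ 2 * sin t ^+ 2) =
        cst 1 - cst (s ^+ 2) * (sin * sin) :> (R -> R).
      by apply/funext => t; rewrite expr2.
    apply: is_derive_eq (is_deriveB (is_derive_cst (1 : R) (0 : R) (1 : R))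
      (is_deriveM (is_derive_cst (s ^+ 2) (0 : R) (1 : R)) (is_deriveM d_sin d_sin))) _.
    by rewrite /GRing.mul /= sin0 /GRing.scale /=; ring.
  have d2 : is_derive ((fun t => 1 - s ^+ 2 * sin t ^+ 2) 0) (1 : R) Num.sqrt
      (2 * Num.sqrt (1 - s ^+ 2 * sin 0 ^+ 2))^-1.
    by apply: is_derive1_sqrt; rewrite sin0 expr0n /= mulr0 subr0.
  have kn0 : k 0 != 0 by rewrite k_0 oner_neq0.
  have dk : is_derive (0 : R) (1 : R) k 0.
    rewrite -[X in is_derive _ _ _ X](mulr0
      (2 * Num.sqrt (1 - s ^+ 2 * sin 0 ^+ 2))^-1).
    exact: (@is_derive1_comp R Num.sqrt (fun t => 1 - s ^+ 2 * sin t ^+ 2)).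
  have h := is_deriveV kn0 dk.
  by apply: is_derive_eq h _; rewrite scaler0.
have d_a : is_derive (0 : R) (1 : R) a c.
  apply: is_derive_asin0; first by rewrite sin0 mulr0 mul0r.
  apply: is_derive_eq (is_deriveM (is_deriveM (is_derive_cst c (0 : R) (1 : R)) d_sin) d_k) _.
  by rewrite k_0 /= /GRing.scale /= sin0; field.
have d_b : is_derive (0 : R) (1 : R) b s.
  apply: is_derive_asin0; first by rewrite sin0 mulr0.
  apply: is_derive_eq (is_deriveM (is_derive_cst s (0 : R) (1 : R)) d_sin) _.
  by rewrite /= /GRing.scale /= sin0; ring.
have d_d : is_derive (0 : R) (1 : R) d 0.
  apply: is_derive_asin0; first by rewrite cos0 subrr mulr0 mul0r.
  apply: is_derive_eq (is_deriveM (is_deriveM (is_derive_cst (c * s) (0 : R) (1 : R))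
    (is_deriveB d_cos (is_derive_cst (1 : R) (0 : R) (1 : R)))) d_k) _.
  by rewrite k_0 /= /GRing.scale /=; ring.
have comp u v (f : R -> R) e : orthonormal2 u v -> f 0 = 0 ->
    is_derive (0 : R) (1 : R) f e ->
    mx_derive (fun t => sg (rot u v (f t))) 0 (e *: gen u v).
  move=> ouv f0 df; apply: (@mx_derive_comp R N N (fun t => sg (rot u v t)) f) df.
  by rewrite f0; exact: genP.
have a0 : a 0 = 0 by rewrite /a sin0 mulr0 mul0r -{1}sin0 sinK// in_itv /=;
  have := pi_gt0 R; lra.
have b0 : b 0 = 0 by rewrite /b sin0 mulr0 -{1}sin0 sinK// in_itv /=;
  have := pi_gt0 R; lra.
have d0 : d 0 = 0 by rewrite /d cos0 subrr mulr0 mul0r -{1}sin0 sinK// in_itv /=;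
  have := pi_gt0 R; lra.
have := mx_deriveM (comp _ _ _ _ oxy a0 d_a)
  (mx_deriveM (comp _ _ _ _ oxz b0 d_b) (comp _ _ _ _ oyz d0 d_d)).
move=> /mx_derive_eq; apply.
rewrite a0 b0 d0 !rot0 sg1 !mul1mx !mulmx1 scale0r add0r.
exact: addrC.
Qed.

(** Differentiate at 0 the conjugation of [gen x y] by the rotations of the plane
    [y, z], which by [gen_tilt] is [cos t gen x y + sin t gen x z]. *)
Lemma gen_bracket x y z : orthonormal3 x y z ->
  gen y z *m gen x y - gen x y *m gen y z = gen x z.
Proof.
move=> oxyz; have [oxy oxz oyz] := oxyz.
have [[_ _ xy yx] [_ _ xz zx] _] := oxyz.
have h t : sg (rot y z t) *m gen x y *m sg (rot y z (- t)) =
    cos t *: gen x y + sin t *: gen x z.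
  rewrite -tr_rot gen_conj//; last exact: rot_special_orthogonal.
  rewrite rot_mul_perp// rot_mulx// gen_tilt//.
  by rewrite cos2Dsin2.
have hN : mx_derive (fun t => sg (rot y z (- t))) 0 (- gen y z).
  rewrite -(genC oyz); apply: mx_derive_ext (genP (orthonormal2_sym oyz)) => t.
  by rewrite rotC.
have d1 := mx_deriveM (mx_deriveMr (gen x y) (genP oyz)) hN.
have d_sin : is_derive (0 : R) (1 : R) sin 1.
  by apply: is_derive_eq (is_derive_sin 0) _; rewrite cos0.
have d_cos : is_derive (0 : R) (1 : R) cos 0.
  by apply: is_derive_eq (is_derive_cos 0) _; rewrite sin0 oppr0.
have d2 := mx_deriveD (mx_deriveZ (gen x y) d_cos) (mx_deriveZ (gen x z) d_sin).
have := mx_derive_unique d1 (mx_derive_ext (fun t => esym (h t)) d2).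
rewrite oppr0 rot0 sg1 mul1mx mulmx1 scale0r scale1r add0r => <-.
rewrite mulmxN; exact: addrC.
Qed.

(** Rotations of orthogonal planes commute. *)
Lemma gen_comm x y z w : orthonormal2 x y -> orthonormal2 z w ->
  x^T *m z = 0 -> x^T *m w = 0 -> y^T *m z = 0 -> y^T *m w = 0 ->
  gen z w *m gen x y = gen x y *m gen z w.
Proof.
move=> oxy ozw xz xw yz yw.
have tr0 (a b : 'cV[R]_n) : a^T *m b = 0 -> b^T *m a = 0.
  by move=> e; rewrite -(trmxK a) -trmx_mul e trmx0.
have h t : sg (rot z w t) *m gen x y = gen x y *m sg (rot z w t).
  rewrite (sg_gen (rot_special_orthogonal ozw t) oxy).
  by rewrite !rot_mul_perp//; exact: tr0.
apply: mx_derive_unique (mx_deriveMr (gen x y) (genP ozw)) _.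
by apply: mx_derive_ext (mx_deriveMl (gen x y) (genP ozw)) => t; rewrite h.
Qed.

Lemma gen_sg x y t : orthonormal2 x y ->
  sg (rot x y t) *m gen x y = gen x y *m sg (rot x y t).
Proof.
move=> oxy.
exact: one_parameter_comm (sg_rotD oxy) _ (genP oxy) t.
Qed.

Lemma gen_fix x y M (v : 'M[R]_(N, M)) : orthonormal2 x y ->
  gen x y *m v = 0 -> forall t, sg (rot x y t) *m v = v.
Proof.
move=> oxy h t.
exact: (generator_fix (sg_rot0 x y) (sg_rotD oxy) (genP oxy) h).
Qed.

Lemma gen_semisimple x y M (v : 'M[R]_(N, M)) : orthonormal2 x y ->
  gen x y *m (gen x y *m v) = 0 -> gen x y *m v = 0.
Proof.
move=> oxy; apply: (generator_semisimple (T := pi *+ 2) (sg_rot0 x y) (sg_rotD oxy) (genP oxy)).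
  by rewrite mulrn_eq0 /= gt_eqF// pi_gt0.
by rewrite /rot cos2pi sin2pi subrr !scale0r !addr0 sg1.
Qed.

End Representation.

(** * Signed permutations and the coordinate generators *)

Section CoordinateRotations.
Variables (R : realType) (n : nat).

Definition evec (i : 'I_n) : 'cV[R]_n := delta_mx i 0.

Lemma evec_dot i j : (evec i)^T *m evec j = (i == j)%:R%:M.
Proof.
rewrite /evec trmx_delta mul_delta_mx_cond.
by apply/matrixP => a b; rewrite !ord1; case: (i == j); rewrite !mxE.
Qed.

Lemma evec_orthonormal i j : i != j -> orthonormal2 (evec i) (evec j).
Proof.
move=> ij; split; rewrite evec_dot ?eqxx // ?(negPf ij) ?[j == i]eq_sym ?(negPf ij);
  by rewrite mulr0n raddf0.
Qed.

Lemma evec_orthonormal3 i j k : i != j -> i != k -> j != k ->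
  orthonormal3 (evec i) (evec j) (evec k).
Proof. by move=> *; split; exact: evec_orthonormal. Qed.

Definition crot i j t : 'M[R]_n := rot (evec i) (evec j) t.

Lemma crot_SO i j t : i != j -> special_orthogonal_group (crot i j t).
Proof. by move=> ij; apply: rot_special_orthogonal; exact: evec_orthonormal. Qed.

Lemma crot_other i j k t : k != i -> k != j -> crot i j t *m evec k = evec k.
Proof.
move=> ki kj; apply: rot_mul_perp; rewrite evec_dot eq_sym;
  by rewrite ?(negPf ki) ?(negPf kj) mulr0n raddf0.
Qed.

(** A quarter turn is a signed transposition, and a half turn is a diagonal
    matrix with two entries [-1]. *)
Lemma quarter_evec i j k : i != j ->
  crot i j (pi / 2) *m evec k = (-1) ^+ (k == j) *: evec (tperm i j k).
Proof.
move=> ij; have oij := evec_orthonormal ij.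
case: tpermP => [->|->|/eqP ki /eqP kj].
- by rewrite (negPf ij) expr0 rot_mulx// cos_pihalf sin_pihalf scale0r add0r.
- by rewrite eqxx expr1 rot_muly// cos_pihalf sin_pihalf scale0r add0r scale1r scaleN1r.
- by rewrite (negPf kj) expr0 scale1r crot_other.
Qed.

Lemma half_evec i j k : i != j ->
  crot i j pi *m evec k = (-1) ^+ ((k == i) || (k == j)) *: evec k.
Proof.
move=> ij; have oij := evec_orthonormal ij.
have [->|ki] := eqVneq k i.
  by rewrite /= expr1 rot_mulx// cospi sinpi scale0r addr0.
have [->|kj] := eqVneq k j.
  by rewrite /= expr1 rot_muly// cospi sinpi scale0r subr0.
by rewrite /= expr0 scale1r crot_other.
Qed.

End CoordinateRotations.
Arguments evec {R n} i.
Arguments crot {R n} i j t.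

(** The quarter turn, the half turn and the generator of a coordinate plane, as
    operators of the representation.  They are sealed so that matching two of
    them never unfolds the rotations. *)
HB.lock Definition qt (R : realType) (n N : nat) (sg : 'M[R]_n -> 'M[R]_N)
  (i j : 'I_n) : 'M[R]_N := sg (crot i j (pi / 2)).
HB.lock Definition ht (R : realType) (n N : nat) (sg : 'M[R]_n -> 'M[R]_N)
  (i j : 'I_n) : 'M[R]_N := sg (crot i j pi).
HB.lock Definition E (R : realType) (n N : nat) (sg : 'M[R]_n -> 'M[R]_N)
  (i j : 'I_n) : 'M[R]_N := gen sg (evec i) (evec j).

Section SignedGenerators.
Variables (R : realType) (n N : nat) (sg : 'M[R]_n -> 'M[R]_N).
Hypothesis rsg : is_matrix_rep sg.
Local Notation SO := (@special_orthogonal_group R n).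

Lemma rot_sign (a b : bool) (x y : 'cV[R]_n) t :
  rot ((-1) ^+ a *: x) ((-1) ^+ b *: y) t = rot x y ((-1) ^+ (a (+) b) * t).
Proof.
case: a; case: b; rewrite /= ?expr0 ?expr1 ?scale1r ?scaleN1r ?rotNl ?rotNr //;
  by rewrite ?opprK ?mulN1r ?mul1r.
Qed.

Lemma gen_sign (a b : bool) (x y : 'cV[R]_n) : orthonormal2 x y ->
  gen sg ((-1) ^+ a *: x) ((-1) ^+ b *: y) = (-1) ^+ (a (+) b) *: gen sg x y.
Proof.
move=> oxy; have Nr u v : orthonormal2 u v -> gen sg u (- v) = - gen sg u v.
  move=> ouv; have ovu := orthonormal2_sym ouv.
  rewrite (genC rsg (orthonormal2Nl ovu)) (genNl rsg ovu) opprK.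
  exact: (genC rsg ouv).
case: a; case: b; rewrite /= ?expr0 ?expr1 ?scale1r ?scaleN1r //.
- by rewrite (Nr _ _ (orthonormal2Nl oxy)) (genNl rsg oxy) opprK.
- exact: genNl.
- exact: Nr.
Qed.

Local Notation qt := (qt sg).
Local Notation ht := (ht sg).
Local Notation E := (E sg).

Lemma qtE i j : qt i j = sg (crot i j (pi / 2)). Proof. by rewrite qt.unlock. Qed.
Lemma htE i j : ht i j = sg (crot i j pi). Proof. by rewrite ht.unlock. Qed.
Lemma EE i j : E i j = gen sg (evec i) (evec j). Proof. by rewrite E.unlock. Qed.

Lemma qt_qtE i j : i != j -> qt i j *m qt i j = ht i j.
Proof.
move=> ij; rewrite qtE htE -(sg_rotD rsg (evec_orthonormal R ij)).
by rewrite -splitr.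
Qed.

Lemma qtNK i j : i != j -> qt j i *m qt i j = 1%:M.
Proof.
move=> ij; rewrite !qtE /crot rotC -(sg_rotD rsg (evec_orthonormal R ij)) addNr.
by rewrite (sg_rot0 rsg).
Qed.

Lemma htC i j : ht j i = ht i j.
Proof. by rewrite !htE /crot rotC /rot cosN sinN sinpi oppr0. Qed.

Lemma EC i j : i != j -> E j i = - E i j.
Proof. by move=> ij; rewrite !EE; apply: (genC rsg); exact: evec_orthonormal. Qed.

Lemma tperm_neq (i j k l : 'I_n) : k != l -> tperm i j k != tperm i j l.
Proof. by rewrite (inj_eq perm_inj). Qed.

(** Conjugation by a quarter turn permutes the indices up to a sign, and
    conjugation by a half turn only changes signs. *)
Lemma qt_E i j k l : i != j -> k != l -> qt i j *m E k l =
  ((-1) ^+ ((k == j) (+) (l == j)) *: E (tperm i j k) (tperm i j l)) *m qt i j.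
Proof.
move=> ij kl; rewrite qtE !EE (sg_gen rsg); last 2 first.
- exact: crot_SO.
- exact: evec_orthonormal.
rewrite !quarter_evec// gen_sign//.
by apply: evec_orthonormal; exact: tperm_neq.
Qed.

Lemma ht_E i j k l : i != j -> k != l -> ht i j *m E k l =
  ((-1) ^+ (((k == i) || (k == j)) (+) ((l == i) || (l == j))) *: E k l)
    *m ht i j.
Proof.
move=> ij kl; rewrite htE !EE (sg_gen rsg); last 2 first.
- exact: crot_SO.
- exact: evec_orthonormal.
by rewrite !half_evec// gen_sign//; exact: evec_orthonormal.
Qed.

Lemma sg_rot_conj A x y t : SO A -> orthonormal2 x y ->
  sg A *m sg (rot x y t) = sg (rot (A *m x) (A *m y) t) *m sg A.
Proof.
move=> hA oxy; have [oA _] := hA.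
have hr := rot_special_orthogonal oxy t.
have hr' := rot_special_orthogonal (orthonormal2_img oA oxy) t.
by rewrite -!(sgM rsg)// -(rot_conj _ _ _ oA) -mulmxA (mulmx1C oA) mulmx1.
Qed.

Lemma qt_ht i j k l : i != j -> k != l ->
  qt i j *m ht k l = ht (tperm i j k) (tperm i j l) *m qt i j.
Proof.
move=> ij kl; rewrite !htE qtE sg_rot_conj; last 2 first.
- exact: crot_SO.
- exact: evec_orthonormal.
rewrite !quarter_evec// rot_sign; congr (_ *m _).
by case: (_ (+) _); rewrite ?expr0 ?mul1r // expr1 mulN1r /crot -rotC; by rewrite -!htE; exact: htC.
Qed.

Lemma qt_qt i j k l : i != j -> k != l ->
  qt i j *m qt k l =
  (if (k == j) (+) (l == j) then qt (tperm i j l) (tperm i j k)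
   else qt (tperm i j k) (tperm i j l)) *m qt i j.
Proof.
move=> ij kl; rewrite !qtE sg_rot_conj; last 2 first.
- exact: crot_SO.
- exact: evec_orthonormal.
rewrite !quarter_evec// rot_sign; congr (_ *m _).
by case: (_ (+) _); rewrite ?expr0 ?mul1r // expr1 mulN1r /crot -rotC.
Qed.

Lemma E_bracket i j k : i != j -> i != k -> j != k ->
  E j k *m E i j - E i j *m E j k = E i k.
Proof. by move=> ij ik jk; rewrite !EE; apply: (gen_bracket rsg); exact: evec_orthonormal3. Qed.

Lemma E_comm i j k l : i != j -> k != l -> i != k -> i != l -> j != k -> j != l ->
  E k l *m E i j = E i j *m E k l.
Proof.
move=> ij kl ik il jk jl; rewrite !EE; apply: (gen_comm rsg); try exact: evec_orthonormal;
  by rewrite evec_dot ?(negPf ik) ?(negPf il) ?(negPf jk) ?(negPf jl) mulr0n raddf0.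
Qed.

Section Vectors.
Implicit Types v w u : 'cV[R]_N.

Lemma E_semisimple i j w : i != j -> E i j *m (E i j *m w) = 0 -> E i j *m w = 0.
Proof. by move=> ij; rewrite !EE ?qtE; apply: (gen_semisimple rsg); exact: evec_orthonormal. Qed.

Lemma E_fix i j w : i != j -> E i j *m w = 0 -> forall t, sg (crot i j t) *m w = w.
Proof. by move=> ij; rewrite !EE ?qtE; apply: (gen_fix rsg); exact: evec_orthonormal. Qed.

Lemma E_qt_comm i j : i != j -> qt i j *m E i j = E i j *m qt i j.
Proof. by move=> ij; rewrite !EE ?qtE; apply: (gen_sg rsg); exact: evec_orthonormal. Qed.

End Vectors.

End SignedGenerators.

(** Transpositions act transitively on the pairs of distinct indices, so a
    property stable under them needs to be checked for one pair. *)
Lemma pair_transport (n : nat) (Q : 'I_n -> 'I_n -> Prop) (i0 p : 'I_n) :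
  (forall i j s t, i != j -> s != t -> Q i j -> Q (tperm s t i) (tperm s t j)) ->
  i0 != p -> Q i0 p -> forall i j, i != j -> Q i j.
Proof.
move=> stable i0p Q0 i j ij.
have [l il Ql] : exists2 l, i != l & Q i l.
  have [<-|ne] := eqVneq i0 i; first by exists p.
  exists (tperm i0 i p); first by rewrite -{1}(tpermL i0 i) tperm_neq.
  by rewrite -{1}(tpermL i0 i); exact: stable.
have [<- //|lj] := eqVneq l j.
rewrite -(tpermL l j) -{1}(_ : tperm l j i = i); first exact: stable.
by rewrite tpermD// eq_sym.
Qed.

(** * Reflections on the vectors fixed by the diagonal group *)

Section Reflections.
Variables (R : realType) (n N : nat) (sg : 'M[R]_n -> 'M[R]_N).
Hypothesis rsg : is_matrix_rep sg.
Local Notation qt := (qt sg).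
Local Notation ht := (ht sg).
Local Notation E := (E sg).
Implicit Types (u v w a : 'cV[R]_N) (i j k l : 'I_n).

(** The half turns generate the diagonal matrices of SO_n, so these are the
    vectors fixed by the diagonal matrices. On them the quarter turns satisfy
    the relations of transpositions ([qtW_inv], [qtW_sym], [qtW_conj]). *)
Definition inW w : Prop := forall k l, k != l -> ht k l *m w = w.

Lemma inWD w w' : inW w -> inW w' -> inW (w + w').
Proof. by move=> h h' k l kl; rewrite mulmxDr h ?h'. Qed.

Lemma inWZ c w : inW w -> inW (c *: w).
Proof. by move=> h k l kl; rewrite -scalemxAr h. Qed.

Lemma inW0 : inW 0.
Proof. by move=> k l _; rewrite mulmx0. Qed.

Lemma inWN w : inW w -> inW (- w).
Proof. by move=> h; rewrite -scaleN1r; exact: inWZ. Qed.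

Lemma inWB w w' : inW w -> inW w' -> inW (w - w').
Proof. by move=> h h'; apply: inWD => //; exact: inWN. Qed.

Lemma inW_sum (I : finType) (P : pred I) (f : I -> 'cV[R]_N) :
  (forall x, P x -> inW (f x)) -> inW (\sum_(x | P x) f x).
Proof.
by move=> h; elim/big_ind: _ => //; [exact: inW0 | exact: inWD].
Qed.

Lemma inW_qt i j w : i != j -> inW w -> inW (qt i j *m w).
Proof.
move=> ij h k l kl.
have := qt_ht rsg ij (tperm_neq (tperm i j k) (tperm i j l) kl).
have kl' := @tperm_neq n i j k l kl.
have := qt_ht rsg ij kl'; rewrite !tpermK => e _.
by rewrite mulmxA -e -mulmxA h.
Qed.

Lemma qtW_inv i j w : i != j -> inW w -> qt i j *m (qt i j *m w) = w.
Proof. by move=> ij h; rewrite mulmxA (qt_qtE rsg ij) h. Qed.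

Lemma qtW_sym i j w : i != j -> inW w -> qt j i *m w = qt i j *m w.
Proof.
move=> ij h; rewrite -{1}(qtW_inv ij h) mulmxA (qtNK rsg ij).
by rewrite mul1mx.
Qed.

Lemma qtW_conj i j k l w : i != j -> k != l -> inW w ->
  qt i j *m (qt k l *m w) = qt (tperm i j k) (tperm i j l) *m (qt i j *m w).
Proof.
move=> ij kl h; rewrite mulmxA (qt_qt rsg ij kl) -mulmxA.
case: ifP => // _; apply: qtW_sym; first exact: tperm_neq.
exact: inW_qt.
Qed.

Lemma ht_Ev k l i j w : k != l -> i != j -> ht k l *m (E i j *m w) =
  (-1) ^+ (((i == k) || (i == l)) (+) ((j == k) || (j == l)))
    *: (E i j *m (ht k l *m w)).
Proof.
by move=> kl ij; rewrite mulmxA (ht_E rsg kl ij) -!scalemxAl -mulmxA.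
Qed.

Lemma inW_EE i j w : i != j -> inW w -> inW (E i j *m (E i j *m w)).
Proof.
move=> ij h k l kl.
by rewrite !ht_Ev// h// -scalemxAr scalerA -expr2 sqrr_sign scale1r.
Qed.

Definition rank_one i j : Prop :=
  exists u, forall w, inW w -> exists c, E i j *m w = c *: u.

(** Let u span the image of W.  The square [E (E w)] of the generator lies in W
    again, so a = E u is in W, and a is not 0 since a circle has no nilpotent
    generator.  Modulo a every vector of W is killed by E, hence fixed by the
    quarter turn, which therefore is a reflection with root a and with the
    kernel of E as its mirror. *)
Lemma reflectionP i j w1 : i != j -> rank_one i j ->
  inW w1 -> qt i j *m w1 <> w1 ->
  exists a, exists kp : R, [/\ inW a, a <> 0, qt i j *m a = - a,
    forall w, inW w -> exists c, qt i j *m w = w - c *: a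
  & forall w, inW w ->
      E i j *m (E i j *m w) = (kp / 2) *: (w - qt i j *m w) /\
      (qt i j *m w = w -> E i j *m w = 0)].
Proof.
move=> ij [u0 hu0] Ww1 nfix.
have Ew1 : E i j *m w1 <> 0.
  by move=> h; apply: nfix; rewrite qtE; exact: (E_fix rsg ij h).
set u := E i j *m w1 in Ew1.
have hu w : inW w -> exists c, E i j *m w = c *: u.
  move=> Ww; have [c1 e1] := hu0 _ Ww1; have [c e] := hu0 _ Ww.
  have c10 : c1 != 0.
    by apply/eqP => c10; apply: Ew1; rewrite /u e1 c10 scale0r.
  by exists (c / c1); rewrite /u e1 scalerA mulfVK.
pose a := E i j *m u.
have Wa : inW a by exact: inW_EE.
have [kp ekp] := hu _ Wa.
have kp0 : kp != 0.
  apply/eqP => kp0; apply: Ew1.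
  have : E i j *m (E i j *m u) = 0 by rewrite -/a ekp kp0 scale0r.
  by move=> /(E_semisimple rsg ij) /(E_semisimple rsg ij).
have a0 : a <> 0 by move=> /(E_semisimple rsg ij).
have [e qe] : exists e, qt i j *m u = e *: u.
  have [e ee] := hu _ (inW_qt ij Ww1).
  by exists e; rewrite /u mulmxA (E_qt_comm rsg ij) -mulmxA.
have qa : qt i j *m a = e *: a.
  by rewrite /a mulmxA (E_qt_comm rsg ij) -mulmxA qe -scalemxAr.
have split_w w : inW w -> exists c, [/\ E i j *m w = (c * kp) *: u &
    qt i j *m w = w + (c * (e - 1)) *: a].
  move=> Ww; have [c ec] := hu _ Ww.
  exists (c / kp); split; first by rewrite mulfVK.
  have : E i j *m (w - (c / kp) *: a) = 0.
    by rewrite mulmxBr -scalemxAr ekp ec scalerA mulfVK// subrr.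
  move=> /(E_fix rsg ij) /(_ (pi / 2)); rewrite -qtE.
  rewrite mulmxBr -scalemxAr qa => /eqP; rewrite subr_eq => /eqP ->.
  by apply/matrixP => x y; rewrite !mxE; ring.
have e2 : e ^+ 2 = 1.
  have := qtW_inv ij Wa; rewrite qa -scalemxAr qa scalerA -expr2 => /eqP.
  rewrite -subr_eq0 -{2}(scale1r a) -scalerBl scaler_eq0.
  by case/orP => [|/eqP //]; rewrite subr_eq0 => /eqP.
have {}e2 : e = -1.
  have : (e == 1) || (e == -1) by rewrite -sqrf_eq1 e2.
  case/orP => /eqP // e1; case: nfix.
  by have [c [_ ->]] := split_w _ Ww1; rewrite e1 subrr mulr0 scale0r addr0.
exists a, kp; split => //; first by rewrite qa e2 scaleN1r.
  move=> w Ww; have [c [_ ->]] := split_w _ Ww; exists (2 * c).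
  by rewrite e2; apply/matrixP => x y; rewrite !mxE; ring.
move=> w Ww; have [c [h1 h2]] := split_w _ Ww; split.
  rewrite h1 -scalemxAr -/a h2 e2.
  by apply/matrixP => x y; rewrite !mxE; field.
rewrite h2 h1 => /eqP; rewrite -subr_eq0 addrAC subrr add0r scaler_eq0 e2.
case/orP => [|/eqP //]; rewrite mulf_eq0 => /orP[/eqP -> | ].
  by rewrite mul0r scale0r.
by rewrite -opprD oppr_eq0 (_ : 1 + 1 = 2%:R) // pnatr_eq0.
Qed.

(** Permutation action generated by one vector: if [a] is fixed by the
    transpositions of [D] that avoid [p], then its images under the
    transpositions [(p j)] are permuted by the transpositions of [D]. *)
Definition orbit_vec p a j : 'cV[R]_N := if j == p then a else qt p j *m a.

Lemma orbit_vec_inW p a j : inW a -> inW (orbit_vec p a j).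
Proof.
move=> Wa; rewrite /orbit_vec; case: eqVneq => // jp.
by apply: inW_qt => //; rewrite eq_sym.
Qed.

Lemma orbit_vec_tperm (D : pred 'I_n) p a : D p -> inW a ->
  (forall k l, k != l -> D k -> D l -> k != p -> l != p -> qt k l *m a = a) ->
  forall k l j, k != l -> D k -> D l -> D j ->
  qt k l *m orbit_vec p a j = orbit_vec p a (tperm k l j).
Proof.
move=> Dp Wa fixa.
have case1 l j : l != p -> D l -> D j ->
    qt p l *m orbit_vec p a j = orbit_vec p a (tperm p l j).
  move=> lp Dl Dj; have pl : p != l by rewrite eq_sym.
  rewrite /orbit_vec; case: eqVneq => [->|jp].
    by rewrite tpermL (negPf lp).
  have pj : p != j by rewrite eq_sym.
  have [<-|lj] := eqVneq l j.
    by rewrite tpermR eqxx qtW_inv.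
  rewrite tpermD ?(negPf jp)// qtW_conj// tpermL tpermD//.
  rewrite (qtW_conj lj pl Wa) tpermL tpermD 1?eq_sym//.
  by rewrite fixa.
move=> k l j kl Dk Dl Dj.
have [kp|kp] := eqVneq k p; first by rewrite kp case1// -kp eq_sym.
have [lp|lp] := eqVneq l p.
  rewrite qtW_sym 1?eq_sym//; last exact: orbit_vec_inW.
  by rewrite tpermC lp case1.
rewrite /orbit_vec; case: (eqVneq j p) => [->|jp].
  by rewrite tpermD// eqxx fixa.
have -> : (tperm k l j == p) = false.
  apply/negP => /eqP e; have := congr1 (tperm k l) e.
  by rewrite tpermK tpermD// => /eqP; rewrite (negPf jp).
have pj : p != j by rewrite eq_sym.
by rewrite (qtW_conj kl pj Wa) fixa// tpermD.
Qed.

Section Base.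
Variables (v : 'cV[R]_N) (i0 p : 'I_n).
Hypothesis i0p : i0 != p.
Hypothesis Wv : inW v.
Hypothesis nv1 : qt i0 p *m v <> v.
Hypothesis nv2 : forall k, k != i0 -> k != p -> qt i0 p *m (qt i0 k *m v) <> v.
Hypothesis nv3 : forall k l, k != l -> k != i0 -> k != p -> l != i0 -> l != p ->
  qt i0 p *m (qt k l *m v) <> v.
Hypothesis rk1 : forall i j, i != j -> rank_one i j.

Lemma qt_nontrivial i j : i != j -> exists w, inW w /\ qt i j *m w <> w.
Proof.
pose Q k l := exists w, inW w /\ qt k l *m w <> w.
apply: (@pair_transport n Q i0 p) => //; last by exists v.
move=> k l s t kl st [w [Ww h]]; exists (qt s t *m w); split; first exact: inW_qt.
rewrite -qtW_conj// => e; apply: h.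
by rewrite -(qtW_inv st (inW_qt kl Ww)) e qtW_inv.
Qed.

(** Two reflections with the same root compose to a transvection along it, which
    has infinite order or is trivial.  As a product of two transpositions has
    order 2 or 3, it would be trivial. *)
Lemma same_root a s t : (forall w, inW w -> exists c, s *m w = w - c *: a) ->
  (forall w, inW w -> exists c, t *m w = w - c *: a) ->
  s *m a = - a -> t *m a = - a ->
  forall w : 'cV[R]_N, inW w -> inW a ->
  exists c, s *m (t *m w) = w + c *: a /\
    forall m, iter m (fun x => s *m (t *m x)) w = w + (m%:R * c) *: a.
Proof.
move=> hs ht' sa ta w Ww Wa.
have [c1 e1] := hs _ Ww; have [c2 e2] := ht' _ Ww.
have st : s *m (t *m w) = w + (c2 - c1) *: a.
  rewrite e2 mulmxBr -scalemxAr sa e1.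
  by apply/matrixP => x y; rewrite !mxE; ring.
exists (c2 - c1); split => //; elim=> [|m IH]; first by rewrite mul0r scale0r addr0.
rewrite iterS IH !mulmxDr st -!scalemxAr ta mulmxN sa opprK.
by apply/matrixP => x y; rewrite !mxE -natr1; ring.
Qed.

(** The root [a] of the transposition [(i0 p)] is fixed by the transpositions that
    avoid [i0] and [p], since otherwise [(i0 p)] and a disjoint transposition
    would have the same root, so that their product would fix v.  The
    images [b j] of [a] under [(p j)] behave as the roots [w j - w i0] of the
    permutation module, so their sum is fixed by the transpositions avoiding
    [i0], and it is moved by [(i0 p)]. *)
Lemma standard_vector : exists w1, [/\ inW w1,
   forall k l, k != l -> k != i0 -> l != i0 -> qt k l *m w1 = w1 &
   qt i0 p *m w1 <> w1].
Proof.
have pi0 : p != i0 by rewrite eq_sym.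
have [a [_ [Wa a0 qa root _]]] := reflectionP i0p (rk1 i0p) Wv nv1.
have eig b : inW b -> qt i0 p *m b = - b -> exists c, b = c *: a.
  move=> Wb; have [c ->] := root _ Wb => e; exists (c / 2).
  by apply/matrixP => x y; move/matrixP/(_ x y): e; rewrite !mxE => e; lra.
have line_root k l : k != l -> qt k l *m a = - a ->
    forall w, inW w -> exists c, qt k l *m w = w - c *: a.
  move=> kl ea; have [w' [Ww' nw']] := qt_nontrivial kl.
  have [a' [_ [_ _ _ root' _]]] := reflectionP kl (rk1 kl) Ww' nw'.
  have [c' e'] := root' _ Wa.
  have c'0 : c' != 0.
    apply/eqP => c'0; apply: a0; apply/matrixP => x y.
    move: e'; rewrite ea c'0 scale0r subr0 => /matrixP/(_ x y).
    by rewrite !mxE; lra.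
  move=> w Ww; have [c ->] := root' _ Ww; exists (c / c' * 2).
  have -> : a = (c' / 2) *: a'.
    apply/matrixP => x y; move: e'; rewrite ea => /matrixP/(_ x y).
    by rewrite !mxE; lra.
  by rewrite scalerA; congr (_ - _ *: _); field.
(* disjoint transpositions act by distinct reflections, so their roots
   are fixed by each other *)
have disj k l : k != l -> k != i0 -> l != i0 -> k != p -> l != p -> qt k l *m a = a.
  move=> kl ki li kp lp.
  have comm w : inW w -> qt i0 p *m (qt k l *m w) = qt k l *m (qt i0 p *m w).
    by move=> Ww; rewrite qtW_conj// !tpermD// eq_sym.
  have [d ed] : exists c, qt k l *m a = c *: a.
    by apply: eig; [exact: inW_qt | rewrite comm// qa mulmxN].
  have d2 : d ^+ 2 = 1.
    have := qtW_inv kl Wa; rewrite ed -scalemxAr ed scalerA -expr2 => /eqP.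
    rewrite -subr_eq0 -{2}(scale1r a) -scalerBl scaler_eq0.
    by case/orP => [|/eqP //]; rewrite subr_eq0 => /eqP.
  have : (d == 1) || (d == -1) by rewrite -sqrf_eq1 d2.
  case/orP => /eqP d1; first by rewrite ed d1 scale1r.
  have qkla : qt k l *m a = - a by rewrite ed d1 scaleN1r.
  have [c [e1 /(_ 2%N) /=]] := same_root root (line_root _ _ kl qkla) qa qkla Wv Wa.
  have Wq := inW_qt kl Wv.
  rewrite -(comm (qt k l *m v))// (qtW_inv kl Wv) (qtW_inv i0p Wv).
  move=> /eqP; rewrite eq_sym addrC -subr_eq0 addrK scaler_eq0 => /orP[|/eqP //].
  rewrite mulf_eq0 pnatr_eq0 /= => /eqP c0.
  by case: (@nv3 k l) => //; rewrite e1 c0 scale0r addr0.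
pose b := orbit_vec p a.
have Wb j : inW (b j) by exact: orbit_vec_inW.
have bp : b p = a by rewrite /b /orbit_vec eqxx.
have b_perm k l j : k != l -> k != i0 -> l != i0 -> j != i0 ->
    qt k l *m b j = b (tperm k l j).
  move=> kl ki li ji; apply: (@orbit_vec_tperm (fun x => x != i0)) => //.
have b_root j : j != i0 -> j != p -> qt i0 p *m b j = b j - a.
  move=> ji jp; have ij : i0 != j by rewrite eq_sym.
  have pj : p != j by rewrite eq_sym.
  have bE : qt p j *m a = b j by rewrite -bp b_perm// tpermL.
  have bE' : qt p j *m b j = a by rewrite b_perm// tpermR.
  have bj : qt i0 j *m b j = - b j.
    rewrite -{1}bE -{1}(tpermL p j) -{1}(@tpermD _ p j i0) 1?eq_sym//.
    by rewrite -qtW_conj// qa mulmxN bE.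
  have [mu emu] := root _ (Wb j).
  have : qt p j *m (qt i0 p *m b j) = - (qt i0 p *m b j).
    rewrite -{1}(tpermL i0 p) -{1}(@tpermD _ i0 p j) 1?eq_sym//.
    by rewrite -qtW_conj// bj mulmxN.
  rewrite emu mulmxBr -scalemxAr bE bE' => e.
  have {e} : (1 - mu) *: (a + b j) = 0.
    apply/matrixP => x y; move/matrixP/(_ x y): e; rewrite !mxE => e; lra.
  move=> /eqP; rewrite scaler_eq0 subr_eq0 => /orP[/eqP <-|]; first by rewrite scale1r.
  rewrite addrC addr_eq0 => /eqP ba.
  (* otherwise (i0 p) and (i0 j) have the same root, so that the 3-cycle
     they generate acts trivially *)
  have qja : qt i0 j *m a = - a.
    by rewrite -[a]opprK -ba mulmxN bj.
  have [c [e1 /(_ 3%N) /=]] := same_root root (line_root _ _ ij qja) qa qja Wv Wa.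
  have W1 w : inW w -> inW (qt i0 p *m w) by exact: inW_qt.
  have W2 w : inW w -> inW (qt i0 j *m w) by exact: inW_qt.
  have sts w : inW w -> qt i0 p *m (qt i0 j *m (qt i0 p *m w)) = qt p j *m w.
    move=> Ww; rewrite qtW_conj//; last exact: W1.
    by rewrite tpermL tpermD// qtW_inv.
  have tst w : inW w -> qt i0 j *m (qt i0 p *m (qt i0 j *m w)) = qt p j *m w.
    move=> Ww; rewrite (qtW_conj ij i0p); last exact: W2.
    rewrite tpermL tpermD// (qtW_inv ij Ww) qtW_sym//.
  rewrite (sts _ (W2 _ (W1 _ (W2 _ Wv)))) (tst _ Wv) (qtW_inv pj Wv).
  move=> /eqP; rewrite eq_sym addrC -subr_eq0 addrK scaler_eq0 => /orP[|/eqP //].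
  rewrite mulf_eq0 pnatr_eq0 /= => /eqP c0.
  by case: (@nv2 j) => //; rewrite e1 c0 scale0r addr0.
exists (\sum_(j | j != i0) b j); split.
- by apply: inW_sum => j _.
- move=> k l kl ki li; rewrite mulmx_sumr.
  rewrite [RHS](reindex_inj (@perm_inj _ (tperm k l))) /=.
  apply: eq_big => j; last by move=> ji; rewrite b_perm.
  by rewrite -(inj_eq (@perm_inj _ (tperm k l)) j i0) (@tpermD _ k l i0).
rewrite mulmx_sumr (bigD1 p)//= [X in _ <> X](bigD1 p)//= bp qa.
under eq_bigr => j /andP[ji jp] do rewrite b_root//.
rewrite sumrB sumr_const => /eqP; rewrite -subr_eq0 => /eqP e.
apply: a0; apply/matrixP => x y; move/matrixP/(_ x y): e.
rewrite !mxE -scaler_nat !mxE => e.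
set m := (#|_|%:R : R) in e; have m0 : 0 <= m by exact: ler0n.
have : (2 + m) * a x y = 0 by lra.
by move=> /eqP; rewrite mulf_eq0 => /orP[|/eqP //]; rewrite gt_eqF//; lra.
Qed.

End Base.
End Reflections.

(** * Vectors that transform like the elementary symmetric matrices *)

Lemma third_index n (n3 : (3 <= n)%N) (i j : 'I_n) : exists k, (k != i) && (k != j).
Proof.
pose o m (h : (m < 3)%N) := Ordinal (leq_trans h n3).
case: (boolP ((@o 0%N isT != i) && (@o 0%N isT != j))) => h0; first by eexists; exact: h0.
case: (boolP ((@o 1%N isT != i) && (@o 1%N isT != j))) => h1; first by eexists; exact: h1.
exists (@o 2%N isT); move: h0 h1; rewrite -!val_eqE /=.
move: (val i) (val j) => x y; lia.
Qed.


Section SymSystem.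
Variables (R : realType) (n N : nat) (sg : 'M[R]_n -> 'M[R]_N).
Hypothesis rsg : is_matrix_rep sg.
Local Notation qt := (qt sg).
Local Notation E := (E sg).
Local Notation inW := (inW sg).

(** [om i j] plays the role of the symmetric matrix [e_i e_j^T + e_j e_i^T]:
    the generators act on it by the Leibniz rule. *)
Definition sym_system (om : 'I_n -> 'I_n -> 'cV[R]_N) : Prop :=
  [/\ forall i j, om i j = om j i,
      forall i j, i != j -> om i j <> 0
    & forall k l i j, k != l -> E k l *m om i j =
        (k == i)%:R *: om l j - (l == i)%:R *: om k j
        + ((k == j)%:R *: om i l - (l == j)%:R *: om i k)].

Lemma ENv i j (w : 'cV[R]_N) : i != j -> E j i *m w = - (E i j *m w).
Proof. by move=> ij; rewrite (EC rsg ij) mulNmx. Qed.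

Lemma E_bracket_v i j k (w : 'cV[R]_N) : i != j -> i != k -> j != k ->
  E j k *m (E i j *m w) = E i k *m w + E i j *m (E j k *m w).
Proof.
move=> ij ik jk; rewrite -(E_bracket rsg ij ik jk) !mulmxA mulmxBl.
by rewrite subrK.
Qed.

Section FromDiagonal.
Variable w : 'I_n -> 'cV[R]_N.
Hypothesis w_other : forall k l i, k != l -> k != i -> l != i -> E k l *m w i = 0.
Hypothesis w_pair : forall i j, i != j -> E i j *m (w i + w j) = 0.
Hypothesis w_sq : forall i j, i != j ->
  E i j *m (E i j *m w i) = (- 2) *: (w i - w j).
Hypothesis w_neq0 : forall i j, i != j -> E i j *m w i <> 0.

(** In the model [w i] is the matrix unit [e_i e_i^T]. *)
Definition sym_of_diag i j := if i == j then 2 *: w i else E i j *m w i.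

Lemma diag_swap i j : i != j -> E j i *m w j = E i j *m w i.
Proof.
move=> ij; rewrite ENv//; have /eqP := w_pair ij.
by rewrite mulmxDr addr_eq0 => /eqP ->.
Qed.

(** [E j k] kills [w i], so it acts on [E i j (w i)] through its bracket with
    [E i j]. *)
Lemma diag_step i j k : i != j -> i != k -> j != k ->
  E j k *m (E i j *m w i) = E i k *m w i.
Proof.
move=> ij ik jk; rewrite E_bracket_v// (w_other jk) 1?eq_sym//.
by rewrite mulmx0 addr0.
Qed.

(** The Leibniz rule is checked by cases on coincidences between the indices of
    the generator and those of the vector; [w_sq] is the case of equal pairs. *)
Lemma sym_system_of_diag : sym_system sym_of_diag.
Proof.
have sC i j : sym_of_diag i j = sym_of_diag j i.
  rewrite /sym_of_diag [j == i]eq_sym; case: eqVneq => [->//|ij].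
  exact: esym (diag_swap ij).
have sO i j : i != j -> sym_of_diag i j = E i j *m w i.
  by rewrite /sym_of_diag => /negPf ->.
have sD i : sym_of_diag i i = 2 *: w i by rewrite /sym_of_diag eqxx.
move: sC sO sD; move: sym_of_diag => om sC sO sD.
split=> //.
  by move=> i j ij; rewrite sO//; exact: w_neq0.
(* it suffices to treat k = i or disjoint indices *)
pose rhs k l i j := (k == i)%:R *: om l j - (l == i)%:R *: om k j
        + ((k == j)%:R *: om i l - (l == j)%:R *: om i k).
have base k l j : k != l -> E k l *m om k j = rhs k l k j.
  move=> kl; have lk : l != k by rewrite eq_sym.
  rewrite /rhs eqxx (negPf lk) scale1r scale0r subr0.
  have [<-|kj] := eqVneq k j.
    rewrite (negPf lk) scale1r scale0r subr0 sD (sC l k) sO// -scalemxAr.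
    by rewrite scaler_nat mulr2n.
  have [<-|lj] := eqVneq l j.
    rewrite scale1r scale0r sub0r !sD sO// w_sq//.
    by apply/matrixP => x y; rewrite !mxE; ring.
  have jk : j != k by rewrite eq_sym.
  have jl : j != l by rewrite eq_sym.
  rewrite !scale0r subr0 addr0 (sC k j) sO// (sC l j) sO//.
  exact: diag_step.
have base' k l i j : k != l -> k != i -> l != i -> k != j -> l != j ->
    E k l *m om i j = 0.
  move=> kl ki li kj lj; have [<-|ij] := eqVneq i j.
    by rewrite sD -scalemxAr w_other// scaler0.
  rewrite sO// mulmxA (E_comm rsg ij kl) 1?eq_sym// -mulmxA w_other//.
  by rewrite mulmx0.
have rN k l i j : rhs l k i j = - rhs k l i j.
  by rewrite /rhs; apply/matrixP => x y; rewrite !mxE; ring.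
have rC k l i j : rhs k l j i = rhs k l i j.
  rewrite /rhs (sC l i) (sC k i) (sC j l) (sC j k).
  by apply/matrixP => x y; rewrite !mxE; ring.
move=> k l i j kl; rewrite -/(rhs k l i j).
have [<-|ki] := eqVneq k i; first exact: base.
have lk : l != k by rewrite eq_sym.
have [<-|li] := eqVneq l i; first by rewrite ENv// base// -rN.
have [<-|kj] := eqVneq k j; first by rewrite sC base// rC.
have [<-|lj] := eqVneq l j; first by rewrite sC ENv// base// -rN rC.
rewrite base'// /rhs (negPf ki) (negPf li) (negPf kj) (negPf lj).
by rewrite !scale0r !subr0 addr0.
Qed.

End FromDiagonal.

Section FromReflections.
Variables (v : 'cV[R]_N) (i0 p : 'I_n).
Hypothesis i0p : i0 != p.
Hypothesis n3 : (3 <= n)%N.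
Hypothesis Wv : inW v.
Hypothesis nv1 : qt i0 p *m v <> v.
Hypothesis nv2 : forall k, k != i0 -> k != p -> qt i0 p *m (qt i0 k *m v) <> v.
Hypothesis nv3 : forall k l, k != l -> k != i0 -> k != p -> l != i0 -> l != p ->
  qt i0 p *m (qt k l *m v) <> v.
Hypothesis rk1 : forall i j, i != j -> rank_one sg i j.

(** All hypotheses of [sym_system_of_diag] but the normalization of the square
    are properties of the reflections.  The constant in the square is forced to
    be [-2] by the commutation relation with a third index. *)
Lemma reflections_sym_system : exists om, sym_system om.
Proof.
have [w1 [Ww1 fix1 nfix1]] := standard_vector rsg i0p Wv nv1 nv2 nv3 rk1.
pose w := orbit_vec sg i0 w1.
have Ww i : inW (w i) by exact: orbit_vec_inW.
have w_perm k l i : k != l -> qt k l *m w i = w (tperm k l i).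
  move=> kl; apply: (@orbit_vec_tperm _ _ _ _ rsg xpredT) => //.
  by move=> k' l' kl' _ _; exact: fix1.
have w_inj i j : i != j -> w i <> w j.
  have w0 j' : j' != i0 -> w i0 <> w j'.
    move=> ji e; apply: nfix1.
    have w1E : w1 = w i0 by rewrite /w /orbit_vec eqxx.
    rewrite {1}w1E w_perm// tpermL w1E.
    have [<-|jp] := eqVneq j' p; first by rewrite e.
    have := congr1 (mulmx (qt j' p)) e.
    by rewrite !w_perm// tpermL tpermD// eq_sym.
  move=> ij e; have [ii|ii] := eqVneq i i0.
    by apply: (w0 j); [rewrite -ii eq_sym | rewrite -e ii].
  have := congr1 (mulmx (qt i i0)) e; rewrite !w_perm// tpermL; apply: w0.
  by rewrite -{2}(tpermL i i0) tperm_neq// eq_sym.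
have refl i j : i != j -> exists kp : R, forall u, inW u ->
    E i j *m (E i j *m u) = (kp / 2) *: (u - qt i j *m u) /\
    (qt i j *m u = u -> E i j *m u = 0).
  move=> ij; have nfix : qt i j *m w i <> w i.
    by rewrite w_perm// tpermL => /esym; exact: w_inj.
  by have [_ [kp [_ _ _ _ h]]] := reflectionP rsg ij (rk1 ij) (Ww i) nfix; exists kp.
have w_other k l i : k != l -> k != i -> l != i -> E k l *m w i = 0.
  move=> kl ki li; have [kp h] := refl _ _ kl; apply: (h _ (Ww i)).2.
  by rewrite w_perm// tpermD.
have w_pair i j : i != j -> E i j *m (w i + w j) = 0.
  move=> ij; have [kp h] := refl _ _ ij; apply: (h _ (inWD (Ww i) (Ww j))).2.
  by rewrite mulmxDr !w_perm// tpermL tpermR addrC.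
have w_neq0 i j : i != j -> E i j *m w i <> 0.
  move=> ij h; have := E_fix rsg ij h (pi / 2); rewrite -qtE w_perm//.
  by rewrite tpermL => /esym; exact: w_inj.
exists (sym_of_diag w); apply: sym_system_of_diag => // i j ij.
have [kp h] := refl _ _ ij; have [h1 _] := h _ (Ww i).
rewrite h1 w_perm// tpermL; congr (_ *: _).
have [k /andP[ki kj]] := third_index n3 i j.
have ik : i != k by rewrite eq_sym.
have jk : j != k by rewrite eq_sym.
have ji : j != i by rewrite eq_sym.
(* evaluate [E_jk, E_ij] = E_ik on E_ij w_i *)
have e1 : E j k *m (E i j *m (E i j *m w i)) = - (kp / 2) *: (E j k *m w j).
  rewrite h1 w_perm// tpermL -scalemxAr mulmxBr (w_other _ _ _ jk ji ki) sub0r.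
  by rewrite scalerN scaleNr.
have e2 := diag_step w_other ij ik jk.
have e3 : E i j *m (E i k *m w i) = E j k *m w j.
  rewrite -(diag_swap w_pair ik) diag_step// 1?eq_sym//.
  by rewrite (diag_swap w_pair jk).
have e4 : E i k *m (E i j *m w i) = E j k *m w j.
  by rewrite -(diag_swap w_pair ij) diag_step.
have := E_bracket_v (E i j *m w i) ij ik jk.
rewrite e1 e2 e3 e4 => /eqP; rewrite -subr_eq0 -{2 3}[E j k *m w j]scale1r.
rewrite -scalerDl -scalerBl scaler_eq0 => /orP[/eqP e|/eqP].
  lra.
by move/w_neq0 => /(_ jk).
Qed.

End FromReflections.
End SymSystem.

(** * Eigenspaces of the diagonal group and the rank of the generators *)

(** Joint eigenvectors with pairwise distinct eigenvalue systems are
    independent: [\prod_(j != i) (op (g j) - chi j (g j))] kills all of them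
    but the [i]-th one, where [g j] separates [j] from [i]. *)
Lemma directv_joint_eigen (F : fieldType) (N : nat) (I : finType) (P : pred I)
    (G : Type) (g0 : G) (op : G -> 'M[F]_N) (chi : I -> G -> F)
    (Us : I -> {vspace 'cV[F]_N}) :
  (forall i u g, P i -> u \in Us i -> op g *m u = chi i g *: u) ->
  (forall i j, P i -> P j -> i != j -> exists g, chi i g != chi j g) ->
  directv (\sum_(i | P i) Us i).
Proof.
move=> eig sep; apply/directv_sum_independent => us Uus us0 i Pi.
have /choice[g hg] : forall j, exists g, P j && (i != j) -> chi i g != chi j g.
  move=> j; case: (boolP (P j && (i != j))) => [/andP[Pj ij]|_].
    by have [g hg] := sep i j Pi Pj ij; exists g.
  by exists g0.
have key (s : seq I) : \sum_(k | P k)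
    (\prod_(j <- s) (chi k (g j) - chi j (g j))) *: us k = 0.
  elim: s => [|j s IH].
    by under eq_bigr do rewrite big_nil scale1r.
  rewrite -[RHS](mulmx0 _ (op (g j) - (chi j (g j))%:M)) -[in RHS]IH mulmx_sumr.
  apply: eq_bigr => k Pk; rewrite big_cons -scalemxAr mulmxBl mul_scalar_mx.
  by rewrite (eig k)// ?Uus// -scalerBl scalerA mulrC.
have := key [seq j <- index_enum I | P j && (i != j)].
rewrite (bigD1 i)//= [X in _ + X]big1 ?addr0.
  move=> /eqP; rewrite scaler_eq0 => /orP[|/eqP //].
  rewrite big_filter prodf_seq_eq0 => /hasP[j _ /andP[h]].
  by rewrite subr_eq0 (negPf (hg j h)).
move=> k /andP[Pk ki]; rewrite (bigD1_seq k)//= ?subrr ?mul0r ?scale0r//.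
  by rewrite mem_filter Pk eq_sym ki mem_index_enum.
by rewrite filter_uniq// index_enum_uniq.
Qed.

Section JointEigenspaces.
Variables (R : realType) (n N : nat) (sg : 'M[R]_n -> 'M[R]_N).
Hypothesis rsg : is_matrix_rep sg.
Local Notation qt := (qt sg).
Local Notation ht := (ht sg).
Local Notation E := (E sg).
Local Notation inW := (inW sg).

(** The half turn of the plane [k, l] acts by the scalar [chi (k, l)]. *)
Definition eig (chi : 'I_n * 'I_n -> R) : {vspace 'cV[R]_N} :=
  (\bigcap_(kl : 'I_n * 'I_n | kl.1 != kl.2)
     lker (linfun (mulmx (ht kl.1 kl.2 - (chi kl)%:M) : 'cV[R]_N -> 'cV[R]_N)))%VS.

Lemma eigP chi u : reflect
  (forall k l, k != l -> ht k l *m u = chi (k, l) *: u) (u \in eig chi).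
Proof.
have mem_ker k l : (u \in lker (linfun
    (mulmx (ht k l - (chi (k, l))%:M) : 'cV[R]_N -> 'cV[R]_N))) =
    (ht k l *m u == chi (k, l) *: u).
  by rewrite memv_ker lfunE /= mulmxBl mul_scalar_mx subr_eq0.
rewrite memvE; apply: (iffP subv_bigcapP) => h.
  by move=> k l kl; have := h (k, l) kl; rewrite -memvE mem_ker => /eqP.
by move=> [k l] /= kl; rewrite -memvE mem_ker h.
Qed.

Definition in_pair (i j k : 'I_n) := (k == i) || (k == j).

(** The character [d |-> d i * d j] of the diagonal group; the half turn of the
    plane [k, l] is the diagonal matrix with [d k = d l = -1]. *)
Definition pair_chi (i j : 'I_n) (kl : 'I_n * 'I_n) : R :=
  (-1) ^+ (in_pair i j kl.1 (+) in_pair i j kl.2).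

Definition Wv : {vspace 'cV[R]_N} := eig (fun=> 1).
Definition Uv i j : {vspace 'cV[R]_N} := eig (pair_chi i j).

Lemma WvP u : reflect (inW u) (u \in Wv).
Proof.
by apply: (iffP (eigP _ _)) => h k l kl; have := h k l kl; rewrite ?scale1r.
Qed.

Lemma ht_E_chi i j k l (w : 'cV[R]_N) : i != j -> k != l ->
  ht k l *m (E i j *m w) = pair_chi i j (k, l) *: (E i j *m (ht k l *m w)).
Proof.
move=> ij kl; rewrite (ht_Ev rsg _ kl ij).
rewrite /pair_chi /in_pair /=; congr ((-1) ^+ (nat_of_bool _) *: _).
by move: ij kl; rewrite -!val_eqE /=; lia.
Qed.

Lemma E_Uv i j w : i != j -> inW w -> E i j *m w \in Uv i j.
Proof.
by move=> ij Ww; apply/eigP => k l kl; rewrite ht_E_chi// Ww.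
Qed.

Lemma qt_Uv i j k l u : k != l -> u \in Uv i j ->
  qt k l *m u \in Uv (tperm k l i) (tperm k l j).
Proof.
move=> kl /eigP Uu; apply/eigP => s t st.
have st' := @tperm_neq n k l s t st.
have := qt_ht rsg kl st'; rewrite !tpermK => e.
rewrite mulmxA -e -mulmxA Uu// -scalemxAr /pair_chi /in_pair /=.
have h (x y : 'I_n) : (tperm k l x == y) = (x == tperm k l y).
  by rewrite -(inj_eq (@perm_inj _ (tperm k l)) _ (tperm k l y)) tpermK.
by rewrite !h.
Qed.

Lemma dim_Uv_le i j k l : k != l ->
  (\dim (Uv i j) <= \dim (Uv (tperm k l i) (tperm k l j)))%N.
Proof.
move=> kl; pose f : 'Hom('cV[R]_N, 'cV[R]_N) := linfun (mulmx (qt k l)).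
have fE u : f u = qt k l *m u by rewrite lfunE.
have f0 : lker f = 0%VS.
  apply/eqP; rewrite -subv0; apply/subvP => u; rewrite memv_ker fE => /eqP h.
  by rewrite -[u]mul1mx -(qtNK rsg kl) -mulmxA h mulmx0 mem0v.
rewrite -(@limg_dim_eq _ _ _ f (Uv i j)); last by rewrite f0 capv0.
apply: dimvS; apply/subvP => _ /memv_imgP[u Uu ->].
by rewrite fE; exact: qt_Uv.
Qed.

Lemma dim_Uv i j i' j' : i != j -> i' != j' ->
  (\dim (Uv i j) <= \dim (Uv i' j'))%N.
Proof.
pose Q k l := (\dim (Uv i j) <= \dim (Uv k l))%N.
move=> ij; apply: (@pair_transport n Q i j) => //; last exact: leqnn.
move=> k l s t _ st h.
exact: leq_trans h (dim_Uv_le _ _ st).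
Qed.

Lemma rank_one_dim i j : i != j -> (\dim (Uv i j) <= 1)%N -> rank_one sg i j.
Proof.
move=> ij d1; exists (vpick (Uv i j)) => w Ww.
have sub : (Uv i j <= <[vpick (Uv i j)]>)%VS.
  suff /eqP -> : <[vpick (Uv i j)]>%VS == Uv i j by [].
  rewrite eqEdim -memvE memv_pick dim_vline vpick0.
  by case: eqP d1 => [->|_] //; rewrite dimv0.
by apply/vlineP/(subvP sub); exact: E_Uv.
Qed.

End JointEigenspaces.

Lemma neq1N1 (R : numDomainType) : (1 : R) != -1.
Proof. by rewrite -subr_eq0 opprK (_ : 1 + 1 = 2%:R) // pnatr_eq0. Qed.

Section Counting.
Variables (R : realType) (n N : nat) (sg : 'M[R]_n -> 'M[R]_N).
Hypothesis rsg : is_matrix_rep sg.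
Hypothesis n3 : (3 <= n)%N.
Local Notation Wv := (Wv sg).
Local Notation Uv := (Uv sg).
Local Notation chi := (@pair_chi R n).

Lemma dim_cV (U : {vspace 'cV[R]_N}) : (\dim U <= N)%N.
Proof.
have := dimvS (subvf U); rewrite dimvf /= dim_matrix.
by rewrite /GRing.mul /= muln1.
Qed.

Lemma pair_chi_neq i j i' j' (k l : 'I_n) :
  in_pair i j k != in_pair i' j' k -> in_pair i j l = in_pair i' j' l ->
  chi i j (k, l) != chi i' j' (k, l).
Proof.
have n1 := neq1N1 R.
rewrite /pair_chi /= => h1 ->; move: h1.
by case: (in_pair i j k); case: (in_pair i' j' k) => // _;
  case: (in_pair i' j' l); rewrite /= ?expr0 ?expr1 // eq_sym.
Qed.

(** Eigenspaces of distinct characters are independent; a third index separates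
    the trivial character, that of W, from the character of a pair. *)
Lemma dim_W_Uv (P : pred ('I_n * 'I_n)) :
  (forall ij, P ij -> ij.1 != ij.2) ->
  (forall ij ij', P ij -> P ij' -> ij != ij' ->
     exists kl, chi ij.1 ij.2 kl != chi ij'.1 ij'.2 kl) ->
  (\dim Wv + \sum_(ij | P ij) \dim (Uv ij.1 ij.2) <= N)%N.
Proof.
move=> Pne Psep.
pose Us (x : unit + 'I_n * 'I_n) : {vspace 'cV[R]_N} :=
  if x is inr ij then Uv ij.1 ij.2 else Wv.
pose PP (x : unit + 'I_n * 'I_n) := if x is inr ij then P ij else true.
pose ops (kl : 'I_n * 'I_n) : 'M[R]_N :=
  if kl.1 == kl.2 then 1%:M else ht sg kl.1 kl.2.
pose ch (x : unit + 'I_n * 'I_n) (kl : 'I_n * 'I_n) : R :=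
  if kl.1 == kl.2 then 1 else if x is inr ij then chi ij.1 ij.2 kl else 1.
have chiD ij k : chi ij.1 ij.2 (k, k) = 1 by rewrite /pair_chi /= addbb.
have third (i j : 'I_n) := third_index n3 i j.
have chiW (ij : 'I_n * 'I_n) : ij.1 != ij.2 ->
    exists kl, 1 != (if kl.1 == kl.2 then 1 else chi ij.1 ij.2 kl).
  move=> ne; have [k /andP[ki kj]] := third ij.1 ij.2.
  exists (k, ij.1); rewrite /= (negPf ki) /pair_chi /in_pair /= (negPf ki) (negPf kj).
  by rewrite eqxx /= expr1 neq1N1.
have i0 : 'I_n by exact: Ordinal (leq_trans (isT : (0 < 3)%N) n3).
have dir : directv (\sum_(x | PP x) Us x).
  apply: (directv_joint_eigen (i0, i0) (op := ops) (chi := ch)).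
    move=> x u [k l] Px; rewrite /ops /ch /=.
    case: (eqVneq k l) => [_ _|kl]; first by rewrite mul1mx scale1r.
    case: x Px => [_ _ /WvP h|[i j] _ /eigP h]; last exact: h.
    by rewrite h// scale1r.
  move=> [[]|ij] [[]|ij'] // Px Py ne; rewrite /ch.
  - by have [kl h] := chiW _ (Pne _ Py); exists kl; move: h; case: ifP; rewrite ?eqxx.
  - have [kl h] := chiW _ (Pne _ Px); exists kl; rewrite eq_sym.
    by move: h; case: ifP; rewrite ?eqxx.
  - have [[k l] h] := Psep _ _ Px Py ne; exists (k, l) => /=.
    by case: (eqVneq k l) h => [->|//]; rewrite !chiD eqxx.
have := dim_cV (\sum_(x | PP x) Us x)%VS.
rewrite (directvP dir) /= big_sumType /= (big_pred1 tt) //.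
Qed.

(** The characters of two pairs coincide if and only if the pairs are equal or
    complementary, and complementary pairs exist for n = 4 only. *)
Lemma pair_chi_sep (i j i' j' : 'I_n) : n != 4%N ->
  (i < j)%N -> (i' < j')%N -> (i, j) != (i', j') ->
  exists kl, chi i j kl != chi i' j' kl.
Proof.
move=> n4 ij ij' ne.
have [k hk] : exists k, in_pair i j k != in_pair i' j' k.
  have [h|h] := boolP (in_pair i' j' i); last first.
    by exists i; rewrite (negPf h) /in_pair eqxx.
  exists j; move: h ne ij ij'; rewrite xpair_eqE /in_pair -!val_eqE /=.
  by move: (val i) (val j) (val i') (val j') => a b c d; lia.
have [l hl] : exists l, in_pair i j l = in_pair i' j' l.
  pose P (l : nat) := ((l == i) || (l == j)) == ((l == i') || (l == j')) :> bool.
  suff [l ln /eqP hl] : exists2 l, (l < n)%N & P l by exists (Ordinal ln).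
  have bj := ltn_ord j; have bj' := ltn_ord j'.
  have [n5|n5] := leqP 5 n.
    case: (pickP (fun l : 'I_n => l \notin [:: i; j; i'; j'])) => [l|h].
      rewrite !inE !negb_or -!val_eqE /= => /and4P[/negPf h1 /negPf h2 /negPf h3 /negPf h4].
      by exists l => //; rewrite /P h1 h2 h3 h4.
    have : {subset enum 'I_n <= [:: i; j; i'; j']} by move=> l _; exact: negbFE (h l).
    by move=> /(uniq_leq_size (enum_uniq _)); rewrite size_enum_ord leqNgt n5.
  have [h|h0] := boolP (P 0%N); first by exists 0%N => //; lia.
  have [h|h1] := boolP (P 1%N); first by exists 1%N => //; lia.
  exists 2%N; first by lia.
  move: h0 h1; rewrite /P; lia.
by exists (k, l); exact: pair_chi_neq.
Qed.

Lemma sum_pairs : (\sum_(ij : 'I_n * 'I_n | (ij.1 < ij.2)%N) 1 = 'C(n, 2))%N.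
Proof.
rewrite -(pair_big_dep xpredT (fun i j : 'I_n => (i < j)%N) (fun _ _ => 1%N)) /=.
rewrite (exchange_big_dep xpredT) //= -bin2_sum big_mkord.
apply: eq_bigr => j _.
by rewrite (big_ord_narrow (ltnW (ltn_ord j))) sum_nat_const card_ord muln1.
Qed.

(** If all the eigenspaces [Uv i j] had dimension at least 2, then V would have
    dimension at least [1 + n (n - 1)], which exceeds [(n + 2)(n - 1)/2]. *)
Lemma rank_one_generic (v : 'cV[R]_N) : n != 4%N -> inW sg v -> v <> 0 ->
  (N <= (n + 2) * (n - 1) %/ 2)%N ->
  forall i j, i != j -> rank_one sg i j.
Proof.
move=> n4 vW v0 hN i j ij; apply: (rank_one_dim rsg ij).
rewrite leqNgt; apply/negP => d2.
have Pne (x : 'I_n * 'I_n) : (x.1 < x.2)%N -> x.1 != x.2.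
  by move=> h; rewrite -val_eqE neq_ltn h.
have Psep (x y : 'I_n * 'I_n) : (x.1 < x.2)%N -> (y.1 < y.2)%N ->
    x != y -> exists kl, chi x.1 x.2 kl != chi y.1 y.2 kl.
  by case: x y => a b [a' b'] /=; exact: pair_chi_sep.
have := dim_W_Uv Pne Psep; apply/negP; rewrite -ltnNge.
have dW : (1 <= \dim Wv)%N.
  rewrite lt0n dimv_eq0; apply/eqP => W0; apply: v0.
  by apply/eqP; rewrite -memv0 -W0; apply/WvP.
have dU : (2 * 'C(n, 2) <= \sum_(ij : 'I_n * 'I_n | (ij.1 < ij.2)%N)
    \dim (Uv ij.1 ij.2))%N.
  rewrite -sum_pairs big_distrr /=; apply: leq_sum => -[a b] /= ab.
  rewrite muln1; apply: leq_trans d2 _; apply: (dim_Uv rsg) => //.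
  exact: (Pne (a, b)).
apply: leq_ltn_trans hN _; apply: leq_trans (leq_add dW dU).
have := bin2 n; have := odd_double_half (n * n.-1).
have -> : odd (n * n.-1) = false by rewrite oddM; case: n n3 => // m _ /=; rewrite andNb.
rewrite add0n -muln2 => e ->.
have : (((n + 2) * (n - 1)) %/ 2 * 2 <= (n + 2) * (n - 1))%N by exact: leq_divM.
move: e; set x := (_ %/ 2)%N; set y := (_./2)%N; clearbody x y.
move: n3; case: n => [|[|[|m]]] // _ e h.
have : (x * 2 <= (m.+3 + 2) * (m.+3 - 1))%N by [].
have : (y * 2 = m.+3 * m.+2)%N by [].
clear; nia.
Qed.

End Counting.

(** * The rank of the generators for n = 4 *)

(** Joint eigenvectors [x i] with distinct eigenvalue systems, in a space whose
    dimension is at most their number, span it. *)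
Lemma joint_eigen_span (F : fieldType) (N : nat) (I : finType) (G : Type) (g0 : G)
    (op : G -> 'M[F]_N) (chi : I -> G -> F) (U : {vspace 'cV[F]_N})
    (x : I -> 'cV[F]_N) :
  (forall i, x i \in U) -> (forall i, x i != 0) ->
  (forall i g, op g *m x i = chi i g *: x i) ->
  (forall i j, i != j -> exists g, chi i g != chi j g) ->
  (#|I| <= \dim U)%N /\
  ((\dim U <= #|I|)%N -> forall u, u \in U -> exists c : I -> F,
     u = \sum_i c i *: x i).
Proof.
move=> xU x0 eig sep.
have dir : directv (\sum_(i | xpredT i) <[x i]>).
  apply: (directv_joint_eigen g0 (op := op) (chi := chi)).
    by move=> i u g _ /vlineP[c ->]; rewrite -scalemxAr eig !scalerA mulrC.
  by move=> i j _ _; exact: sep.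
have sub : (\sum_i <[x i]> <= U)%VS.
  by apply/subv_sumP => i _; rewrite -memvE.
have dE : \dim (\sum_i <[x i]>)%VS = #|I|.
  rewrite (directvP dir) /= -sum1_card; apply: eq_bigr => i _.
  by rewrite dim_vline x0.
split; first by rewrite -dE; exact: dimvS.
move=> dU u; have -> : U = (\sum_i <[x i]>)%VS.
  by apply/eqP; rewrite eq_sym eqEdim sub dE.
move=> /memv_sumP[us Uus ->].
have /choice[c hc] : forall i, exists c, us i = c *: x i.
  by move=> i; apply/vlineP/Uus.
by exists c; apply: eq_bigr => i _.
Qed.

Lemma three_cases (Q : 'I_3 -> Prop) : Q 0 -> Q 1 -> Q 2 -> forall i, Q i.
Proof.
move=> Q0 Q1 Q2 [[|[|[|//]]] hi].
- by rewrite (_ : Ordinal hi = 0) //; exact: val_inj.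
- by rewrite (_ : Ordinal hi = 1) //; exact: val_inj.
- by rewrite (_ : Ordinal hi = 2) //; exact: val_inj.
Qed.

Section Four.
Variables (R : realType) (n N : nat) (sg : 'M[R]_n -> 'M[R]_N).
Hypothesis rsg : is_matrix_rep sg.
Hypothesis n4 : n = 4%N.
Local Notation qt := (qt sg).
Local Notation ht := (ht sg).
Local Notation E := (E sg).
Local Notation inW := (inW sg).
Local Notation Wv := (Wv sg).
Local Notation Uv := (Uv sg).
Implicit Types (u w x y : 'cV[R]_N) (a b c d i j k l s t : 'I_n).

(** [so(4) = so(3) + so(3)]: for a splitting [{a, b}, {c, d}] of the indices,
    the three operators [A a b c d], [A a c d b], [A a d b c] generate one of
    the two factors, and exchanging [c] and [d] gives the other one. The
    operators [J] of the three splittings are simultaneous quarter turns. *)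
Definition quad a b c d : bool :=
  [&& a != b, a != c, a != d, b != c, b != d & c != d].
Definition A a b c d := E a b + E c d.
Definition J a b c d := qt a b *m qt c d.

Lemma quad_rot a b c d : quad a b c d -> quad a c d b.
Proof.
rewrite /quad -!val_eqE /=.
by move: (val a) (val b) (val c) (val d) => x y z t; lia.
Qed.

Lemma quad_swap a b c d : quad a b c d -> quad a b d c.
Proof.
rewrite /quad -!val_eqE /=.
by move: (val a) (val b) (val c) (val d) => x y z t; lia.
Qed.

Lemma quad_cover a b c d k : quad a b c d -> [|| k == a, k == b, k == c | k == d].
Proof.
rewrite /quad -!val_eqE /=.
have lt4 (i : 'I_n) : (i < 4)%N by apply: leq_trans (ltn_ord i) _; rewrite n4.
move: (lt4 a) (lt4 b) (lt4 c) (lt4 d) (lt4 k).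
move: (val a) (val b) (val c) (val d) (val k) => x y z t s; lia.
Qed.

Lemma quad_exists a b : a != b -> exists c d, quad a b c d.
Proof.
have n3 : (3 <= n)%N by rewrite n4.
move=> ab; have [c /andP[ca cb]] := third_index n3 a b.
case: (pickP (fun d : 'I_n => d \notin [:: a; b; c])) => [d|h].
  rewrite !inE !negb_or => /and3P[da db dc]; exists c, d.
  by rewrite /quad ab ![_ == c]eq_sym ![_ == d]eq_sym ca cb da db dc.
have : {subset enum 'I_n <= [:: a; b; c]} by move=> l _; exact: negbFE (h l).
move=> /(uniq_leq_size (enum_uniq _)); rewrite size_enum_ord => n_le3.
by have := leq_trans (eq_leq (esym n4)) n_le3.
Qed.

Lemma quad_neq a b c d : quad a b c d ->
  ([/\ a != b, a != c & a != d] /\ [/\ b != a, b != c & b != d]) /\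
  ([/\ c != a, c != b & c != d] /\ [/\ d != a, d != b & d != c]).
Proof.
move=> /and3P[ab ac /and4P[ad bc bd cd]].
by rewrite ![_ == a]eq_sym [c == b]eq_sym ![d == _]eq_sym.
Qed.

Lemma A_bracket a b c d w : quad a b c d ->
  A a b c d *m (A a c d b *m w) - A a c d b *m (A a b c d *m w) =
  2 *: (A a d b c *m w).
Proof.
move=> q; have [[[ab ac ad] [ba bc bd]] [[ca cb cd] [da db dc]]] := quad_neq q.
have h1 := E_bracket rsg ba bc ac.
have h2 := E_bracket rsg ab ad bd.
have h3 := E_bracket rsg ac ad cd.
have h4 := E_bracket rsg cd cb db.
rewrite !mulmxA -mulmxBl scalemxAl; congr (_ *m w).
rewrite /A !mulmxDl !mulmxDr.
move: h1 h2 h3 h4; rewrite (EC rsg ab) (EC rsg bd) (EC rsg bc).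
rewrite !mulmxN !mulNmx => h1 h2 h3 h4.
apply/matrixP => x y.
move/matrixP/(_ x y): h1; move/matrixP/(_ x y): h2.
move/matrixP/(_ x y): h3; move/matrixP/(_ x y): h4.
rewrite !mxE; lra.
Qed.

Lemma J_E_aux a b c d k l : quad a b c d -> k != l ->
  J a b c d *m E k l = ((-1) ^+ ((k == d) (+) (l == d)
     (+) ((tperm c d k == b) (+) (tperm c d l == b))) *:
    E (tperm a b (tperm c d k)) (tperm a b (tperm c d l))) *m J a b c d.
Proof.
move=> q kl; have [[[ab ac ad] [ba bc bd]] [[ca cb cd] [da db dc]]] := quad_neq q.
rewrite /J -mulmxA (qt_E rsg cd kl) mulmxA -scalemxAr.
rewrite (qt_E rsg ab (tperm_neq c d kl)) -!scalemxAl scalerA -signr_addb.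
by rewrite mulmxA.
Qed.

(** [J a b c d], a quarter turn in both planes, commutes with [A a b c d] and
    anticommutes with the other two operators. *)
Lemma J_A a b c d : quad a b c d ->
  [/\ J a b c d *m A a b c d = A a b c d *m J a b c d,
      J a b c d *m A a c d b = - (A a c d b *m J a b c d)
    & J a b c d *m A a d b c = - (A a d b c *m J a b c d)].
Proof.
move=> q; have [[[ab ac ad] [ba bc bd]] [[ca cb cd] [da db dc]]] := quad_neq q.
have sc : tperm c d c = d by rewrite tpermL.
have sd : tperm c d d = c by rewrite tpermR.
have sa : tperm c d a = a by rewrite tpermD.
have sb : tperm c d b = b by rewrite tpermD.
have ta : tperm a b a = b by rewrite tpermL.
have tb : tperm a b b = a by rewrite tpermR.
have tc : tperm a b c = c by rewrite tpermD.
have td : tperm a b d = d by rewrite tpermD.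
have ee := (sa, sb, sc, sd, ta, tb, tc, td, @eqxx 'I_n, negPf ab, negPf ac, negPf ad,
  negPf bc, negPf bd, negPf cd, negPf ba, negPf ca, negPf da, negPf cb, negPf db,
  negPf dc).
have Eab : J a b c d *m E a b = E a b *m J a b c d.
  by rewrite (J_E_aux q ab) !ee /= expr1 (EC rsg ab) scaleN1r opprK.
have Ecd : J a b c d *m E c d = E c d *m J a b c d.
  by rewrite (J_E_aux q cd) !ee /= expr1 (EC rsg cd) scaleN1r opprK.
have Eac : J a b c d *m E a c = - (E d b *m J a b c d).
  by rewrite (J_E_aux q ac) !ee /= expr0 (EC rsg bd) scale1r mulNmx opprK.
have Edb : J a b c d *m E d b = - (E a c *m J a b c d).
  by rewrite (J_E_aux q db) !ee /= expr0 (EC rsg ac) scale1r mulNmx.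
have Ead : J a b c d *m E a d = - (E b c *m J a b c d).
  by rewrite (J_E_aux q ad) !ee /= expr1 scaleN1r mulNmx.
have Ebc : J a b c d *m E b c = - (E a d *m J a b c d).
  by rewrite (J_E_aux q bc) !ee /= expr1 scaleN1r mulNmx.
split; rewrite /A mulmxDr mulmxDl.
- by rewrite Eab Ecd.
- by rewrite Eac Edb opprD addrC.
- by rewrite Ead Ebc opprD addrC.
Qed.

(** [J a b c d] is the value at [pi / 2] of the circle generated by [A a b c d]. *)
Lemma A_fix a b c d w : quad a b c d -> A a b c d *m w = 0 -> J a b c d *m w = w.
Proof.
move=> q; have [[[ab ac ad] [ba bc bd]] [[ca cb cd] [da db dc]]] := quad_neq q.
rewrite /A !EE /J !qtE => Aw.
have oab := evec_orthonormal R ab; have ocd := evec_orthonormal R cd.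
pose S (t : R) := sg (crot a b t) *m sg (crot c d t).
have comm (s t : R) : sg (crot c d t) *m sg (crot a b s) = sg (crot a b s) *m sg (crot c d t).
  rewrite {2}/crot (sg_rot_conj rsg _ (crot_SO _ cd) oab).
  by rewrite !crot_other.
have S0 : S 0 = 1%:M by rewrite /S /crot !rot0 (sg1 rsg) mulmx1.
have SD (s t : R) : S (s + t) = S s *m S t.
  rewrite /S /crot (sg_rotD rsg oab) (sg_rotD rsg ocd) -!/(crot _ _ _).
  by rewrite !mulmxA -!(mulmxA (sg (crot a b s))) comm.
have dS : mx_derive S 0 (gen sg (evec a) (evec b) + gen sg (evec c) (evec d)).
  apply: mx_derive_eq (mx_deriveM (genP rsg oab) (genP rsg ocd)) _.
  by rewrite /crot !rot0 (sg1 rsg) mul1mx mulmx1 addrC.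
exact: (generator_fix S0 SD dS Aw (pi / 2)).
Qed.

Lemma J_swap a b c d w : quad a b c d -> inW w -> J a b d c *m w = J a b c d *m w.
Proof.
move=> q Ww; have [[[ab ac ad] [ba bc bd]] [[ca cb cd] [da db dc]]] := quad_neq q.
rewrite /J -!mulmxA; congr (_ *m _).
exact: (qtW_sym rsg).
Qed.

Lemma J_inW a b c d w : quad a b c d -> inW w -> inW (J a b c d *m w).
Proof.
move=> q Ww; have [[[ab ac ad] [ba bc bd]] [[ca cb cd] [da db dc]]] := quad_neq q.
by rewrite /J -mulmxA; do 2!apply: (inW_qt rsg) => //.
Qed.

Lemma J_conj s t a b c d w : quad a b c d -> s != t -> inW w ->
  qt s t *m (J a b c d *m w) =
  J (tperm s t a) (tperm s t b) (tperm s t c) (tperm s t d) *m (qt s t *m w).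
Proof.
move=> q st Ww; have [[[ab ac ad] [ba bc bd]] [[ca cb cd] [da db dc]]] := quad_neq q.
rewrite /J -!mulmxA.
rewrite (qtW_conj rsg st ab); last exact: inW_qt.
by rewrite (qtW_conj rsg st cd).
Qed.

(** On W the operators [J] are the double transpositions, which form a Klein
    four-group. *)
Lemma JJ a b c d w : quad a b c d -> inW w ->
  J a b c d *m (J a c d b *m w) = J a d b c *m w.
Proof.
move=> q Ww; have [[[ab ac ad] [ba bc bd]] [[ca cb cd] [da db dc]]] := quad_neq q.
rewrite /J -!mulmxA.
have Wq k l x : k != l -> inW x -> inW (qt k l *m x) by move=> *; exact: inW_qt.
rewrite (qtW_conj rsg cd ac); last exact: Wq.
rewrite tpermL tpermD// (qtW_conj rsg cd db Ww) tpermR tpermD//.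
(* the product is now (a b)(a d)(c b)(c d) = (a d)(b d)(b d)(b c) *)
have -> : qt c b *m (qt c d *m w) = qt b d *m (qt b c *m w).
  rewrite (qtW_sym rsg bc (Wq _ _ _ cd Ww)) (qtW_conj rsg bc cd Ww).
  by rewrite tpermR tpermD.
have e X : inW X -> qt a b *m (qt a d *m X) = qt a d *m (qt b d *m X).
  move=> WX; rewrite (qtW_conj rsg ad bd WX) tpermR tpermD//.
  by rewrite (qtW_sym rsg ab (Wq _ _ _ ad WX)).
have Wbc := Wq _ _ _ bc Ww.
by rewrite e ?(qtW_inv rsg bd)//; exact: Wq.
Qed.

Lemma JK a b c d w : quad a b c d -> inW w -> J a b c d *m (J a b c d *m w) = w.
Proof.
move=> q Ww; have [[[ab ac ad] [ba bc bd]] [[ca cb cd] [da db dc]]] := quad_neq q.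
have Wq k l x : k != l -> inW x -> inW (qt k l *m x) by move=> *; exact: inW_qt.
rewrite /J -!mulmxA.
have -> : qt c d *m (qt a b *m (qt c d *m w)) = qt a b *m w.
  rewrite (qtW_conj rsg cd ab (Wq _ _ _ cd Ww)) !tpermD//.
  by rewrite (qtW_inv rsg cd).
exact: (qtW_inv rsg ab).
Qed.

(** The three nontrivial characters of the Klein group generated by the
    [J]'s on [W]. *)
Definition klein_vec a b c d x : Prop :=
  [/\ inW x, x <> 0, J a b c d *m x = x, J a c d b *m x = - x
    & J a d b c *m x = - x].

Lemma klein_vec_conj a b c d x : quad a b c d -> klein_vec a b c d x ->
  klein_vec a c d b (qt b c *m x).
Proof.
move=> q [Wx x0 h1 h2 h3]; have [[[ab ac ad] [ba bc bd]] [[ca cb cd] [da db dc]]] := quad_neq q.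
have qr := quad_rot q; have qrr := quad_rot qr.
have Wy : inW (qt b c *m x) by exact: inW_qt.
have e1 : J a c d b *m (qt b c *m x) = qt b c *m x.
  rewrite -(J_swap qr Wy) -{2}h1 (J_conj q bc Wx).
  by rewrite tpermL tpermR !tpermD.
have e2 : J a b c d *m (qt b c *m x) = - (qt b c *m x).
  rewrite -(J_swap q Wy) -mulmxN -h2 (J_conj qr bc Wx).
  by rewrite tpermL tpermR !tpermD.
have e3 : J a d b c *m (qt b c *m x) = - (qt b c *m x).
  rewrite -(J_swap qrr Wy) -mulmxN -h3 (J_conj qrr bc Wx).
  by rewrite tpermL tpermR !tpermD.
split=> // h; apply: x0.
by rewrite -(qtW_inv rsg bc Wx) h mulmx0.
Qed.

(** One of the [J] acts nontrivially, so some nontrivial character of the Klein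
    group occurs in W; the quarter turns permute the three of them. *)
Lemma klein_vecs a b c d : quad a b c d ->
  (exists w, inW w /\ J a b c d *m w <> w) ->
  exists x1 x2 x3, [/\ klein_vec a b c d x1, klein_vec a c d b x2
    & klein_vec a d b c x3].
Proof.
move=> q [w [Ww nw]].
have qr := quad_rot q; have qrr := quad_rot qr.
suff [[x hx]|[x hx]] : (exists x, klein_vec a c d b x) \/
    (exists x, klein_vec a d b c x).
- have h3 := klein_vec_conj qr hx; have h1 := klein_vec_conj qrr h3.
  by do 3!eexists; split; [exact: h1 | exact: hx | exact: h3].
- have h1 := klein_vec_conj qrr hx; have h2 := klein_vec_conj q h1.
  by do 3!eexists; split; [exact: h1 | exact: h2 | exact: hx].
pose y := w - J a b c d *m w.
have Wy : inW y by apply: inWB => //; exact: J_inW.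
have y0 : y <> 0 by move=> /eqP; rewrite subr_eq0 eq_sym => /eqP.
have J1y : J a b c d *m y = - y by rewrite mulmxBr (JK q Ww) opprB.
clearbody y.
have J12 x : inW x -> J a b c d *m (J a c d b *m x) = J a c d b *m (J a b c d *m x).
  move=> Wx; rewrite (JJ q Wx).
  have W3 := J_inW qrr Wx.
  by rewrite -(JJ qr Wx) (JK qr W3).
have type_of (z : 'cV[R]_N) : inW z -> z <> 0 -> J a b c d *m z = - z ->
    J a c d b *m z = z \/ J a c d b *m z = - z ->
    klein_vec a c d b z \/ klein_vec a d b c z.
  move=> Wz z0 J1z [J2z|J2z]; [left|right]; split => //.
  - by rewrite -(JJ q Wz) J2z J1z.
  - by rewrite -(JJ q Wz) J2z mulmxN J1z opprK.
have W2y := J_inW qr Wy.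
have J12y : J a b c d *m (J a c d b *m y) = - (J a c d b *m y).
  by rewrite (J12 _ Wy) J1y mulmxN.
suff : klein_vec a c d b (y + J a c d b *m y) \/ klein_vec a d b c (y + J a c d b *m y)
    \/ (klein_vec a c d b y \/ klein_vec a d b c y).
  by move=> [h|[h|[h|h]]]; [left|right|left|right]; eexists; exact: h.
have [e|/eqP ne] := eqVneq (y + J a c d b *m y) 0.
  right; right; apply: (type_of y Wy y0 J1y); right.
  by apply/eqP; rewrite -addr_eq0 addrC e.
have J1z : J a b c d *m (y + J a c d b *m y) = - (y + J a c d b *m y).
  by rewrite mulmxDr J1y J12y opprD.
have J2z : J a c d b *m (y + J a c d b *m y) = y + J a c d b *m y.
  by rewrite mulmxDr (JK qr Wy) addrC.
have [h|h] := type_of _ (inWD Wy W2y) ne J1z (or_introl J2z); first by left.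
by right; left.
Qed.

Lemma in_pair_compl a b c d k : quad a b c d ->
  in_pair c d k = ~~ in_pair a b k.
Proof.
move=> q; have [[[ab ac ad] [ba bc bd]] [[ca cb cd] [da db dc]]] := quad_neq q.
by rewrite /in_pair; case/or4P: (quad_cover k q) => /eqP ->;
  rewrite !eqxx ?orbT ?(negPf ac, negPf ad, negPf bc, negPf bd, negPf ca, negPf da,
    negPf cb, negPf db).
Qed.

Lemma in_pair_sum a b c d k : quad a b c d ->
  in_pair a c k = ~~ (in_pair a b k (+) in_pair a d k).
Proof.
move=> q; have [[[ab ac ad] [ba bc bd]] [[ca cb cd] [da db dc]]] := quad_neq q.
by rewrite /in_pair; case/or4P: (quad_cover k q) => /eqP ->;
  rewrite ?eqxx ?(negPf ba, negPf bc, negPf bd, negPf ca, negPf da, negPf cb,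
    negPf cd, negPf db, negPf dc).
Qed.

(** A pair and its complement define the same character, so for n = 4 there are
    only three eigenspaces [Uv] besides [Wv]. *)
Lemma pair_chi_swap a b c d : quad a b c d ->
  @pair_chi R n c d = @pair_chi R n a b.
Proof.
move=> q; apply/funext => -[k l]; rewrite /pair_chi /= !(in_pair_compl _ q).
by rewrite addbN addNb negbK.
Qed.

Lemma Uv_swap a b c d : quad a b c d -> Uv c d = Uv a b.
Proof. by move=> q; exact: (congr1 (eig sg) (pair_chi_swap q)). Qed.

Lemma A_Uv a b c d w : quad a b c d -> inW w -> A a b c d *m w \in Uv a b.
Proof.
move=> q Ww; have [[[ab ac ad] [ba bc bd]] [[ca cb cd] [da db dc]]] := quad_neq q.
rewrite /A mulmxDl; apply: memvD; first exact: E_Uv.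
by rewrite -(Uv_swap q); exact: E_Uv.
Qed.

Lemma pair_chiM a b c d kl : quad a b c d ->
  @pair_chi R n a b kl * @pair_chi R n a d kl = @pair_chi R n a c kl.
Proof.
move=> q; rewrite /pair_chi -signr_addb !(in_pair_sum _ q).
by rewrite addbN addNb negbK addbACA.
Qed.

Lemma E_Uv_step a b c d u : quad a b c d -> u \in Uv a b ->
  E a d *m u \in Uv a c /\ E b c *m u \in Uv a c.
Proof.
move=> q /eigP Uu; have [[[ab ac ad] [ba bc bd]] [[ca cb cd] [da db dc]]] := quad_neq q.
split; apply/eigP => k l kl; rewrite (ht_E_chi rsg)// Uu// -scalemxAr scalerA.
  by rewrite mulrC (pair_chiM _ q).
by rewrite (pair_chi_swap (quad_rot (quad_rot q))) mulrC (pair_chiM _ q).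
Qed.

Section Dimensions.
Hypothesis N9 : (N <= 9)%N.
Variables (a b c d : 'I_n) (x1 x2 x3 : 'cV[R]_N).
Hypothesis q : quad a b c d.
Hypothesis k1 : klein_vec a b c d x1.
Hypothesis k2 : klein_vec a c d b x2.
Hypothesis k3 : klein_vec a d b c x3.
Hypothesis dU2 : (2 <= \dim (Uv a b))%N.

Local Notation J1 := (J a b c d).
Local Notation J2 := (J a c d b).
Local Notation J3 := (J a d b c).

(** The three characters of the pairs containing [a] are distinct. *)
Lemma sum_dim_four : (\dim Wv + 3 * \dim (Uv a b) <= 9)%N.
Proof.
have [[[ab ac ad] _] _] := quad_neq q.
have n3 : (3 <= n)%N by rewrite n4.
pose P (x : 'I_n * 'I_n) := (x.1 == a) && (x.2 != a).
have Pne (x : 'I_n * 'I_n) : P x -> x.1 != x.2.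
  by move=> /andP[/eqP ->]; rewrite eq_sym.
have Psep (x y : 'I_n * 'I_n) : P x -> P y -> x != y ->
    exists kl, @pair_chi R n x.1 x.2 kl != @pair_chi R n y.1 y.2 kl.
  case: x y => [i j] [i' j'] /andP[/= /eqP -> ja] /andP[/= /eqP -> ja'].
  rewrite xpair_eqE eqxx /= => jj; exists (j, a); apply: pair_chi_neq => //.
    by rewrite /in_pair eqxx orbT (negPf ja) (negPf jj).
  by rewrite /in_pair eqxx.
apply: leq_trans N9; apply: leq_trans (@dim_W_Uv R n N sg n3 P Pne Psep).
rewrite leq_add2l.
have -> : (3 * \dim (Uv a b))%N = (\sum_(x | P x) \dim (Uv a b))%N.
  rewrite sum_nat_const; congr (_ * _)%N.
  rewrite -sum1_card -(pair_big (pred1 a) (predC1 a) (fun _ _ => 1%N)) /=.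
  rewrite big_pred1_eq sum1_card cardC1 card_ord.
  by have := n4; case: (n) => // m [->].
apply: leq_sum => x Px; apply: (dim_Uv rsg) => //; exact: Pne.
Qed.

(** W contains the three nontrivial characters of the Klein group; by
    [sum_dim_four] it has dimension exactly 3 when the [Uv] have dimension 2. *)
Lemma W_span : (3 <= \dim Wv)%N /\ ((\dim Wv <= 3)%N -> forall w, inW w ->
  exists c1 c2 c3 : R, w = c1 *: x1 + c2 *: x2 + c3 *: x3).
Proof.
have [W1 n1 h11 h12 h13] := k1.
have [W2 n2 h22 h23 h21] := k2.
have [W3 n3 h33 h31 h32] := k3.
pose x (m : 'I_3) := nth x1 [:: x1; x2; x3] m.
pose op (m : 'I_3) := nth J1 [:: J1; J2; J3] m.
pose chi (m m' : 'I_3) : R := if m == m' then 1 else -1.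
have [| | | |h1 h2] := @joint_eigen_span R N 'I_3 'I_3 0 op chi Wv x.
- by apply: three_cases; apply/WvP.
- by apply: three_cases; apply/eqP.
- apply: three_cases; apply: three_cases; rewrite /chi /= ?scale1r ?scaleN1r //.
- by move=> m m' mm; exists m; rewrite /chi eqxx eq_sym [m' == m]eq_sym (negPf mm) eq_sym neq1N1.
rewrite card_ord in h1 h2; split=> // d3 w /WvP Ww.
have [cc ->] := h2 d3 w Ww; rewrite !big_ord_recl big_ord0 addr0 addrA.
by exists (cc 0), (cc (lift 0 0)), (cc (lift 0 (lift 0 0))).
Qed.

(** [A a b c d] maps [x2] and [x3] to eigenvectors of [J1] for [-1] in [Uv a b],
    which are independent as [J2] separates them, so they span it. *)
Lemma U_eigen u : u \in Uv a b -> J1 *m u = - u.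
Proof.
have [h3 _] := W_span; have h9 := sum_dim_four.
have dU : (\dim (Uv a b) <= 2)%N by lia.
have [W2 n2 h22 h23 h21] := k2.
have [W3 n3 h33 h31 h32] := k3.
have [JA1 _ _] := J_A q.
have [_ _ JA2] := J_A (quad_rot q).
have no_fix (x : 'cV[R]_N) : x <> 0 -> J1 *m x = - x -> A a b c d *m x != 0.
  move=> x0 Jx; apply/eqP => /(A_fix q); rewrite Jx => /matrixP e.
  by apply: x0; apply/matrixP => i j; have := e i j; rewrite !mxE; lra.
pose y (m : bool) := A a b c d *m (if m then x2 else x3).
have J1y m : J1 *m y m = - y m.
  by rewrite mulmxA JA1 -mulmxA; case: m; rewrite ?h21 ?h31 mulmxN.
have J2y m : J2 *m y m = (if m then -1 else 1) *: y m.
  rewrite mulmxA JA2 mulNmx -mulmxA; case: m; rewrite /y ?h22 ?h32.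
    by rewrite scaleN1r.
  by rewrite mulmxN opprK scale1r.
have [| | | |_ h] := @joint_eigen_span R N bool unit tt (fun=> J2)
    (fun m _ => if m then -1 else 1) (Uv a b) y.
- by case; apply: A_Uv.
- by case; apply: no_fix.
- by move=> m _; exact: J2y.
- by case; case=> // _; exists tt; rewrite ?neq1N1 // eq_sym neq1N1.
rewrite card_bool in h => Uu; have [cc ->] := h dU u Uu.
rewrite mulmx_sumr -sumrN; apply: eq_bigr => m _.
by rewrite -scalemxAr J1y scalerN.
Qed.

End Dimensions.

Lemma eq_opp0 u : u = - u -> u = 0.
Proof.
by move=> /matrixP e; apply/matrixP => i j; have := e i j; rewrite !mxE; lra.
Qed.

Section Square.
Hypothesis N9 : (N <= 9)%N.
Variables (a b c d : 'I_n) (x1 x2 x3 : 'cV[R]_N).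
Hypothesis q : quad a b c d.
Hypothesis k1 : klein_vec a b c d x1.
Hypothesis k2 : klein_vec a c d b x2.
Hypothesis k3 : klein_vec a d b c x3.
Hypothesis dU2 : forall i j, i != j -> (2 <= \dim (Uv i j))%N.

Local Notation A1 := (A a b c d).

(** The image of [x1] lies in [Uv a b], where [J1] is [-1] by [U_eigen], while
    [J1] commutes with [A1] and fixes [x1]. *)
Lemma A_kill : A1 *m x1 = 0.
Proof.
have [[[ab ac ad] _] _] := quad_neq q.
have [W1 n1 h11 h12 h13] := k1; have [JA1 _ _] := J_A q.
apply: eq_opp0; rewrite -(U_eigen N9 q k1 k2 k3 (dU2 ab)); last exact: A_Uv.
by rewrite mulmxA JA1 -mulmxA h11.
Qed.

End Square.

(** The bracket relations express [A3 (A1 (A1 x2))] by [A3 x2]: the vector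
    [A1 (A1 x2) + 4 x2] is killed by [A3], hence fixed by [J3], which
    sends it to its opposite. *)
Lemma A_square a b c d x1 x2 x3 : (N <= 9)%N ->
  (forall i j, i != j -> (2 <= \dim (Uv i j))%N) -> quad a b c d ->
  klein_vec a b c d x1 -> klein_vec a c d b x2 -> klein_vec a d b c x3 ->
  A a b c d *m (A a b c d *m x2) = (-4) *: x2 /\
  A a b c d *m (A a b c d *m x3) = (-4) *: x3.
Proof.
move=> N9 dU2 q k1 k2 k3; have qr := quad_rot q; have qrr := quad_rot qr.
have [[[ab ac ad] [ba bc bd]] [[ca cb cd] [da db dc]]] := quad_neq q.
have [W2 n2 h22 h23 h21] := k2.
have [W3 n3 h33 h31 h32] := k3.
have A22 := A_kill N9 qr k2 k3 k1 dU2.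
have A33 := A_kill N9 qrr k3 k1 k2 dU2.
have [_ J12 J13] := J_A q; have [_ J23 J21] := J_A qr; have [_ J31 J32] := J_A qrr.
have UA x : inW x -> A a b c d *m x \in Uv a b by move=> Wx; exact: A_Uv.
have anti2 (M X Y : 'M[R]_N) x : M *m X = - (X *m M) -> M *m Y = - (Y *m M) ->
    M *m (X *m (Y *m x)) = X *m (Y *m (M *m x)).
  by move=> e1 e2; rewrite mulmxA e1 mulNmx -mulmxA (mulmxA M) e2 mulNmx mulmxN
    opprK -mulmxA.
have A3A1 : A a d b c *m (A a b c d *m x2) = 0.
  apply: eq_opp0; rewrite -(U_eigen N9 qr k2 k3 k1 (dU2 _ _ ac)); last first.
    rewrite /A mulmxDl; have [h h'] := E_Uv_step q (UA _ W2).
    exact: memvD.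
  by rewrite (anti2 _ _ _ _ J23 J21) h22.
have A2A1 : A a c d b *m (A a b c d *m x3) = 0.
  apply: eq_opp0; rewrite -(U_eigen N9 qrr k3 k1 k2 (dU2 _ _ ad)); last first.
    rewrite {1}/A mulmxDl; have [h h'] := E_Uv_step (quad_swap q) (UA _ W3).
    by apply: memvD => //; rewrite (EC rsg bd) mulNmx memvN.
  by rewrite (anti2 _ _ _ _ J32 J31) h33.
have lin0 (M : 'M[R]_N) (r : R) x : M *m (A a b c d *m (A a b c d *m x) + r *: x) =
    M *m (A a b c d *m (A a b c d *m x)) + r *: (M *m x).
  by rewrite mulmxDr -scalemxAr.
split.
  apply/eqP; rewrite -subr_eq0 -scaleNr opprK; apply/eqP; apply: eq_opp0.
  have AZ : A a d b c *m (A a b c d *m (A a b c d *m x2) + 4 *: x2) = 0.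
    have b1 := A_bracket x2 q; rewrite A22 mulmx0 sub0r in b1.
    have b2 := A_bracket (A a b c d *m x2) qrr; rewrite A3A1 mulmx0 subr0 in b2.
    rewrite lin0 b2; apply/matrixP => i j; move/matrixP/(_ i j): b1.
    by rewrite !mxE; lra.
  by rewrite -{1}(A_fix qrr AZ) lin0 (anti2 _ _ _ _ J31 J31) h23 !mulmxN scalerN
    -opprD.
apply/eqP; rewrite -subr_eq0 -scaleNr opprK; apply/eqP; apply: eq_opp0.
have AZ : A a c d b *m (A a b c d *m (A a b c d *m x3) + 4 *: x3) = 0.
  have b1 := A_bracket x3 qrr; rewrite A33 mulmx0 subr0 in b1.
  have b2 := A_bracket (A a b c d *m x3) q; rewrite A2A1 mulmx0 sub0r in b2.
  rewrite lin0; apply/matrixP => i j; move/matrixP/(_ i j): b1.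
  by move/matrixP/(_ i j): b2; rewrite !mxE; lra.
by rewrite -{1}(A_fix qr AZ) lin0 (anti2 _ _ _ _ J21 J21) h32 !mulmxN scalerN
  -opprD.
Qed.

Lemma klein_vec_swap a b c d x : quad a b c d -> klein_vec a b c d x ->
  klein_vec a b d c x.
Proof.
move=> q [Wx x0 h1 h2 h3]; have qr := quad_rot q; have qrr := quad_rot qr.
by split => //; rewrite (J_swap _ Wx).
Qed.

(** If the [Uv i j] have dimension at least 2, then W and the [Uv i j] fill V,
    and both factors of so(4) have the same squares on W by [A_square]. This
    makes [E c d] kill the image of W under [E a b]; were that image
    two-dimensional, it would be all of [Uv a b = Uv c d], the image of W under
    [E c d] would be killed by [E c d], and [E c d] would vanish on W. *)
Lemma rank_one_four (v : 'cV[R]_N) (i0 p : 'I_n) : (N <= 9)%N -> i0 != p ->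
  inW v ->
  (forall k l, k != l -> k != i0 -> k != p -> l != i0 -> l != p ->
     qt i0 p *m (qt k l *m v) <> v) ->
  (forall i j, i != j -> exists w, inW w /\ qt i j *m w <> w) ->
  forall i j, i != j -> rank_one sg i j.
Proof.
move=> N9 i0p vW nv nontriv a b ab.
have [c [d q]] := quad_exists ab.
have [dU1|dU2] := leqP (\dim (Uv a b)) 1; first exact: (rank_one_dim rsg).
have {}dU2 i j : i != j -> (2 <= \dim (Uv i j))%N.
  by move=> ij; apply: leq_trans dU2 _; exact: (dim_Uv rsg).
have Jnt : exists w, inW w /\ J a b c d *m w <> w.
  pose Q k l := forall s t, quad k l s t -> exists w, inW w /\ J k l s t *m w <> w.
  suff : Q a b by apply.
  apply: (@pair_transport n Q i0 p) => //; last first.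
    move=> s t /quad_neq[_ [[h1 h2 st] [h3 h4 _]]]; exists v; split=> //.
    by rewrite /J -mulmxA; exact: nv.
  move=> k l s t kl st h s' t' q'.
  have q'' : quad k l (tperm s t s') (tperm s t t').
    by move: q'; rewrite -[s'](tpermK s t) -[t'](tpermK s t) /quad !(inj_eq perm_inj) !tpermK.
  have [w [Ww nw]] := h _ _ q''.
  exists (qt s t *m w); split; first exact: inW_qt.
  have := J_conj q'' st Ww; rewrite !tpermK => <- e; apply: nw.
  by rewrite -(qtW_inv rsg st (J_inW q'' Ww)) e (qtW_inv rsg st Ww).
have [x1 [x2 [x3 [k1 k2 k3]]]] := klein_vecs q Jnt.
have [[[_ ac ad] [_ bc bd]] [[_ _ cd] _]] := quad_neq q.
have h9 := sum_dim_four N9 q; have d2 := dU2 _ _ ab.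
have [d3 span_W] := W_span k1 k2 k3.
have {}span_W := span_W ltac:(lia).
have q' := quad_swap q.
have k1' := klein_vec_swap q k1.
have k2' := klein_vec_swap (quad_rot q) k2.
have k3' := klein_vec_swap (quad_rot (quad_rot q)) k3.
have [s2 s3] := A_square N9 dU2 q k1 k2 k3.
have [t3 t2] := A_square N9 dU2 q' k1' k3' k2'.
have s1 := A_kill N9 q k1 k2 k3 dU2.
have t1 := A_kill N9 q' k1' k3' k2' dU2.
(* 4 E_ab E_cd is the difference of the squares of the two operators A *)
have EEx x : A a b c d *m (A a b c d *m x) = A a b d c *m (A a b d c *m x) ->
    E c d *m (E a b *m x) = 0.
  have e := congr1 (mulmx^~ x) (E_comm rsg ab cd ac ad bc bd).
  rewrite /= -!mulmxA in e.
  rewrite /A (EC rsg cd) !mulmxDl !mulmxDr !mulNmx !mulmxN opprK e.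
  move=> /matrixP h; apply/matrixP => i j; have := h i j.
  by rewrite !mxE; lra.
have EE0 w : inW w -> E c d *m (E a b *m w) = 0.
  move=> Ww; have [c1 [c2 [c3 ->]]] := span_W _ Ww.
  rewrite !mulmxDr -!scalemxAr !EEx ?scaler0 ?addr0 //.
  - by rewrite s3 t3.
  - by rewrite s2 t2.
  - by rewrite s1 t1 !mulmx0.
have [w0 [Ww0 nw0]] := nontriv _ _ cd.
case: (pselect (exists w1, inW w1 /\ E a b *m w1 <> 0)) => [[w1 [Ww1 n1]]|no].
  exists (E a b *m w1) => w Ww.
  have [/vlineP //|out] := boolP (E a b *m w \in <[E a b *m w1]>%VS).
  case: nw0; rewrite qtE; apply: (E_fix rsg cd); apply: (E_semisimple rsg cd).
  have UE : Uv a b = <<[:: E a b *m w; E a b *m w1]>>%VS.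
    apply/eqP; rewrite eq_sym eqEdim; apply/andP; split.
      apply/span_subvP => u; rewrite !inE.
      by case/orP => /eqP ->; exact: E_Uv.
    have /eqP -> : \dim <<[:: E a b *m w; E a b *m w1]>> == 2%N; last by lia.
    have : free [:: E a b *m w; E a b *m w1].
      rewrite free_cons span_seq1 out seq1_free; exact/eqP.
    by rewrite /free.
  have : E c d *m w0 \in Uv a b by rewrite -(Uv_swap q); exact: E_Uv.
  rewrite UE span_cons span_seq1 => /memv_addP[_ /vlineP[r1 ->] [_ /vlineP[r2 ->] ->]].
  by rewrite mulmxDr -!scalemxAr !EE0// !scaler0 addr0.
exists 0 => w Ww; exists 0; rewrite scaler0; apply: contrapT => nz.
by apply: no; exists w.
Qed.

End Four.

(** * Coordinate rotations generate SO_n *)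

Lemma polar_angle (R : realType) (p q : R) :
  exists t, cos t * p + sin t * q = Num.sqrt (p ^+ 2 + q ^+ 2) /\
            cos t * q - sin t * p = 0.
Proof.
set r := Num.sqrt _.
have r2 : r ^+ 2 = p ^+ 2 + q ^+ 2 by rewrite sqr_sqrtr// addr_ge0// sqr_ge0.
have [r0|rn] := eqVneq r 0.
  exists 0; rewrite cos0 sin0 r0; have : p ^+ 2 + q ^+ 2 = 0 by rewrite -r2 r0 expr0n.
  have := sqr_ge0 p; have := sqr_ge0 q => h1 h2 h3.
  have /eqP : p ^+ 2 = 0 by lra.
  have /eqP : q ^+ 2 = 0 by lra.
  by rewrite !sqrf_eq0 => /eqP -> /eqP ->; rewrite !mulr0 subr0 addr0.
have [t [ct st]] : exists t, cos t = p / r /\ sin t = q / r.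
  have hpr : (p / r) ^+ 2 + (q / r) ^+ 2 = 1.
    by rewrite !expr_div_n -mulrDl -r2 divff// expf_neq0.
  have h : -1 <= p / r <= 1.
    by apply/andP; split; have := sqr_ge0 (q / r); nra.
  have sE : sin (acos (p / r)) = `|q / r|.
    by rewrite sin_acos// -hpr addrAC subrr add0r sqrtr_sqr.
  have [qr|qr] := leP 0 (q / r).
    by exists (acos (p / r)); rewrite acosK// sE ger0_norm.
  exists (- acos (p / r)); rewrite cosN sinN acosK// sE ltr0_norm//.
  by rewrite opprK.
exists t; rewrite ct st; split; last by field.
transitivity ((p ^+ 2 + q ^+ 2) / r); first by field.
by rewrite -r2 expr2 mulfK.
Qed.

Section Givens.
Variables (R : realType) (n : nat).
Implicit Types (A : 'M[R]_n) (i j k l m : 'I_n).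
Local Notation SO := (@special_orthogonal_group R n).

Lemma row_crot A k l t i j : (crot k l (- t) *m A) i j =
  \sum_m (crot k l t *m evec i : 'cV[R]_n) m 0 * A m j.
Proof.
rewrite /crot -tr_rot mxE; apply: eq_bigr => m _; congr (_ * _).
by move: (rot _ _ t) => M; rewrite mxE /evec -colE mxE.
Qed.

Lemma row_crot_k A k l t j : k != l ->
  (crot k l (- t) *m A) k j = cos t * A k j + sin t * A l j.
Proof.
move=> kl; rewrite row_crot /crot (rot_mulx (evec_orthonormal R kl)).
have lk : l != k by rewrite eq_sym.
rewrite (bigD1 k)//= (bigD1 l lk)/= big1 => [|m /andP[mk ml]].
  by rewrite !mxE !eqxx /= (negPf kl) [l == k]eq_sym (negPf kl) /=; ring.
by rewrite !mxE (negPf mk) (negPf ml) /=; ring.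
Qed.

Lemma row_crot_l A k l t j : k != l ->
  (crot k l (- t) *m A) l j = cos t * A l j - sin t * A k j.
Proof.
move=> kl; rewrite row_crot /crot (rot_muly (evec_orthonormal R kl)).
have lk : l != k by rewrite eq_sym.
rewrite (bigD1 k)//= (bigD1 l lk)/= big1 => [|m /andP[mk ml]].
  by rewrite !mxE !eqxx /= (negPf kl) [l == k]eq_sym (negPf kl) /=; ring.
by rewrite !mxE (negPf mk) (negPf ml) /=; ring.
Qed.

Lemma row_crot_other A k l t i j : i != k -> i != l ->
  (crot k l (- t) *m A) i j = A i j.
Proof.
move=> ik il; rewrite row_crot crot_other// (bigD1 i)//= big1 => [|m mi].
  by rewrite !mxE !eqxx /= mul1r addr0.
by rewrite !mxE (negPf mi) /= mul0r.
Qed.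

Definition first_columns_id (k : nat) A := forall i j, (j < k)%N -> A i j = (i == j)%:R.

(** [SO_n] is generated by the coordinate rotations: Givens elimination
    brings the columns to the standard basis one by one.  The inner induction
    clears column [k] below the diagonal and keeps the diagonal entry
    nonnegative, which makes it 1; for the last column the determinant
    does. *)
Lemma SO_crot_ind (Q : 'M[R]_n -> Prop) : Q 1%:M ->
  (forall k l t A, k != l -> SO A -> Q (crot k l t *m A) -> Q A) ->
  forall A, SO A -> Q A.
Proof.
move=> Q1 Qstep.
suff main (d k : nat) : (d + k = n)%N -> forall A, SO A -> first_columns_id k A -> Q A.
  by move=> A hA; apply: (main n 0%N (addn0 n) A hA) => i j; rewrite ltn0.
elim: d k => [|d IH] k dk A hA fA.
  rewrite (_ : A = 1%:M)//; apply/matrixP => i j; rewrite mxE fA//.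
  by rewrite -[k]add0n dk.
have kn : (k < n)%N by rewrite -dk addSn ltnS leq_addl.
pose kk := Ordinal kn.
suff inner (e l : nat) : (e + l = n)%N -> (k < l)%N -> forall A, SO A -> first_columns_id k A ->
    (forall i, (k < i < l)%N -> A i kk = 0) -> l = k.+1 \/ 0 <= A kk kk -> Q A.
  apply: (inner d k.+1) => //; first by rewrite addnS -addSn.
    by move=> i /andP[h1 h2]; move: (leq_trans h1 h2); rewrite ltnn.
  by left.
elim: e l => [|e IHe] l el kl {hA fA}A hA fA zA sA; last first.
  have ln : (l < n)%N by rewrite -el addSn ltnS leq_addl.
  pose ll := Ordinal ln; have kkll : kk != ll by rewrite -val_eqE /= neq_ltn kl.
  have [t [t1 t2]] := polar_angle (A kk kk) (A ll kk).
  apply: (Qstep kk ll (- t)) => //; apply: (IHe l.+1).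
  - by rewrite addnS -addSn.
  - exact: ltnW.
  - by apply: special_orthogonalM => //; exact: crot_SO.
  - move=> i j jk; have nj m : (k <= m)%N -> (A m j = 0 /\ (m == j) = false).
      move=> km; have mj : (m == j) = false.
        by apply/negbTE; rewrite -val_eqE /= neq_ltn (leq_trans jk km) orbT.
      by rewrite fA// mj.
    have [k0 kj] := nj kk (leqnn _); have [l0 lj] := nj ll (ltnW kl).
    have [->|ik] := eqVneq i kk; first by rewrite row_crot_k// k0 l0 kj !mulr0 addr0.
    have [->|il] := eqVneq i ll; first by rewrite row_crot_l// k0 l0 lj !mulr0 subr0.
    by rewrite row_crot_other// fA.
  - move=> i /andP[ki il]; have ik : i != kk by rewrite -val_eqE /= neq_ltn ki orbT.
    have [->|nil] := eqVneq i ll; first by rewrite row_crot_l.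
    rewrite row_crot_other// zA// ki /= ltn_neqAle -ltnS il andbT.
    by move: nil; rewrite -val_eqE.
  - by right; rewrite row_crot_k// t1 sqrtr_ge0.
(* only the diagonal entry of column k is left, and it is 1 *)
rewrite add0n in el.
have hAA : A^T *m A = 1%:M by apply: mulmx1C; case: hA.
have z i : i != kk -> A i kk = 0.
  move=> ik; have [ki|ki] := ltnP k i.
    by apply: zA; rewrite ki el ltn_ord.
  have {}ki : (i < k)%N by rewrite ltn_neqAle ki andbT -(val_eqE i kk) in ik *.
  move/matrixP/(_ i kk): hAA; rewrite !mxE (negPf ik) (bigD1 i)//= big1.
    by rewrite mxE fA// eqxx mul1r addr0.
  by move=> m mi; rewrite mxE fA// (negPf mi) mul0r.
have sq : A kk kk ^+ 2 = 1.
  move/matrixP/(_ kk kk): hAA; rewrite !mxE eqxx (bigD1 kk)//= big1.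
    by rewrite mxE addr0 expr2.
  by move=> m mk; rewrite mxE z// mul0r.
have Akk : A kk kk = 1.
  have : (A kk kk == 1) || (A kk kk == -1) by rewrite -sqrf_eq1 sq.
  case/orP => /eqP // An; case: sA => [lk|]; last by rewrite An; lra.
  have [_] := hA; suff -> : \det A = A kk kk by [].
  have -> : A = diag_mx (\row_j (if j == kk then A kk kk else 1)).
    apply/matrixP => i j; rewrite !mxE.
    have [->|jk] := eqVneq j kk.
      by have [->|ik] := eqVneq i kk; rewrite ?mulr1n// z// mulr0n.
    rewrite fA//; last first.
      rewrite ltn_neqAle -(val_eqE j kk) in jk *.
      by rewrite jk -ltnS -lk el ltn_ord.
    have [->|ij] := eqVneq i j; first by rewrite (negPf jk).
    by rewrite mulr0n.
  rewrite det_diag (bigD1 kk)//= big1; first by rewrite !mxE eqxx mulr1 mulr1n.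
  by move=> m /negPf mk; rewrite !mxE mk.
apply: (IH k.+1) => //; first by rewrite addnS -addSn.
move=> i j; rewrite ltnS leq_eqVlt => /orP[jk|]; last exact: fA.
have -> : j = kk by apply: val_inj; exact/eqP.
by have [->|ik] := eqVneq i kk; rewrite ?Akk ?z.
Qed.

End Givens.

(** * The equivariant map from the isospectral model *)

Lemma mx_derive_sum (R : realType) (a b : nat) (I : finType)
    (F : I -> R -> 'M[R]_(a, b)) (t : R) (D : I -> 'M[R]_(a, b)) :
  (forall x, mx_derive (F x) t (D x)) ->
  mx_derive (fun s => \sum_x F x s) t (\sum_x D x).
Proof.
move=> dF; elim: (index_enum I) => [|x s IH].
  rewrite big_nil; apply: mx_derive_ext (mx_derive_cst 0 t) => s.
  by rewrite big_nil.
rewrite big_cons; apply: mx_derive_ext (mx_deriveD (dF x) IH) => y.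
by rewrite big_cons.
Qed.

Section Intertwiner.
Variables (R : realType) (n N : nat) (sg : 'M[R]_n -> 'M[R]_N).
Hypothesis rsg : is_matrix_rep sg.
Local Notation SO := (@special_orthogonal_group R n).
Local Notation E := (E sg).
Variable om : 'I_n -> 'I_n -> 'cV[R]_N.
Hypothesis som : sym_system sg om.
Implicit Types (T A : 'M[R]_n) (i j k l : 'I_n).

Definition model_map T : 'cV[R]_N := \sum_(ij : 'I_n * 'I_n) T ij.1 ij.2 *: om ij.1 ij.2.

Local Notation Phi := model_map.

Lemma model_mapE T : Phi T = \sum_i \sum_j T i j *: om i j.
Proof. by rewrite /model_map pair_big. Qed.

Lemma model_map_linear : linear Phi.
Proof.
move=> r S T; rewrite /model_map scaler_sumr -big_split /=; apply: eq_bigr => ij _.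
by rewrite !mxE scalerDl scalerA.
Qed.

Lemma model_map_derive (F : R -> 'M[R]_n) t D :
  mx_derive F t D -> mx_derive (fun s => Phi (F s)) t (Phi D).
Proof. by move=> dF; apply: mx_derive_sum => ij; apply: mx_deriveZ; exact: dF. Qed.

Definition skew k l : 'M[R]_n :=
  evec l *m (evec k)^T - evec k *m (evec l)^T.

Lemma rot_derive0 (x y : 'cV[R]_n) :
  mx_derive (rot x y) 0 (y *m x^T - x *m y^T).
Proof.
have d1 : is_derive (0 : R) (1 : R) (fun t => cos t - 1) 0.
  apply: is_derive_eq (is_deriveB (is_derive_cos 0) (is_derive_cst (1 : R) (0 : R) (1 : R))) _.
  by rewrite sin0 oppr0 addr0.
have d2 : is_derive (0 : R) (1 : R) sin 1.
  by apply: is_derive_eq (is_derive_sin 0) _; rewrite cos0.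
apply: mx_derive_eq (mx_deriveD (mx_deriveD (mx_derive_cst 1%:M 0)
  (mx_deriveZ (x *m x^T + y *m y^T) d1)) (mx_deriveZ (y *m x^T - x *m y^T) d2)) _.
by rewrite add0r scale0r add0r scale1r.
Qed.

Lemma crot_derive k l t : k != l -> mx_derive (crot k l) t (skew k l *m crot k l t).
Proof.
move=> kl; apply: one_parameter_derive.
- by move=> s u; apply: rotD; exact: evec_orthonormal.
- exact: rot_derive0.
Qed.

Lemma skewE k l i j : k != l ->
  skew k l i j = (i == l)%:R * (j == k)%:R - (i == k)%:R * (j == l)%:R.
Proof. by move=> kl; rewrite !mxE !big_ord1 !mxE !andbT. Qed.

(** Infinitesimal equivariance: on [om i j = e_i e_j^T + e_j e_i^T] the
    generator acts by [T |-> X T + T X^T]. *)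
Lemma E_model_map k l T : k != l ->
  E k l *m Phi T = Phi (skew k l *m T + T *m (skew k l)^T).
Proof.
move=> kl; have [_ _ hE] := som; have lk : l != k by rewrite eq_sym.
have sum1 (f : 'I_n -> 'cV[R]_N) m : \sum_i (i == m)%:R *: f i = f m.
  rewrite (bigD1 m)//= eqxx scale1r big1 ?addr0// => i /negPf ->.
  by rewrite scale0r.
have lhs : E k l *m Phi T = \sum_j (T k j *: om l j - T l j *: om k j)
    + \sum_i (T i k *: om i l - T i l *: om i k).
  rewrite model_mapE mulmx_sumr.
  transitivity (\sum_i \sum_j ((i == k)%:R *: (T i j *: om l j)
      - (i == l)%:R *: (T i j *: om k j))
    + \sum_i \sum_j ((j == k)%:R *: (T i j *: om i l)
      - (j == l)%:R *: (T i j *: om i k))).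
    rewrite -big_split /=; apply: eq_bigr => i _; rewrite mulmx_sumr -big_split /=.
    apply: eq_bigr => j _; rewrite -scalemxAr hE// ![k == _]eq_sym ![l == _]eq_sym.
    by apply/matrixP => x y; rewrite !mxE; ring.
  congr (_ + _).
    rewrite exchange_big /=; apply: eq_bigr => j _.
    by rewrite sumrB !(sum1 (fun i => T i j *: _)).
  by apply: eq_bigr => i _; rewrite sumrB !(sum1 (fun j => T i j *: _)).
rewrite lhs model_mapE.
have skT i j : (skew k l *m T) i j = (i == l)%:R * T k j - (i == k)%:R * T l j.
  rewrite mxE (bigD1 k)//= (bigD1 l lk)/= big1 => [|m /andP[mk ml]].
    by rewrite !skewE// !eqxx [l == k]eq_sym (negPf kl) /=; ring.
  by rewrite skewE// (negPf mk) (negPf ml) /=; ring.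
have Tsk i j : (T *m (skew k l)^T) i j = (j == l)%:R * T i k - (j == k)%:R * T i l.
  rewrite mxE (bigD1 k)//= (bigD1 l lk)/= big1 => [|m /andP[mk ml]].
    by rewrite ![_^T _ _]mxE !skewE// !eqxx [l == k]eq_sym (negPf kl) /=; ring.
  by rewrite mxE skewE// (negPf mk) (negPf ml) /=; ring.
transitivity (\sum_i \sum_j ((i == l)%:R *: (T k j *: om i j)
      - (i == k)%:R *: (T l j *: om i j))
    + \sum_i \sum_j ((j == l)%:R *: (T i k *: om i j)
      - (j == k)%:R *: (T i l *: om i j))); last first.
  rewrite -big_split /=; apply: eq_bigr => i _; rewrite -big_split /=.
  apply: eq_bigr => j _; rewrite [X in _ = X *: _]mxE skT Tsk.
  by apply/matrixP => x y; rewrite !mxE; ring.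
congr (_ + _).
  rewrite exchange_big /=; apply: eq_bigr => j _.
  by rewrite sumrB !(sum1 (fun i => _ *: om i j)).
by apply: eq_bigr => i _; rewrite sumrB !(sum1 (fun j => _ *: om i j)).
Qed.

(** By [E_model_map] the derivative of [s |-> sg (R (- s)) (Phi (R s T (R s)^T))]
    vanishes, where [R] is the rotation group of the plane [k, l]. *)
Lemma model_map_crot k l t T : k != l ->
  Phi (crot k l t *m T *m (crot k l t)^T) = sg (crot k l t) *m Phi T.
Proof.
move=> kl; have okl := evec_orthonormal R kl.
pose F s := sg (crot k l (- s)) *m Phi (crot k l s *m T *m (crot k l s)^T).
have dR s := crot_derive s kl.
have dRT s : mx_derive (fun x => (crot k l x)^T) s (skew k l *m crot k l s)^T.
  move=> i j; rewrite mxE.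
  have -> : (fun x : R => (crot k l x : 'M[R]_n)^T i j) = (fun x => crot k l x j i).
    by apply/funext => x; rewrite mxE.
  exact: dR.
have SD := sg_rotD rsg okl.
have dS s : mx_derive (fun x => sg (crot k l (- x))) s (- (E k l *m sg (crot k l (- s)))).
  have dN : is_derive s (1 : R) (fun x : R => - x) (- 1) by exact: is_deriveNid.
  rewrite -scaleN1r.
  apply: (@mx_derive_comp R N N (fun x => sg (crot k l x)) (fun x => - x)) dN.
  by rewrite EE; exact: (one_parameter_derive SD (genP rsg okl)).
have cS s : sg (crot k l s) *m E k l = E k l *m sg (crot k l s).
  by rewrite EE; exact: (gen_sg rsg _ okl).
have dF s : mx_derive F s 0.
  have dM := mx_deriveM (mx_deriveMr T (dR s)) (dRT s).
  apply: mx_derive_eq (mx_deriveM (dS s) (model_map_derive dM)) _.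
  set M := crot k l s *m T *m (crot k l s)^T.
  have -> : crot k l s *m T *m (skew k l *m crot k l s)^T +
      skew k l *m crot k l s *m T *m (crot k l s)^T
      = skew k l *m M + M *m (skew k l)^T.
    by rewrite addrC trmx_mul /M !mulmxA.
  by rewrite -E_model_map// mulmxA cS mulNmx subrr.
have e : F t = F 0 := mx_derive0_cst _ _ dF.
move: e; rewrite /F oppr0 /crot rot0 (sg1 rsg) trmx1 !mul1mx mulmx1 => <-.
by rewrite mulmxA -(sg_rotD rsg okl) subrr rot0 (sg1 rsg) mul1mx.
Qed.

Lemma model_map_SO A T : SO A -> Phi (A *m T *m A^T) = sg A *m Phi T.
Proof.
move=> hA; move: A hA T.
apply: SO_crot_ind => [T|k l t A kl hA IH T].
  by rewrite trmx1 mul1mx mulmx1 (sg1 rsg) mul1mx.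
have hr := crot_SO (R := R) t kl.
have := IH T; rewrite trmx_mul !mulmxA -(mulmxA (crot k l t) A) -(mulmxA (crot k l t)).
rewrite model_map_crot// (sgM rsg)// -mulmxA => /(congr1 (mulmx (sg (crot k l t)^T))).
by rewrite !mulmxA (sg_trKC rsg)// !mul1mx.
Qed.

End Intertwiner.

Section Injectivity.
Variables (R : realType) (n N : nat) (sg : 'M[R]_n -> 'M[R]_N).
Hypothesis rsg : is_matrix_rep sg.
Local Notation SO := (@special_orthogonal_group R n).
Local Notation E := (E sg).
Variable om : 'I_n -> 'I_n -> 'cV[R]_N.
Hypothesis som : sym_system sg om.
Implicit Types (T A : 'M[R]_n) (i j k l : 'I_n).
Local Notation Phi := (model_map om).

Lemma model_mapD S T : Phi (S + T) = Phi S + Phi T.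
Proof. by have := model_map_linear om 1 S T; rewrite !scale1r. Qed.

Lemma model_map0 : Phi 0 = 0.
Proof. by rewrite /model_map big1 // => ij _; rewrite mxE scale0r. Qed.

Lemma model_mapZ r T : Phi (r *: T) = r *: Phi T.
Proof. by have := model_map_linear om r T 0; rewrite !addr0 model_map0 addr0. Qed.

Lemma model_map_delta i j : Phi (delta_mx i j) = om i j.
Proof.
rewrite /model_map (bigD1 (i, j))//= mxE !eqxx scale1r big1 ?addr0// => -[k l].
by rewrite xpair_eqE => /negPf h; rewrite mxE h scale0r.
Qed.

(** [om l l - om k k] and [om k l] span a space on which [E k l] squares to
    [-4], so there is no invariant line. *)
Lemma om_free k l (a b : R) : k != l ->
  a *: (om l l - om k k) + b *: om k l = 0 -> a = 0 /\ b = 0.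
Proof.
move=> kl; have [oC o0 oE] := som; have lk : l != k by rewrite eq_sym.
set u := om l l - om k k; set r := om k l => ab.
have Er : E k l *m r = u.
  rewrite oE// !eqxx (negPf kl) (negPf lk) !scale1r !scale0r subr0.
  by rewrite sub0r.
have Eu : E k l *m u = (- 4) *: r.
  rewrite mulmxBr !oE// !eqxx (negPf kl) (negPf lk) !scale1r !scale0r (oC l k).
  by apply/matrixP => x y; rewrite !mxE; ring.
have r0 : r <> 0 by exact: o0.
clearbody u r.
have := congr1 (mulmx (E k l)) ab.
rewrite mulmxDr mulmx0 -!scalemxAr Er Eu => ab'.
have : (b ^+ 2 + 4 * a ^+ 2) *: r = 0.
  apply/matrixP => x y; move/matrixP/(_ x y): ab; move/matrixP/(_ x y): ab'.
  rewrite !mxE => h1 h2.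
  transitivity (b * (a * u x y + b * r x y) - a * (a * (- 4 * r x y) + b * u x y)).
    by ring.
  by rewrite h1 h2; ring.
move=> /eqP; rewrite scaler_eq0 => /orP[/eqP h|/eqP /r0 //].
have := sqr_ge0 a; have := sqr_ge0 b => hb ha.
have /eqP : a ^+ 2 = 0 by lra.
have /eqP : b ^+ 2 = 0 by lra.
by rewrite !sqrf_eq0 => /eqP -> /eqP ->.
Qed.

Lemma half_diag k l i j : k != l -> (crot k l pi : 'M[R]_n) i j =
  (-1) ^+ ((j == k) || (j == l)) * (i == j)%:R.
Proof.
move=> kl; transitivity ((crot k l pi *m evec j : 'cV[R]_n) i 0).
  by move: (crot k l pi) => M; rewrite /evec -colE mxE.
by rewrite half_evec// !mxE andbT.
Qed.

Lemma skew_actE T k l i j : T^T = T -> k != l ->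
  (skew R k l *m T + T *m (skew R k l)^T) i j =
  (i == l)%:R * T k j - (i == k)%:R * T l j
    + ((j == l)%:R * T i k - (j == k)%:R * T i l).
Proof.
move=> sT kl; have lk : l != k by rewrite eq_sym.
have sTe x y : T x y = T y x by rewrite -{1}sT mxE.
have skT x y : (skew R k l *m T) x y = (x == l)%:R * T k y - (x == k)%:R * T l y.
  rewrite mxE (bigD1 k)//= (bigD1 l lk)/= big1 => [|m /andP[mk ml]].
    by rewrite !skewE// !eqxx [l == k]eq_sym (negPf kl) /=; ring.
  by rewrite skewE// (negPf mk) (negPf ml) /=; ring.
have -> : T *m (skew R k l)^T = (skew R k l *m T)^T by rewrite trmx_mul sT.
by rewrite [LHS]mxE [X in _ + X]mxE !skT (sTe k i) (sTe l i).
Qed.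

(** The kernel is invariant, so it contains [Y = X T + T X^T] for X the generator
    of the plane [k, l], and the average of Y with its conjugate by the half
    turn of that plane.  Only the entries of the plane [k, l] survive
    the averaging, and [om_free] applies. *)
Lemma model_map_ker_offdiag T k l : T^T = T -> Phi T = 0 -> k != l -> T k l = 0.
Proof.
move=> sT PT kl; have lk : l != k by rewrite eq_sym.
have sTe i j : T i j = T j i by rewrite -{1}sT mxE.
pose Y := skew R k l *m T + T *m (skew R k l)^T.
pose D := crot k l pi : 'M[R]_n.
have PY : Phi Y = 0 by rewrite -(E_model_map som)// PT mulmx0.
have PDY : Phi (D *m Y *m D^T) = 0.
  by rewrite (model_map_SO rsg som) ?PY ?mulmx0//; exact: crot_SO.
have YE i j := skew_actE i j sT kl.
have DYE i j : (D *m Y *m D^T) i j = (-1) ^+ ((i == k) || (i == l)) *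
    (-1) ^+ ((j == k) || (j == l)) * Y i j.
  have D0 x y : x != y -> D x y = 0 by move=> /negPf xy; rewrite half_diag// xy mulr0.
  have D1 x : D x x = (-1) ^+ ((x == k) || (x == l)).
    by rewrite half_diag// eqxx mulr1.
  rewrite mxE (bigD1 j)//= big1 => [|m mj]; last first.
    by rewrite [D^T _ _]mxE D0 ?mulr0// eq_sym.
  rewrite addr0 [D^T _ _]mxE D1 mxE (bigD1 i)//= big1; first by rewrite D1 addr0; ring.
  by move=> m mi; rewrite D0 ?mul0r// eq_sym.
have ZE : Y + D *m Y *m D^T = (4 * T k l) *: (delta_mx l l - delta_mx k k)
    + (2 * (T k k - T l l)) *: (delta_mx k l + delta_mx l k).
  apply/matrixP => i j; rewrite [LHS]mxE DYE [Y i j]YE !mxE.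
  have [->|ik] := eqVneq i k; [|have [->|il] := eqVneq i l];
  (have [->|jk] := eqVneq j k; [|have [->|jl] := eqVneq j l]);
  rewrite ?eqxx ?(negPf kl) ?(negPf lk) ?(negPf ik) ?(negPf il) ?(negPf jk)
    ?(negPf jl) /= ?expr0 ?expr1 ?mulr1n ?mulr0n ?(sTe l k); ring.
have := congr1 Phi ZE.
rewrite model_mapD PY PDY addr0 model_mapD !model_mapZ -scaleN1r !model_mapD model_mapZ !model_map_delta.
have [oC _ _] := som; rewrite (oC l k) => e.
have /(om_free kl) [/eqP h _] : (4 * T k l) *: (om l l - om k k)
    + (4 * (T k k - T l l)) *: om k l = 0.
  rewrite [RHS]e; apply/matrixP => x y; rewrite !mxE; ring.
by move: h; rewrite mulf_eq0 pnatr_eq0 /= => /eqP.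
Qed.

(** The off-diagonal entries of [X T + T X^T] vanish as well, and for a diagonal
    matrix T they are the differences of its entries; so T is scalar. *)
Lemma model_map_injective T : (0 < n)%N -> T^T = T -> \tr T = 0 -> Phi T = 0 -> T = 0.
Proof.
move=> n0 sT tT PT.
have off := model_map_ker_offdiag _ PT.
have i0 : 'I_n := Ordinal n0.
have dg i : T i i = T i0 i0.
  have [->//|ii] := eqVneq i i0.
  pose Y := skew R i i0 *m T + T *m (skew R i i0)^T.
  have PY : Phi Y = 0 by rewrite -(E_model_map som)// PT mulmx0.
  have sY : Y^T = Y.
    by rewrite /Y linearD /= !trmx_mul sT trmxK addrC.
  have := model_map_ker_offdiag sY PY ii.
  rewrite (skew_actE _ _ sT ii) !eqxx (negPf ii) [i0 == i]eq_sym (negPf ii) /=.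
  by move=> h; lra.
have tE : \tr T = n%:R * T i0 i0.
  rewrite /mxtrace (eq_bigr (fun=> T i0 i0)) => [|i _]; last exact: dg.
  by rewrite sumr_const card_ord mulr_natl.
have /eqP : n%:R * T i0 i0 = 0 by rewrite -tE.
rewrite mulf_eq0 pnatr_eq0 -leqn0 leqNgt n0 /= => /eqP T0.
apply/matrixP => i j; rewrite mxE; have [<-|ij] := eqVneq i j; first by rewrite dg.
exact: off.
Qed.

End Injectivity.

(** * The case n = 2 *)

Section Plane.
Variables (R : realType) (N : nat) (S : R -> 'M[R]_N) (E : 'M[R]_N).
Hypothesis S0 : S 0 = 1%:M.
Hypothesis SD : forall s t, S (s + t) = S s *m S t.
Hypothesis dS0 : mx_derive S 0 E.
Hypothesis S2pi : S (pi *+ 2) = 1%:M.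
Implicit Types u w : 'cV[R]_N.

Lemma orbit_unique (c : R -> 'cV[R]_N) :
  (forall t, mx_derive c t (E *m c t)) -> forall t, c t = S t *m c 0.
Proof.
move=> dc t.
have e : S (- t) *m c t = S (- 0) *m c 0.
  apply: (@mx_derive0_cst R N 1 (fun s => S (- s) *m c s)) => s.
  have dN : is_derive s (1 : R) (fun x : R => - x) (- 1) by exact: is_deriveNid.
  have dS : mx_derive (fun x => S (- x)) s ((- 1) *: (E *m S (- s))).
    exact: (@mx_derive_comp R N N S (fun x => - x) s _ _
      (one_parameter_derive SD dS0 (- s)) dN).
  apply: mx_derive_eq (mx_deriveM dS (dc s)) _.
  by rewrite mulmxA (one_parameter_comm SD dS0) scaleN1r mulNmx subrr.
transitivity (S t *m (S (- t) *m c t)); first by rewrite mulmxA -SD subrr S0 mul1mx.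
by rewrite e oppr0 S0 mul1mx.
Qed.

(** The orbit of w is [exp(x t) (cos(y t) w + sin(y t) w')], which cannot be periodic
    unless [x = 0]. *)
Lemma planar_orbit (w w' : 'cV[R]_N) (x y : R) :
  (forall a b : R, a *: w + b *: w' = 0 -> a = 0 /\ b = 0) ->
  E *m w = x *: w + y *: w' -> E *m w' = x *: w' - y *: w ->
  x = 0 /\ forall t, S t *m w = cos (y * t) *: w + sin (y * t) *: w'.
Proof.
move=> free Ew Ew'.
pose c t := (expR (x * t) * cos (y * t)) *: w + (expR (x * t) * sin (y * t)) *: w'.
have dlin (z t : R) : is_derive t (1 : R) (fun s => z * s) z.
  apply: is_derive_eq (is_deriveM (is_derive_cst z t (1 : R)) (is_derive_id t (1 : R))) _.
  by rewrite /= /GRing.scale /=; ring.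
have dexp t : is_derive t (1 : R) (fun s => expR (x * s)) (x * expR (x * t)).
  apply: is_derive_eq (is_derive1_comp (is_derive_expR (x * t)) (dlin x t)) _.
  by rewrite mulrC.
have dcos t : is_derive t (1 : R) (fun s => cos (y * s)) (- (y * sin (y * t))).
  apply: is_derive_eq (is_derive1_comp (is_derive_cos (y * t)) (dlin y t)) _.
  by ring.
have dsin t : is_derive t (1 : R) (fun s => sin (y * s)) (y * cos (y * t)).
  apply: is_derive_eq (is_derive1_comp (is_derive_sin (y * t)) (dlin y t)) _.
  by ring.
have dc t : mx_derive c t (E *m c t).
  apply: mx_derive_eq (mx_deriveD
    (mx_deriveZ w (is_deriveM (dexp t) (dcos t)))
    (mx_deriveZ w' (is_deriveM (dexp t) (dsin t)))) _.
  rewrite /c mulmxDr -!scalemxAr Ew Ew'.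
  by apply/matrixP => i j; rewrite !mxE /GRing.scale /=; ring.
have cE := orbit_unique dc.
have c0 : c 0 = w.
  by rewrite /c !mulr0 expR0 cos0 sin0 mulr1 mulr0 scale1r scale0r addr0.
have x0 : x = 0.
  have := cE (pi *+ 2); rewrite S2pi mul1mx c0 /c => e.
  have /free [h1 h2] : (expR (x * (pi *+ 2)) * cos (y * (pi *+ 2)) - 1) *: w
      + (expR (x * (pi *+ 2)) * sin (y * (pi *+ 2))) *: w' = 0.
    by rewrite scalerBl scale1r addrAC e subrr.
  have {}h1 : expR (x * (pi *+ 2)) * cos (y * (pi *+ 2)) = 1 by lra.
  have : expR (x * (pi *+ 2)) ^+ 2 = 1.
    transitivity (expR (x * (pi *+ 2)) ^+ 2
        * (cos (y * (pi *+ 2)) ^+ 2 + sin (y * (pi *+ 2)) ^+ 2)).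
      by rewrite cos2Dsin2 mulr1.
    by rewrite mulrDr -!exprMn h1 h2 expr0n expr1n addr0.
  move=> /eqP; rewrite sqrf_eq1 => /orP[|/eqP h]; last first.
    by have := expR_gt0 (x * (pi *+ 2)); rewrite h; lra.
  rewrite -expR0 => /eqP /expR_inj /eqP; rewrite mulf_eq0 => /orP[/eqP //|].
  by rewrite mulrn_eq0 /= gt_eqF ?pi_gt0.
split=> // t; have := cE t; rewrite c0 => <-.
by rewrite /c x0 mul0r expR0 !mul1r.
Qed.

Lemma eigen_generator0 w r : w <> 0 -> E *m w = r *: w -> r = 0.
Proof.
move=> w0 Ew.
pose c (t : R) := expR (r * t) *: w.
have dlin (z t : R) : is_derive t (1 : R) (fun s => z * s) z.
  apply: is_derive_eq (is_deriveM (is_derive_cst z t (1 : R)) (is_derive_id t (1 : R))) _.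
  by rewrite /= /GRing.scale /=; ring.
have dc t : mx_derive c t (E *m c t).
  apply: mx_derive_eq (mx_deriveZ w
    (is_derive1_comp (is_derive_expR (r * t)) (dlin r t))) _.
  by rewrite /c -scalemxAr Ew scalerA.
have := orbit_unique dc (pi *+ 2); rewrite S2pi mul1mx /c mulr0 expR0.
move=> /eqP; rewrite -subr_eq0 -scalerBl scaler_eq0 => /orP[|/eqP //].
rewrite subr_eq0 -expR0 => /eqP /expR_inj /eqP; rewrite mulf_eq0 => /orP[/eqP //|].
by rewrite mulrn_eq0 /= gt_eqF ?pi_gt0.
Qed.

End Plane.

Lemma span2 (F : fieldType) (N : nat) (v w : 'cV[F]_N) : (N <= 2)%N ->
  (forall a b : F, a *: v + b *: w = 0 -> a = 0 /\ b = 0) ->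
  forall u, exists a b, u = a *: v + b *: w.
Proof.
move=> N2 free u.
have fr : vector.free [:: v; w].
  rewrite free_cons seq1_free span_seq1; apply/andP; split.
    apply/negP => /vlineP[k e]; have [|h _] := free 1 (- k).
      by rewrite scale1r e scaleNr subrr.
    by move/eqP: h; rewrite oner_eq0.
  apply/eqP => w0; have [|_ h] := free 0 1; first by rewrite w0 scale0r scaler0 addr0.
  by move/eqP: h; rewrite oner_eq0.
have : u \in <<[:: v; w]>>%VS.
  have -> : <<[:: v; w]>>%VS = fullv; last exact: memvf.
  apply/eqP; rewrite eqEdim subvf dimvf /= dim_matrix /=.
  move: fr; rewrite /vector.free => /eqP ->.
  by rewrite /GRing.mul /= muln1.
rewrite span_cons span_seq1 => /memv_addP[_ /vlineP[a ->] [_ /vlineP[b ->] ->]].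
by exists a, b.
Qed.

Section SO2.
Variables (R : realType) (n N : nat) (sg : 'M[R]_n -> 'M[R]_N).
Hypothesis rsg : is_matrix_rep sg.
Local Notation qt := (qt sg).
Local Notation ht := (ht sg).
Local Notation E := (E sg).
Hypothesis n2 : n = 2%N.
Hypothesis N2 : (N <= 2)%N.
Variables (i p : 'I_n) (v : 'cV[R]_N).
Hypothesis ip : i != p.
Hypothesis htv : ht i p *m v = v.
Hypothesis fixv : forall t, sg (crot i p t) *m v = v -> sin t = 0.

Local Notation S t := (sg (crot i p t)).
Local Notation X := (E i p).
Local Notation q := (sg (crot i p (pi / 4))).

Let oip := evec_orthonormal R ip.
Let S0 : S 0 = 1%:M. Proof. exact: (sg_rot0 rsg). Qed.
Let SD s t : S (s + t) = S s *m S t. Proof. exact: (sg_rotD rsg oip). Qed.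
Let dS0 : mx_derive (fun t => S t) 0 X. Proof. by rewrite EE; exact: genP. Qed.
Let S2pi : S (pi *+ 2) = 1%:M.
Proof.
by rewrite /crot /rot cos2pi sin2pi subrr !scale0r !addr0 (sg1 rsg).
Qed.

Let eig0 (w : 'cV[R]_N) (r : R) : w <> 0 -> X *m w = r *: w -> r = 0.
Proof. exact: (eigen_generator0 S0 SD dS0 S2pi). Qed.

Let Xv : X *m v <> 0.
Proof.
move=> h; have /fixv : S (pi / 2) *m v = v by exact: (E_fix rsg ip h).
by rewrite sin_pihalf => /eqP; rewrite oner_eq0.
Qed.

Let freeX (w : 'cV[R]_N) : X *m w <> 0 -> forall a b : R, a *: w + b *: (X *m w) = 0 -> a = 0 /\ b = 0.
Proof.
move=> Xw a b e; have w0 : w <> 0 by move=> w0; apply: Xw; rewrite w0 mulmx0.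
have [b0|bn] := eqVneq b 0.
  move: e; rewrite b0 scale0r addr0 => /eqP; rewrite scaler_eq0.
  by case/orP => /eqP.
case: Xw; have Xw : X *m w = (- (b^-1 * a)) *: w.
  have := congr1 (fun u => b^-1 *: u) e.
  rewrite scaler0 scalerDr !scalerA mulVf// scale1r addrC => /eqP.
  by rewrite addr_eq0 scaleNr => /eqP.
by rewrite Xw (eig0 w0 Xw) scale0r.
Qed.

(** The quarter turn acts as [-1]: otherwise its two eigenlines would be
    invariant under the circle, which then acts trivially. *)
Let qtN (u : 'cV[R]_N) : qt i p *m u = - u.
Proof.
have sp := span2 N2 (freeX Xv).
have cX : qt i p *m X = X *m qt i p by exact: (E_qt_comm rsg).
have qq (w : 'cV[R]_N) : qt i p *m (qt i p *m w) = w.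
  have [a [b ->]] := sp w.
  rewrite mulmxA (qt_qtE rsg ip) mulmxDr -!scalemxAr htv.
  have -> : ht i p *m (X *m v) = X *m v by rewrite mulmxA htE EE (gen_sg rsg _ oip) -EE -htE -mulmxA htv.
  by [].
pose y := v - qt i p *m v.
have y0 : y <> 0.
  move=> /eqP; rewrite subr_eq0 eq_sym => /eqP; rewrite qtE => /fixv.
  by rewrite sin_pihalf => /eqP; rewrite oner_eq0.
have qy : qt i p *m y = - y by rewrite mulmxBr qq opprB.
clearbody y.
pose z := u + qt i p *m u.
have qz : qt i p *m z = z by rewrite mulmxDr qq addrC.
suff : z = 0 by rewrite /z addrC => /eqP; rewrite addr_eq0 => /eqP.
clearbody z; apply: contrapT => z0.
have free_yz (a b : R) : a *: y + b *: z = 0 -> a = 0 /\ b = 0.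
  move=> e; have := congr1 (mulmx (qt i p)) e.
  rewrite mulmxDr mulmx0 -!scalemxAr qy qz => e'.
  have : (2 * b) *: z = 0 /\ (2 * a) *: y = 0.
    split; apply/matrixP => k l; move/matrixP/(_ k l): e; move/matrixP/(_ k l): e';
      rewrite !mxE; lra.
  move=> [/eqP hb /eqP ha]; move: hb ha; rewrite !scaler_eq0 pnatr_eq0 /=.
  by move=> /orP[/eqP ->|/eqP //] /orP[/eqP ->|/eqP //].
have sp' := span2 N2 free_yz.
have Xy : X *m y = 0.
  have [a [b e]] := sp' (X *m y).
  have : qt i p *m (X *m y) = - (X *m y) by rewrite mulmxA cX -mulmxA qy mulmxN.
  rewrite e mulmxDr -!scalemxAr qy qz => e'.
  have /free_yz [_ b0] : 0 *: y + (2 * b) *: z = 0.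
    by apply/matrixP => k l; move/matrixP/(_ k l): e'; rewrite !mxE; lra.
  move: e; have -> : b = 0 by lra.
  rewrite scale0r addr0 => e; have a0 := eig0 y0 e.
  by move: e; rewrite a0 scale0r.
have Xz : X *m z = 0.
  have [a [b e]] := sp' (X *m z).
  have : qt i p *m (X *m z) = X *m z by rewrite mulmxA cX -mulmxA qz.
  rewrite e mulmxDr -!scalemxAr qy qz => e'.
  have /free_yz [a0 _] : (2 * a) *: y + 0 *: z = 0.
    by apply/matrixP => k l; move/matrixP/(_ k l): e'; rewrite !mxE; lra.
  move: e; have -> : a = 0 by lra.
  rewrite scale0r add0r => e; have b0 := eig0 z0 e.
  by move: e; rewrite b0 scale0r.
apply: Xv; have [a [b ->]] := sp' v.
by rewrite mulmxDr -!scalemxAr Xy Xz !scaler0 addr0.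
Qed.

(** The eighth of a turn squares to [-1] by [qtN], so it is a complex structure J on V and
    [X = y J]: the orbit of v is [cos(y t) v + sin(y t) J v].  The half turn
    fixes v, so [y pi] is a multiple of [2 pi], and y is [2] or [-2] because
    only the multiples of the half turn fix v. *)
Lemma SO2_square (w : 'cV[R]_N) : X *m (X *m w) = (- 4) *: w.
Proof.
have v0 : v <> 0 by move=> v0; apply: Xv; rewrite v0 mulmx0.
have qq (u : 'cV[R]_N) : q *m (q *m u) = - u.
  rewrite mulmxA -SD -qtN qtE; congr (sg (crot i p _) *m _).
  by lra.
have free_q (m : 'cV[R]_N) : m <> 0 -> forall a b : R, a *: m + b *: (q *m m) = 0 -> a = 0 /\ b = 0.
  move=> u0 a b e; have := congr1 (mulmx q) e.
  rewrite mulmxDr mulmx0 -!scalemxAr qq => e'.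
  have : (a ^+ 2 + b ^+ 2) *: m = 0.
    apply/matrixP => k l; move/matrixP/(_ k l): e; move/matrixP/(_ k l): e'.
    rewrite !mxE => h1 h2.
    transitivity (a * (a * m k l + b * (q *m m) k l) - b * (a * (q *m m) k l + b * - m k l)).
      by ring.
    by rewrite mxE in h1 h2 *; rewrite h1 h2; ring.
  move=> /eqP; rewrite scaler_eq0 => /orP[/eqP h|/eqP //].
  have := sqr_ge0 a; have := sqr_ge0 b => hb ha.
  have /eqP : a ^+ 2 = 0 by lra.
  have /eqP : b ^+ 2 = 0 by lra.
  by rewrite !sqrf_eq0 => /eqP -> /eqP ->.
have sp := span2 N2 (free_q v v0).
have cq : q *m X = X *m q by rewrite EE; exact: (gen_sg rsg).
have [x [y Ev]] := sp (X *m v).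
have Eqv : X *m (q *m v) = x *: (q *m v) - y *: v.
  rewrite mulmxA -cq -mulmxA Ev mulmxDr -!scalemxAr qq.
  by rewrite scalerN.
have [x0 St] := planar_orbit S0 SD dS0 S2pi (free_q v v0) Ev Eqv.
have fixt t : cos (y * t) = 1 -> sin (y * t) = 0 -> sin t = 0.
  by move=> ct st; apply: fixv; rewrite St ct st scale1r scale0r addr0.
have yn : y <> 0.
  by move=> y0; apply: Xv; rewrite Ev x0 y0 !scale0r addr0.
have cy : cos (y * pi) = 1.
  have := St pi; rewrite -htE htv => e.
  have /(free_q v v0) [h _] : (1 - cos (y * pi)) *: v + (- sin (y * pi)) *: (q *m v) = 0.
    by rewrite scalerBl scale1r scaleNr {1}e; apply/matrixP => k l; rewrite !mxE; ring.
  lra.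
have pi0 := pi_gt0 R.
have y2 : y ^+ 2 = 4.
  have ay0 : 0 < `|y| by rewrite normr_gt0; exact/eqP.
  suff ay : `|y| = 2 by rewrite -real_normK ?num_real// ay; ring.
  apply/eqP; rewrite eq_le; apply/andP; split; rewrite leNgt; apply/negP => h.
    have t0 : 0 < 2 * pi / `|y| by rewrite divr_gt0// mulr_gt0.
    have tpi : 2 * pi / `|y| < pi.
      by rewrite ltr_pdivrMr// mulrC ltr_pM2l.
    have yt : y * (2 * pi / `|y|) = Num.sg y * (pi *+ 2).
      rewrite {1}[y]numEsg mulr2n; field; by rewrite gt_eqF.
    have := fixt (2 * pi / `|y|); rewrite yt sin_sg cos_sg; last exact/eqP.
    rewrite cos2pi sin2pi mulr0 => /(_ erefl erefl) s0.
    by have := @sin_gt0_pi R (2 * pi / `|y|); rewrite s0 ltxx t0 tpi => /(_ isT).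
  have th0 : 0 < `|y| * pi / 2 by rewrite divr_gt0// mulr_gt0.
  have thpi : `|y| * pi / 2 < pi.
    by rewrite ltr_pdivrMr// mulrC ltr_pM2l.
  have : cos (`|y| * pi) = 1.
    by rewrite -(gtr0_norm pi0) -normrM cos_norm.
  have -> : `|y| * pi = (`|y| * pi / 2) *+ 2 by rewrite mulr2n; field.
  rewrite cos_mulr2n cos2sin2 => c1.
  have s0 : 0 < sin (`|y| * pi / 2) by apply: sin_gt0_pi; rewrite th0.
  have : 0 < sin (`|y| * pi / 2) ^+ 2 by rewrite exprn_gt0.
  by move: c1; rewrite mulr2n; lra.
have XXv (u : 'cV[R]_N) : u = v \/ u = q *m v -> X *m (X *m u) = (- 4) *: u.
  case=> ->; rewrite ?Eqv ?Ev x0 !scale0r ?add0r ?sub0r.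
    rewrite -scalemxAr Eqv x0 scale0r sub0r scalerN scalerA -expr2 y2.
    by rewrite scaleNr.
  rewrite mulmxN -scalemxAr Ev x0 scale0r add0r scalerA -expr2 y2.
  by rewrite scaleNr.
have [a [b ->]] := sp w.
rewrite !mulmxDr -!scalemxAr !XXv; [|by right|by left].
by rewrite scalerDr !scalerA; congr (_ *: _ + _ *: _); ring.
Qed.

(** [v] and [- v] play the role of the diagonal matrix units made traceless. *)
Lemma SO2_sym_system : exists om, sym_system sg om.
Proof.
have two m : m = i \/ m = p.
  have lt2 (k : 'I_n) : (k < 2)%N by apply: leq_trans (ltn_ord k) _; rewrite n2.
  have := lt2 m; have := lt2 i; have := lt2 p; move: (ip); rewrite -val_eqE => h1 h2 h3 h4.
  have : val m = val i \/ val m = val p by move: h1 h2 h3 h4 => /=; lia.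
  by case=> /val_inj; [left|right].
pose w m := if m == i then v else - v.
have wi : w i = v by rewrite /w eqxx.
have wp : w p = - v by rewrite /w eq_sym (negPf ip).
exists (sym_of_diag sg w); apply: sym_system_of_diag => //.
- move=> k l m kl km lm.
  by case: (two k) (two l) (two m) kl km lm => -> [] -> [] ->; rewrite eqxx.
- move=> k l; case: (two k) (two l) => -> [] ->; rewrite ?eqxx // => _.
    by rewrite wi wp subrr mulmx0.
  by rewrite wi wp addrC subrr mulmx0.
- move=> k l; case: (two k) (two l) => -> [] ->; rewrite ?eqxx // => _.
    by rewrite wi wp SO2_square; apply/matrixP => a b; rewrite !mxE; ring.
  rewrite (EC rsg ip) !mulNmx mulmxN opprK wi wp SO2_square.
  by apply/matrixP => a b; rewrite !mxE; ring.
- move=> k l; case: (two k) (two l) => -> [] ->; rewrite ?eqxx // => _.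
    by rewrite wi; exact: Xv.
  by rewrite (EC rsg ip) wp mulNmx mulmxN opprK; exact: Xv.
Qed.

End SO2.

(** * The block subgroup and the stabilizer hypothesis *)

Lemma mul_mxdiag (R : realType) (r : nat) (p : 'I_r -> nat)
    (B C : forall i, 'M[R]_(p i)) :
  \mxdiag_i B i *m \mxdiag_i C i = \mxdiag_i (B i *m C i).
Proof.
rewrite {1}/mxdiag mul_mxblock_mxdiag; apply/eq_mxblock => i j.
by case: eqVneq => [->|]; rewrite ?conform_mx_id ?mul0mx.
Qed.

(** The block of an index turns block diagonality into the vanishing of entries. *)
Lemma block_orthogonalP (R : realType) (n r : nat) (p : 'I_r -> nat)
    (sum_p : (\sum_(i < r) p i)%N = n) (p_ge1 : forall i, (1 <= p i)%N) :
  exists blk : 'I_n -> 'I_r, (forall i, exists k, blk k = i) /\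
    forall A : 'M[R]_n, special_block_orthogonal_group sum_p A <->
      special_orthogonal_group A /\ forall a b, blk a != blk b -> A a b = 0.
Proof.
case: n / sum_p => /=; exists (@tagnat.sig1 r p); split=> [i|A].
  by exists (@tagnat.Rank r p i (Ordinal (p_ge1 i))); rewrite tagnat.Rank1K.
have offdiag : (forall a b, tagnat.sig1 a != tagnat.sig1 b -> A a b = 0) <->
    A = \mxdiag_i submxblock A i i.
  split=> [A0|-> a b ab]; last by rewrite mxE (negPf ab) mxE.
  rewrite -[LHS]submxblockK /mxdiag; apply/eq_mxblock => i j.
  case: eqVneq => [->|ij]; first by rewrite conform_mx_id.
  by apply/matrixP => a b; rewrite !mxE A0 // !tagnat.Rank1K.
split.
  move=> [[B [oB ->]] dA]; rewrite castmx_id in dA *; split.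
    split=> //; rewrite /orthogonal_group /= tr_mxdiag mul_mxdiag.
    rewrite -[RHS]mxdiagZ; apply/eq_mxdiagP => i; exact: oB.
  by move=> a b ab; rewrite mxE (negPf ab) mxE.
move=> [[oA dA] /offdiag A0]; split=> //; exists (fun i => submxblock A i i).
rewrite castmx_id; split=> //.
apply/eq_mxdiagP; rewrite mxdiagZ -oA A0 tr_mxdiag mul_mxdiag.
by apply/eq_mxdiag => i; rewrite -A0.
Qed.

Section Coordinates.
Variables (R : realType) (n : nat) (V : vectType R) (rho : 'M[R]_n -> 'End(V)).
Hypothesis rep : is_SO_representation rho.
Local Notation SO := (@special_orthogonal_group R n).
Local Notation N := (\dim {:V}).
Local Notation e := (vbasis (@fullv R V)).

(** Transposed because the matrix of an endomorphism acts on row vectors, while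
    matrix representations act here on column vectors. *)
Definition coord_rep (A : 'M[R]_n) : 'M[R]_N := (passmx.mxof e e (rho A))^T.

Definition coord_vec (v : V) : 'cV[R]_N := (passmx.rVof e v)^T.

Let eP : basis_of fullv e := vbasisP fullv.

Lemma coord_vec_inj : injective coord_vec.
Proof. by move=> u v /trmx_inj; apply: can_inj (passmx.rVofK eP) _ _. Qed.

Lemma coord_rep_vec A v : coord_rep A *m coord_vec v = coord_vec (rho A v).
Proof. by rewrite -trmx_mul /coord_vec (passmx.rVof_app _ eP). Qed.

Lemma coord_rep_is_matrix_rep : is_matrix_rep coord_rep.
Proof.
have [r1 rM rc] := rep; split.
- by rewrite /coord_rep r1 passmx.mxof1 ?trmx1 // (basis_free eP).
- move=> A B oA oB; rewrite /coord_rep (rM _ _ oA oB).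
  by rewrite (passmx.mxof_comp _ _ eP) trmx_mul.
- move=> i j; have -> : (fun A => coord_rep A i j) =
      (fun M : 'M[R]_N => M j i) \o (fun A => passmx.mxof e e (rho A)).
    by apply/funext => A; rewrite /coord_rep mxE.
move=> A; apply: (@continuous_comp (subspace SO) 'M[R]_N R); first exact: rc.
exact: coord_continuous.
Qed.

End Coordinates.

Lemma mulmx_evec (R : realType) (n : nat) (A : 'M[R]_n) a b :
  (A *m evec b) a 0 = A a b.
Proof. by rewrite -colE mxE. Qed.

Section BlockStabilizer.
Variables (R : realType) (n N : nat) (sg : 'M[R]_n -> 'M[R]_N).
Hypothesis rsg : is_matrix_rep sg.
Local Notation qt := (qt sg).
Local Notation ht := (ht sg).
Variables (T : eqType) (blk : 'I_n -> T) (v : 'cV[R]_N) (i0 p : 'I_n).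
Hypothesis i0p_blk : blk i0 != blk p.
Hypothesis stab : forall A, special_orthogonal_group A ->
  (sg A *m v = v <-> forall a b, blk a != blk b -> A a b = 0).

Let i0p : i0 != p. Proof. by apply: contraNN i0p_blk => /eqP ->. Qed.

Let moved A a b : special_orthogonal_group A -> blk a != blk b ->
  (A *m evec b) a 0 != 0 -> sg A *m v <> v.
Proof. by move=> oA ab + /(stab oA)/(_ a b ab) A0; rewrite mulmx_evec A0 eqxx. Qed.

Lemma block_inW : inW sg v.
Proof.
move=> k l kl; rewrite htE; apply/stab; first exact: crot_SO.
move=> a b ab; rewrite -mulmx_evec half_evec // !mxE.
by have [ab'|] := eqVneq a b; [rewrite ab' eqxx in ab|rewrite mulr0].
Qed.

Lemma block_qt : qt i0 p *m v <> v.
Proof.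
rewrite qtE; apply: (@moved _ p i0); [exact: crot_SO|by rewrite eq_sym|].
by rewrite quarter_evec // tpermL (negPf i0p) !mxE eqxx mulr1 oner_eq0.
Qed.

Lemma block_qt_adjacent k : k != i0 -> k != p ->
  qt i0 p *m (qt i0 k *m v) <> v.
Proof.
move=> ki kp; have ik : i0 != k by rewrite eq_sym.
rewrite mulmxA !qtE -(sgM rsg); [|exact: crot_SO..].
apply: (@moved _ i0 p) => //; first by apply: special_orthogonalM; exact: crot_SO.
rewrite -mulmxA crot_other; [|by rewrite eq_sym..].
by rewrite quarter_evec // tpermR !mxE !eqxx mulr1 signr_eq0.
Qed.

Lemma block_qt_disjoint k l : k != l -> k != i0 -> k != p -> l != i0 -> l != p ->
  qt i0 p *m (qt k l *m v) <> v.
Proof.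
move=> kl ki kp li lp; rewrite mulmxA !qtE -(sgM rsg); [|exact: crot_SO..].
apply: (@moved _ p i0); [apply: special_orthogonalM; exact: crot_SO|by rewrite eq_sym|].
rewrite -mulmxA crot_other; [|by rewrite eq_sym..].
by rewrite quarter_evec // tpermL (negPf i0p) !mxE eqxx mulr1 oner_eq0.
Qed.

Lemma block_fix t : sg (crot i0 p t) *m v = v -> sin t = 0.
Proof.
move=> /(stab (crot_SO t i0p))/(_ p i0); rewrite eq_sym => /(_ i0p_blk).
have oip := evec_orthonormal R i0p.
by rewrite -mulmx_evec rot_mulx // !mxE !eqxx [p == i0]eq_sym (negPf i0p) mulr0 add0r mulr1.
Qed.

(** The stabilizer contains the diagonal matrices, which gives [inW sg v], and
    it contains no matrix with a nonzero entry outside the blocks, such as the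
    product of a quarter turn of [i0, p] with another quarter turn. *)
Lemma block_sym_system : (2 <= n)%N -> (N <= (n + 2) * (n - 1) %/ 2)%N ->
  exists om, sym_system sg om.
Proof.
move=> n_ge2 dN; have Wv := block_inW; have nv1 := block_qt.
have [n2|n_neq2] := eqVneq n 2%N.
  apply: (SO2_sym_system rsg n2 _ i0p (Wv _ _ i0p) block_fix).
  by rewrite n2 in dN.
have n3 : (3 <= n)%N by lia.
apply: (reflections_sym_system rsg i0p n3 Wv nv1 block_qt_adjacent block_qt_disjoint).
have [n4|n_neq4] := eqVneq n 4%N.
  apply: (rank_one_four rsg n4 _ i0p Wv block_qt_disjoint).
    by rewrite n4 in dN.
  by move=> i j ij; apply: (qt_nontrivial rsg i0p Wv nv1).
move=> i j ij; apply: (rank_one_generic rsg n3 n_neq4 Wv _ dN ij).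
by move=> v0; apply: nv1; rewrite v0 mulmx0.
Qed.

End BlockStabilizer.

(** * The isospectral model *)

Lemma lfun_of_linear (R : fieldType) (U V : vectType R) (f : U -> V) :
  linear f -> exists F : 'Hom(U, V), F =1 f.
Proof.
move=> lf; pose F : {linear U -> V} :=
  HB.pack f (GRing.isLinear.Build _ _ _ _ f lf).
by exists (linfun F) => u; rewrite (lfunE F).
Qed.

Section IsospectralModel.
Variables (R : realType) (n : nat).
Hypothesis n_gt0 : (0 < n)%N.
Local Notation Sym0 := (traceless_sym R n).
Local Notation SO := (@special_orthogonal_group R n).

Let last_lt : (n.-1 < n)%N. Proof. by rewrite prednK. Qed.
Local Notation l := (Ordinal last_lt).

(** The upper triangular entries other than the last diagonal one are
    coordinates on the traceless symmetric matrices. *)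
Definition free_entry (k : 'I_n * 'I_n) := (k.1 <= k.2)%N && (k != (l, l)).

Definition sym0_basis (k : 'I_n * 'I_n) : 'M[R]_n :=
  if k.1 == k.2 then delta_mx k.1 k.1 - delta_mx l l
  else delta_mx k.1 k.2 + delta_mx k.2 k.1.

Lemma sym0_basis_in k : sym0_basis k \in Sym0.
Proof.
rewrite mem_traceless_sym /sym0_basis.
have tr i j : \tr (delta_mx i j : 'M[R]_n) = (i == j)%:R.
  rewrite /mxtrace (bigD1 i) //= mxE eqxx /= big1 ?addr0 // => m mi.
  by rewrite mxE (negPf mi).
have [ij|ij] := eqVneq k.1 k.2.
  by rewrite !linearB /= !trmx_delta eqxx !tr !eqxx subrr eqxx.
by rewrite !linearD /= !trmx_delta addrC eqxx !tr [k.2 == _]eq_sym (negPf ij) addr0 eqxx.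
Qed.

Lemma sym0_basis_coord k k' : free_entry k -> free_entry k' ->
  sym0_basis k k'.1 k'.2 = (k' == k)%:R.
Proof.
case: k k' => [i j] [i' j'] /andP[/= ij kl] /andP[/= ij' kl'].
rewrite /sym0_basis /= xpair_eqE.
case: eqVneq => [e|ne]; rewrite !mxE.
  by move: kl'; rewrite xpair_eqE => /negPf ->; rewrite -e subr0.
case: (boolP ((i' == j) && _)) => [/andP[/eqP e1 /eqP e2]|_]; last by rewrite addr0.
case/eqP: ne; apply: val_inj; apply/eqP.
by rewrite eqn_leq ij /= -e1 -e2.
Qed.

Lemma card_free_entry : #|free_entry| = ((n + 2) * (n - 1) %/ 2)%N.
Proof.
have : (#|free_entry|.+1 = 'C(n, 2) + n)%N.
  have -> : (#|free_entry|.+1 = #|[pred k : 'I_n * 'I_n | (k.1 <= k.2)%N]|)%N.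
    rewrite [RHS](cardD1 (l, l)) inE /= leqnn add1n; congr _.+1.
    by apply: eq_card => k; rewrite !inE /free_entry andbC.
  rewrite -sum1_card -sum_pairs.
  rewrite (bigID [pred k : 'I_n * 'I_n | (k.1 < k.2)%N]) /=; congr (_ + _)%N.
    by apply: eq_bigl => k; rewrite !inE andb_idl // => /ltnW.
  rewrite (eq_bigl [pred k | k \in [set (i, i) | i : 'I_n]]).
    by rewrite sum1_card card_imset ?card_ord // => i j [].
  move=> [i j]; rewrite !inE /= -leqNgt -eqn_leq.
  apply/eqP/imsetP => [/val_inj -> |[k _ [-> ->]] //]; by exists j.
rewrite bin2; have := odd_double_half (n * n.-1).
have -> : odd (n * n.-1) = false.
  by rewrite oddM; case: n n_gt0 => // m _ /=; rewrite andNb.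
rewrite add0n -muln2; set h := (_./2)%N; set c := #|_|; clearbody h c.
case: n n_gt0 => // m _ /= e cE.
have -> : ((m.+1 + 2) * (m.+1 - 1) = c * 2)%N by rewrite subn1 /=; nia.
by rewrite mulnK.
Qed.

Lemma dim_traceless_sym : \dim {: subvs_of Sym0} = ((n + 2) * (n - 1) %/ 2)%N.
Proof.
rewrite -card_free_entry dimvf /=.
have [coords coordsE] : exists f : 'Hom('M[R]_n, 'rV[R]_(#|free_entry|)),
    f =1 fun T => \row_u T (enum_val u).1 (enum_val u).2.
  by apply: lfun_of_linear => a S T; apply/rowP => u; rewrite !mxE.
have [comb combE] : exists f : 'Hom('rV[R]_(#|free_entry|), 'M[R]_n),
    f =1 fun a => \sum_u a 0 u *: sym0_basis (enum_val u).
  apply: lfun_of_linear => a S T; rewrite scaler_sumr -big_split /=.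
  by apply: eq_bigr => u _; rewrite !mxE scalerA scalerDl.
have fe (u : 'I_#|free_entry|) : free_entry (enum_val u) := enum_valP u.
have combK : cancel comb coords.
  move=> a; rewrite coordsE combE; apply/rowP => u; rewrite mxE summxE.
  rewrite (bigD1 u) //= mxE sym0_basis_coord // eqxx mulr1.
  rewrite big1 ?addr0 // => w wu; rewrite mxE sym0_basis_coord //.
  by rewrite (inj_eq enum_val_inj) eq_sym (negPf wu) mulr0.
have dX : \dim {: 'rV[R]_(#|free_entry|)} = #|free_entry|.
  by rewrite dimvf /= dim_matrix; exact: mul1n.
apply/eqP; rewrite eqn_leq; apply/andP; split.
  rewrite -[leqRHS]dX -[leqLHS](@limg_dim_eq _ _ _ coords); first exact/dimvS/subvf.
  apply/eqP; rewrite -subv0; apply/subvP => T; rewrite memv_cap memv_ker memv0.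
  rewrite mem_traceless_sym => /andP[/andP[/eqP sT /eqP tT] /eqP].
  rewrite coordsE => c0.
  have T0 (i j : 'I_n) : (i <= j)%N -> (i, j) != (l, l) -> T i j = 0.
    move=> ij ijl; have k : free_entry (i, j) by rewrite /free_entry ij.
    have /rowP/(_ (enum_rank_in k (i, j))) := c0.
    by rewrite !mxE enum_rankK_in.
  have {}T0 (i j : 'I_n) : (i, j) != (l, l) -> T i j = 0.
    have [ij|ji] := leqP i j; first exact: T0.
    rewrite !xpair_eqE andbC => ijl; rewrite -sT mxE; apply: T0 (ltnW ji) _.
    by rewrite xpair_eqE.
  have Tl : T l l = 0.
    rewrite -tT /mxtrace (bigD1 l) //= big1 ?addr0 // => i il.
    by rewrite T0 // xpair_eqE negb_and il.
  apply/eqP/matrixP => i j; rewrite mxE.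
  by have [[-> ->]|ijl] := eqVneq (i, j) (l, l); [|exact: T0].
rewrite -[leqLHS]dX -[leqLHS](@limg_dim_eq _ _ _ comb).
  apply: dimvS; apply/subvP => _ /memv_imgP[a _ ->]; rewrite combE.
  by apply: memv_suml => u _; apply: memvZ; exact: sym0_basis_in.
apply/eqP; rewrite -subv0; apply/subvP => a; rewrite memv_cap memv_ker memv0.
by move=> /andP[_ /eqP a0]; rewrite -(combK a) a0 linear0.
Qed.

End IsospectralModel.

Lemma cvg_sum (R : realType) (T : Type) (F : set_system T) (FF : Filter F)
    (I : finType) (f : I -> T -> R) (l : I -> R) :
  (forall i, f i x @[x --> F] --> l i) ->
  \sum_i f i x @[x --> F] --> \sum_i l i.
Proof.
move=> h; apply: (@cvg_big R I +%R 0 xpredT _ T F (index_enum I) f l FF) => [|i _].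
  exact: add_continuous.
exact: h.
Qed.

Lemma lfun_mx_continuous (R : realType) (n : nat) (f : 'Hom('M[R]_n, R^o)) :
  continuous (f : 'M[R]_n -> R).
Proof.
have fE : (f : 'M[R]_n -> R) =
    fun M => \sum_i \sum_j M i j * (f (delta_mx i j) : R).
  apply/funext => M; rewrite {1}[M]matrix_sum_delta linear_sum.
  apply: eq_bigr => i _; rewrite linear_sum; apply: eq_bigr => j _.
  by rewrite linearZ.
rewrite fE => M; apply: (@cvg_sum R _ (nbhs M) (nbhs_filter M)) => i.
apply: (@cvg_sum R _ (nbhs M) (nbhs_filter M)) => j.
by apply: cvgM; [exact: coord_continuous|exact: cvg_cst].
Qed.

Lemma conj_mx_continuous (R : realType) (n : nat) (T : 'M[R]_n) :
  continuous (fun B : 'M[R]_n => B *m T *m B^T).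
Proof.
move=> B; apply: (@cvg_mx R _ (nbhs B) (nbhs_filter B)) => i j.
rewrite (_ : (fun x => _) = fun A : 'M[R]_n =>
    \sum_k (\sum_l A i l * T l k) * A j k); last first.
  by apply/funext => A; rewrite mxE; apply: eq_bigr => k _; rewrite !mxE.
rewrite mxE; apply: (@cvg_sum R _ (nbhs B) (nbhs_filter B)) => k; rewrite !mxE.
apply: cvgM; last exact: coord_continuous.
apply: (@cvg_sum R _ (nbhs B) (nbhs_filter B)) => l; apply: cvgM; last exact: cvg_cst.
exact: coord_continuous.
Qed.

Lemma isospectral_model_rep (R : realType) (n : nat) :
  is_SO_representation (@isospectral_model R n).
Proof.
have so1 := special_orthogonal1 R n.
split.
- apply/lfunP => T; apply: subvs_inj.
  by rewrite isospectral_modelE // mul1mx trmx1 mulmx1 lfunE.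
- move=> A B oA oB; apply/lfunP => T; apply: subvs_inj.
  rewrite comp_lfunE !isospectral_modelE //; last exact: special_orthogonalM.
  by rewrite trmx_mul !mulmxA.
set e := vbasis _.
have entry i j : exists f : 'Hom('M[R]_n, R^o), exists T : 'M[R]_n,
    forall B, special_orthogonal_group B ->
    passmx.mxof e e (isospectral_model B) i j = f (B *m T *m B^T).
  have [f fE] : exists f : 'Hom('M[R]_n, R^o),
      f =1 fun M => coord e j (vsproj (traceless_sym R n) M).
    by apply: lfun_of_linear => a S T; rewrite !linearP.
  exists f, (vsval e`_i) => B oB; rewrite fE -isospectral_modelE // vsvalK.
  by rewrite !mxE /= passmx.vecof_delta.
pose f i j := sval (cid (entry i j)).
pose T i j := sval (cid (svalP (cid (entry i j)))).
pose g (B : 'M[R]_n) := \matrix_(i, j) (f i j (B *m T i j *m B^T) : R).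
apply: (@subspace_eq_continuous _ _ _ g) => [B|].
  rewrite inE => oB; apply/matrixP => i j; rewrite mxE.
  exact/esym/(svalP (cid (svalP (cid (entry i j))))).
apply: continuous_subspaceT => B.
apply: (@cvg_mx R _ (nbhs B) (nbhs_filter B)) => i j.
rewrite (_ : (fun x => g x i j) =
    (f i j : 'M[R]_n -> R) \o (fun B : 'M[R]_n => B *m T i j *m B^T)); last first.
  by apply/funext => x; rewrite mxE.
rewrite mxE; apply: (@continuous_comp 'M[R]_n 'M[R]_n R _ _ B).
  exact: conj_mx_continuous.
exact: lfun_mx_continuous.
Qed.

(** The diagonal matrix with entries [c], made traceless by a scalar matrix;
    an orthogonal matrix fixes it if and only if it commutes with it. *)
Lemma diagonal_model_vector (R : realType) (n : nat) (c : 'I_n -> R) :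
  (0 < n)%N ->
  exists v : subvs_of (traceless_sym R n), forall A, special_orthogonal_group A ->
    (isospectral_model A v = v <-> forall a b, c a != c b -> A a b = 0).
Proof.
move=> n0; pose D : 'M[R]_n := diag_mx (\row_i c i).
pose S := D - (\tr D / n%:R)%:M.
have S0 : S \in traceless_sym R n.
  rewrite mem_traceless_sym; apply/andP; split.
    by rewrite /S linearB /= tr_scalar_mx tr_diag_mx.
  rewrite /S linearB /= mxtrace_scalar -[_ *+ n]mulr_natr divfK ?subrr //.
  by rewrite pnatr_eq0 -lt0n.
exists (vsproj _ S) => A oA; have [oAA' _] := oA.
have oAA : A *m A^T = 1%:M by [].
have commE : A *m D = D *m A <-> forall a b, c a != c b -> A a b = 0.
  split=> [e a b ab|A0].
    have := congr1 (fun M : 'M[R]_n => M a b) e.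
    rewrite /D mul_mx_diag mul_diag_mx !mxE => /eqP.
    rewrite mulrC -subr_eq0 -mulrBl mulf_eq0 subr_eq0 eq_sym (negPf ab).
    by move/eqP.
  apply/matrixP => a b; rewrite /D mul_mx_diag mul_diag_mx !mxE.
  have [->|ab] := eqVneq (c a) (c b); first by rewrite mulrC.
  by rewrite A0 // mul0r mulr0.
rewrite -commE; have AtA : A^T *m A = 1%:M by exact: mulmx1C.
have -> : isospectral_model A (vsproj _ S) = vsproj _ S <-> A *m S *m A^T = S.
  have -> : A *m S *m A^T = vsval (isospectral_model A (vsproj _ S)).
    by rewrite isospectral_modelE // vsprojK.
  by split=> [->|e]; [rewrite vsprojK|apply: subvs_inj; rewrite e vsprojK].
have -> : A *m S *m A^T = S <-> A *m S = S *m A.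
  by split=> e; [rewrite -[in RHS]e -mulmxA AtA mulmx1|rewrite e -mulmxA oAA mulmx1].
rewrite /S mulmxBr mulmxBl scalar_mxC; split=> [|->//].
by move/(congr1 (fun M => M + (\tr D / n%:R)%:M *m A)); rewrite !subrK.
Qed.

(** In coordinates [block_sym_system] applies; [model_map] is injective and
    equivariant there, and the basis of V carries it back. *)
Lemma model_embeds (R : realType) (n r : nat) (p : 'I_r -> nat)
    (n_ge2 : (2 <= n)%N) (r_ge2 : (2 <= r)%N)
    (p_ge1 : forall i, (1 <= p i)%N) (sum_p : (\sum_(i < r) p i)%N = n)
    (V : vectType R) (rho : 'M[R]_n -> 'End(V)) :
  is_SO_representation rho ->
  (exists v : V, stabilizer rho v = special_block_orthogonal_group sum_p) ->
  (\dim {:V} <= (n + 2) * (n - 1) %/ 2)%N ->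
  exists2 psi : 'Hom(subvs_of (traceless_sym R n), V), lker psi == 0%VS &
    forall A T, special_orthogonal_group A ->
      psi (isospectral_model A T) = rho A (psi T).
Proof.
move=> rep [v stabv] dV.
have n0 : (0 < n)%N by apply: leq_trans n_ge2.
have [blk [blk_onto blockP]] := @block_orthogonalP R n r p sum_p p_ge1.
have [i0 hi0] := blk_onto (Ordinal (leq_trans (leqnSn 1) r_ge2)).
have [i1 hi1] := blk_onto (Ordinal r_ge2).
have ne : blk i0 != blk i1 by rewrite hi0 hi1 -val_eqE.
have rsg := coord_rep_is_matrix_rep rep.
have stab A : special_orthogonal_group A ->
    (coord_rep rho A *m coord_vec v = coord_vec v <->
     forall a b, blk a != blk b -> A a b = 0).
  move=> oA; rewrite coord_rep_vec.
  have -> : coord_vec (rho A v) = coord_vec v <-> stabilizer rho v A.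
    by split=> [/coord_vec_inj|[_ ->]].
  by rewrite stabv blockP; split=> [[]|].
have [om som] := block_sym_system rsg ne stab n_ge2 dV.
have [psi psiE] : exists f : 'Hom(subvs_of (traceless_sym R n), V),
    f =1 fun T => passmx.vecof (vbasis fullv) (model_map om (vsval T))^T.
  apply: lfun_of_linear => a S T.
  have -> : model_map om (vsval (a *: S + T)) = a *: model_map om (vsval S) + model_map om (vsval T).
    by rewrite [vsval _]linearP model_mapD model_mapZ.
  by rewrite [X in passmx.vecof _ X]linearP; exact: passmx.vecof_linear.
have psi_coord T : coord_vec (psi T) = model_map om (vsval T).
  by rewrite psiE /coord_vec passmx.vecofK ?vbasisP // trmxK.
exists psi => [|A T oA].
  apply/lker0P => S T e; apply/eqP; rewrite -subr_eq0; apply/eqP.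
  apply: subvs_inj; rewrite linear0.
  have := subvsP (S - T); rewrite mem_traceless_sym => /andP[/eqP sST /eqP tST].
  apply: (model_map_injective rsg som n0 sST tST).
  rewrite -psi_coord linearB /= e subrr /coord_vec.
  suff -> : passmx.rVof (vbasis (@fullv R V)) 0 = 0 by rewrite trmx0.
  by apply/eqP; rewrite passmx.rVof_eq0 ?vbasisP.
apply: coord_vec_inj; rewrite psi_coord isospectral_modelE //.
by rewrite (model_map_SO rsg som) // -coord_rep_vec psi_coord.
Qed.

Theorem theorem1p5 (R : realType) (n r : nat) (p : 'I_r -> nat)
    (n_ge2 : (2 <= n)%N) (r_ge2 : (2 <= r)%N)
    (p_ge1 : forall i, (1 <= p i)%N)
    (sum_p : (\sum_(i < r) p i)%N = n) :
  let K := @special_block_orthogonal_group R n r p sum_p in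
  let Sym0 := subvs_of (traceless_sym R n) in
  [/\ is_SO_representation (@isospectral_model R n),
      exists v : Sym0, stabilizer (@isospectral_model R n) v = K,
      \dim {:Sym0} = ((n + 2) * (n - 1) %/ 2)%N,
      forall (V : vectType R) (rho : 'M[R]_n -> 'End(V)),
        is_SO_representation rho -> (exists v : V, stabilizer rho v = K) ->
        (\dim {:Sym0} <= \dim {:V})%N
    & forall (V : vectType R) (rho : 'M[R]_n -> 'End(V)),
        is_SO_representation rho -> (exists v : V, stabilizer rho v = K) ->
        \dim {:V} = \dim {:Sym0} ->
        SO_isomorphic rho (@isospectral_model R n)].
Proof.
move=> K Sym0; have n0 : (0 < n)%N by apply: leq_trans n_ge2.
have dS : \dim {:Sym0} = ((n + 2) * (n - 1) %/ 2)%N by exact: dim_traceless_sym.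
have dim_psi (V : vectType R) (psi : 'Hom(Sym0, V)) : lker psi == 0%VS ->
    \dim (limg psi) = \dim {:Sym0}.
  by move=> /eqP k0; apply: limg_dim_eq; rewrite k0 capv0.
split=> //.
- exact: isospectral_model_rep.
- have [blk [_ blockP]] := @block_orthogonalP R n r p sum_p p_ge1.
  have [v vP] := @diagonal_model_vector R n (fun i => (val (blk i))%:R) n0.
  exists v; apply/seteqP; split=> A.
    move=> [oA /vP -/(_ oA) hA]; apply/blockP; split=> // a b ab.
    by apply: hA; rewrite eqr_nat val_eqE.
  move=> /blockP[oA hA]; split=> //; apply/vP => // a b.
  by rewrite eqr_nat val_eqE => /hA.
- move=> V rho rep stab; rewrite dS.
  have [//|dV] := orP (leq_total ((n + 2) * (n - 1) %/ 2) (\dim {:V})).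
  have [psi psi0 _] := model_embeds n_ge2 r_ge2 p_ge1 rep stab dV.
  by rewrite -dS -(dim_psi _ _ psi0); exact/dimvS/subvf.
move=> V rho rep stab dV.
have [|psi psi0 psi_equiv] := model_embeds n_ge2 r_ge2 p_ge1 rep stab.
  by rewrite dV dS.
have limg_psi : limg psi = fullv.
  by apply/eqP; rewrite eqEdim subvf /= (dim_psi _ _ psi0) dV leqnn.
have psiK := lker0_lfunK psi0.
have psiVK : cancel (psi^-1)%VF psi by move=> u; rewrite limg_lfunVK // limg_psi memvf.
exists (psi^-1)%VF; first by exists psi.
by move=> A u oA; apply: (can_inj psiK); rewrite psi_equiv // !psiVK.
Qed.
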